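(* Consider the planar nonsmooth Liénard system $$(\dot x,\dot y)=\begin{cases}(F^+(x)-y,\ g^+(x)) & \text{if } x>0,\\ (F^-(x)-y,\ g^-(x)) & \text{if } x<0,\end{cases}$$ where $f^\pm,g^\pm:\mathbb{R}\to\mathbb{R}$ are smooth and $F^\pm(x):=\int_0^x f^\pm(s)\,ds$. Assume that $f^+(x)>0$ for $x>0$ and $f^-(x)<0$ for $x<0$, that the (finite) limits $$\lim_{p\to0^+}\frac{g^\pm(x^\pm(p))}{f^\pm(x^\pm(p))}=\eta^\pm$$ exist, and that $$\frac{g^+(x^+(p))}{f^+(x^+(p))}=\frac{g^-(x^-(p))}{f^-(x^-(p))}$$ for all $p>0$ at which both sides are defined, i.e. for all $0<p<\min\{p^+,p^-\}$. If the system has a crossing periodic orbit, then there exists a periodic annulus including this crossing periodic orbit; that is, the system has no crossing limit cycles.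
   Context: Solutions through points of the $y$-axis: since $F^\pm(0)=0$, $\dot x=-y$ on the $y$-axis. If $g^+(0)=g^-(0)$, then $\dot y=g^+(0)$ on the $y$-axis and the vector field is continuous; if $g^+(0)\neq g^-(0)$, solutions through points of the $y$-axis are defined by the Filippov convention. Thus orbits cross the positive $y$-axis from right to left and the negative $y$-axis from left to right. The origin is an equilibrium (a boundary equilibrium if $g^+(0)g^-(0)=0$, a pseudo-equilibrium if $g^+(0)g^-(0)<0$) when $g^+(0)g^-(0)\le 0$, and a regular point when $g^+(0)g^-(0)>0$. A crossing periodic orbit is a periodic orbit that intersects both $\{x>0\}$ and $\{x<0\}$; a crossing limit cycle is an isolated crossing periodic orbit. A periodic annulus including a crossing periodic orbit $\Gamma$ is a neighborhood of $\Gamma$ filled with crossing periodic orbits. Definition of $x^\pm(p)$: let $p(x):=F^+(x)$ for $x\ge 0$ and $p(x):=F^-(x)$ for $x<0$, and let $p^\pm\in(0,+\infty]$ be the limits of $p(x)$ as $x\to\pm\infty$. Under the sign assumption on $f^\pm$, $p$ is strictly increasing on $[0,\infty)$ and strictly decreasing on $(-\infty,0]$; $x^+:[0,p^+)\to[0,+\infty)$ and $x^-:[0,p^-)\to(-\infty,0]$ denote the corresponding strictly increasing, respectively strictly decreasing, inverse functions. *)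

(* Defs.v *)
From HB Require Import structures.
From mathcomp Require Import all_boot all_order all_algebra.
From mathcomp Require Import all_classical all_reals all_analysis.
Import Order.TTheory GRing.Theory Num.Theory.
Import numFieldNormedType.Exports.

Set Implicit Arguments.
Unset Strict Implicit.
Unset Printing Implicit Defensive.

Local Open Scope classical_set_scope.
Local Open Scope ring_scope.

Definition smooth (R : realType) (f : R -> R) : Prop :=
  forall (n : nat) (x : R), derivable (f^`(n)%classic) x 1.

(* The oriented integral of f from 0 to x (negative x included). *)
Definition primitive0 (R : realType) (f : R -> R) (x : R) : R :=
  if 0 <= x then \int[lebesgue_measure]_(s in `[0, x]) f s
  else - \int[lebesgue_measure]_(s in `[x, 0]) f s.

(* p^+ and p^-: pplus is applied to f^+ and pminus to f^-. Both limits exist in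
   ]0, +oo] when f^+ > 0 on ]0, +oo[ and f^- < 0 on ]-oo, 0[. *)
Definition pplus (R : realType) (f : R -> R) : \bar R :=
  lim ((primitive0 f x)%:E @[x --> +oo]).

Definition pminus (R : realType) (f : R -> R) : \bar R :=
  lim ((primitive0 f x)%:E @[x --> -oo]).

(* x^+ and x^-, inverting F^+ on [0, +oo[ and F^- on ]-oo, 0]; outside the range
   of the inverted function the value is a meaningless 0. *)
Definition xplus (R : realType) (f : R -> R) : R -> R :=
  'pinv_(fun=> 0) `[0, +oo[ (primitive0 f).

Definition xminus (R : realType) (f : R -> R) : R -> R :=
  'pinv_(fun=> 0) `]-oo, 0] (primitive0 f).

Definition lienard_field (R : realType) (f g : R -> R) (q : R * R) : R * R :=
  (primitive0 f q.1 - q.2, g q.1).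

(* Filippov's set-valued field of (Zp if x > 0, Zm if x < 0): on the y-axis it
   is the segment joining the two one-sided values (a single vector when these
   agree). *)
Definition filippov_field (R : realType) (Zp Zm : R * R -> R * R) (q : R * R) :
    set (R * R) :=
  if 0 < q.1 then [set Zp q]
  else if q.1 < 0 then [set Zm q]
  else [set l *: Zp q + (1 - l) *: Zm q | l in `[0, 1]].

Definition lienard_inclusion (R : realType) (fp fm gp gm : R -> R) :
    R * R -> set (R * R) :=
  filippov_field (lienard_field fp gp) (lienard_field fm gm).

Definition absolutely_continuous_on (R : realType) (V : normedModType R)
    (a b : R) (z : R -> V) : Prop :=
  forall e : R, 0 < e -> exists2 d : R, 0 < d &
    forall (n : nat) (s t : 'I_n -> R),
      (forall i, [/\ a <= s i, s i <= t i & t i <= b]) ->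
      trivIset [set: 'I_n] (fun i => `]s i, t i[%classic) ->
      \sum_(i < n) (t i - s i) < d ->
      \sum_(i < n) `|z (t i) - z (s i)| < e.

Definition filippov_solution (R : realType) (K : R * R -> set (R * R))
    (z : R -> R * R) : Prop :=
  (forall a b : R, absolutely_continuous_on a b z) /\
  {ae lebesgue_measure, forall t : R, derivable z t 1 /\ K (z t) (z^`()%classic t)}.

Definition equilibrium (R : realType) (K : R * R -> set (R * R)) (q : R * R) :
    Prop :=
  K q 0.

(* A (pseudo- or boundary) equilibrium is an orbit by itself, so a periodic
   orbit contains none; this also excludes closed curves made of solutions that
   reach the equilibrium in finite time, and constant solutions. *)
Definition periodic_orbit (R : realType) (K : R * R -> set (R * R))
    (G : set (R * R)) : Prop :=
  exists (z : R -> R * R) (T : R),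
    [/\ filippov_solution K z, 0 < T, forall t, z (t + T) = z t,
        forall t, ~ equilibrium K (z t) & G = range z].

Definition crossing_periodic_orbit (R : realType)
    (K : R * R -> set (R * R)) (G : set (R * R)) : Prop :=
  [/\ periodic_orbit K G,
      exists2 q, G q & 0 < q.1 &
      exists2 q, G q & q.1 < 0].

Definition crossing_limit_cycle (R : realType)
    (K : R * R -> set (R * R)) (G : set (R * R)) : Prop :=
  crossing_periodic_orbit K G /\
  exists2 U : set (R * R), set_nbhs G U &
    forall G', crossing_periodic_orbit K G' -> G' `<=` U -> G' = G.

(* A is a neighborhood of G that is a union of crossing periodic orbits. *)
Definition periodic_annulus (R : realType) (K : R * R -> set (R * R))
    (G A : set (R * R)) : Prop :=
  set_nbhs G A /\
  forall q, A q ->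
    exists G', [/\ crossing_periodic_orbit K G', G' q & G' `<=` A].

(* Main.v *)
(** With p = F(x) as abscissa, both half-systems become, up to a change of time,
    the same planar system p' = p - y, y' = (g/f)(p), traversed in opposite
    directions. Hence (x, y) |-> (x^-(F^+(x)), y) carries an arc of the right
    half-system joining (0, a) to (0, b), with a < 0 < b, onto an arc of the left
    half-system joining (0, b) to (0, a): every right arc on which F^+ stays below
    p^- closes up. By uniqueness of solutions away from the origin, which is always
    an equilibrium, the given periodic orbit is such a doubled arc, and by continuous
    dependence and transversality at the y-axis the neighbouring right arcs double
    up into crossing periodic orbits filling a neighborhood. If the maximum of F
    along the right arc of the orbit exceeds the one along its left arc, the
    roles of the two half-planes are exchanged by a reflection. *)

Require Import Defs.
From HB Require Import structures.
From mathcomp Require Import all_boot all_order all_algebra.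
From mathcomp Require Import all_classical all_reals all_analysis.
From mathcomp Require Import measurable_realfun ring lra.
Import Order.TTheory GRing.Theory Num.Theory.
Import numFieldNormedType.Exports.

Set Implicit Arguments.
Unset Strict Implicit.
Unset Printing Implicit Defensive.

Local Open Scope classical_set_scope.
Local Open Scope ring_scope.

(** * Calculus on the real line *)

(** Three difficulties shape the proof. A Filippov solution is only absolutely continuous and
    satisfies the inclusion only almost everywhere. Its first component nevertheless has a
    continuous derivative at all times, because [F1 0 = F2 0 = 0] makes the first component of the
    field continuous across the y-axis; its second component is differentiable off the axis. Both
    facts come from a mean value inequality that ignores null sets. On the axis the derivative of x
    is -y, and it is nonzero because the origin is an equilibrium: otherwise g^+(0) and g^-(0) would
    have the same strict sign, and the two ratios g/f opposite signs near p = 0. Finally, the change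
    of time between the two sides may be singular at the ends of an arc, since f may vanish at x =
    0. No return map is needed: only right arcs are perturbed, and the left arc closing each of them
    comes from the transfer, with the same end points by construction. Uniqueness is used only
    forward in time, as the orbits compared are periodic. *)

(** The supremum of the [c] with [P a c] is attained and cannot lie before [b]. This is compactness
    of the segment in the form used for all passages from local to global below: tagged partitions,
    tubes, Lipschitz bounds and uniqueness. *)
Lemma cousin (R : realType) (a b : R) (P : R -> R -> Prop) : a <= b ->
  (forall t : R, a <= t <= b -> exists2 d : R, 0 < d &
     forall s u : R, a <= s -> u <= b -> t - d < s -> s <= t -> t <= u -> u < t + d ->
       P s u) ->
  (forall s t u : R, s <= t -> t <= u -> P s t -> P t u -> P s u) -> P a b.
Proof.
move=> ab loc tr; pose S := [set c | a <= c <= b /\ P a c].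
have Sa : S a.
  split; first by rewrite lexx.
  have [|d d0 h] := loc a; first by rewrite lexx.
  by apply: h; lra.
have Sub : ubound S b by move=> c [/andP[]].
have supS : has_sup S by split; [exists a|exists b].
have ats : a <= sup S by apply: ub_le_sup => //; exists b.
have stb : sup S <= b by apply: ge_sup => //; exists a.
have [|d d0 h] := loc (sup S); first by rewrite ats.
have [c [/andP[ac cb] Pac] ltc] := sup_adherent d0 supS.
have csup : c <= sup S by apply: ub_le_sup => //; [exists b|split => //; rewrite ac].
have step u : sup S <= u -> u < sup S + d -> u <= b -> P a u.
  by move=> su ud ub; apply: (tr a c u) => //; [lra|apply: h => //; lra].
have [bd|db] := ltP b (sup S + d); first exact: step.
have : S (sup S + d / 2).
  by split; [apply/andP; split; lra|apply: step; lra].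
move/(ub_le_sup (ex_intro _ b Sub)); lra.
Qed.

Lemma cvg_realP (R : realType) (f : R -> R) (t l : R) :
  f x @[x --> t] --> l <->
  forall e : R, 0 < e -> exists2 d : R, 0 < d & forall u : R, `|u - t| < d -> `|f u - l| < e.
Proof.
split=> [/cvgrPdist_lt h e e0|h].
  have /nbhs_ballP[d /= d0 hd] := h e e0.
  exists d => // u ud; rewrite distrC; apply: hd.
  by rewrite /ball /= distrC.
apply/cvgrPdist_lt => e /h[d d0 hd].
by apply/nbhs_ballP; exists d => //= u; rewrite /ball /= distrC => /hd; rewrite distrC.
Qed.

Lemma is_deriveP (R : realType) (f : R -> R) (t d : R) :
  is_derive t (1 : R) f d <->
  forall e : R, 0 < e -> exists2 r : R, 0 < r &
    forall u : R, `|u - t| < r -> `|f u - f t - d * (u - t)| <= e * `|u - t|.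
Proof.
split=> [[df fd] e e0|h].
  have : h^-1 *: (f (h *: (1 : R) + t) - f t) @[h --> 0^'] --> d.
    by rewrite -fd; exact: df.
  move/cvgrPdist_lt => /(_ e e0) /nbhs_ballP[r /= r0 hr].
  exists r => // u ur; have [->|ut] := eqVneq u t.
    by rewrite !subrr mulr0 subrr normr0 mulr0.
  have ut0 : u - t != 0 by rewrite subr_eq0.
  have := hr (u - t); rewrite /ball /= sub0r normrN => /(_ ur ut0).
  have -> : (u - t) *: (1 : R) + t = u by rewrite /GRing.scale /=; ring.
  rewrite /GRing.scale /= => he.
  have -> : f u - f t - d * (u - t) = - ((d - (u - t)^-1 * (f u - f t)) * (u - t)).
    by field.
  by rewrite normrN normrM ler_wpM2r // ltW.
have cv : h^-1 *: (f (h *: (1 : R) + t) - f t) @[h --> 0^'] --> d.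
  apply/cvgrPdist_lt => e e0.
  have [r r0 hr] := h (e / 2) (divr_gt0 e0 (ltr0Sn _ _)).
  apply/nbhs_ballP; exists r => //= v; rewrite /ball /= sub0r normrN => vr v0.
  have := hr (v + t); rewrite addrK => /(_ vr).
  rewrite /GRing.scale /= mulr1 => he.
  have -> : d - v^-1 * (f (v + t) - f t) = - (v^-1 * (f (v + t) - f t - d * v)).
    by field.
  rewrite normrN normrM normfV.
  apply: (@le_lt_trans _ _ (e / 2)); last lra.
  by rewrite mulrC ler_pdivrMr ?normr_gt0.
by split; [apply/cvg_ex; exists d|apply/cvg_lim].
Qed.

Lemma is_derive_near (R : realType) (f g : R -> R) (t d r : R) : 0 < r ->
  (forall u : R, `|u - t| < r -> f u = g u) ->
  is_derive t (1 : R) f d -> is_derive t (1 : R) g d.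
Proof.
move=> r0 fg /is_deriveP fd; apply/is_deriveP => e /fd[r' r'0 h].
exists (Num.min r r') => [|u]; first by rewrite lt_min r0.
rewrite lt_min => /andP[ur ur'].
by rewrite -(fg u)// -(fg t) ?subrr ?normr0//; exact: h.
Qed.

Lemma is_derive_cont (R : realType) (f : R -> R) (t d : R) :
  is_derive t (1 : R) f d -> {for t, continuous f}.
Proof. by move=> [df _]; apply/differentiable_continuous/derivable1_diffP. Qed.

Lemma MVT_pt (R : realType) (f df : R -> R) (a b : R) : a < b ->
  (forall t : R, a <= t <= b -> {for t, continuous f}) ->
  (forall t : R, a < t < b -> is_derive t (1 : R) f (df t)) ->
  exists2 c : R, a < c < b & f b - f a = df c * (b - a).
Proof.
move=> ab cf dfP; have dfP' x : x \in `]a, b[%R -> is_derive x 1 f (df x).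
  by rewrite in_itv /= => /dfP.
have cf' : {within `[a, b], continuous f}.
  by apply: continuous_in_subspaceT => x; rewrite inE /= in_itv /= => /cf.
by have [c + ->] := MVT ab dfP' cf'; rewrite in_itv /=; exists c.
Qed.

Lemma deriv_ge0_le (R : realType) (f df : R -> R) (a b : R) : a <= b ->
  (forall t : R, a <= t <= b -> {for t, continuous f}) ->
  (forall t : R, a < t < b -> is_derive t (1 : R) f (df t)) ->
  (forall t : R, a < t < b -> 0 <= df t) -> f a <= f b.
Proof.
rewrite le_eqVlt => /predU1P[->//|ab] cf dfP df0.
have [c cab E] := MVT_pt ab cf dfP.
by rewrite -subr_ge0 E mulr_ge0 ?df0// subr_ge0 ltW.
Qed.

Lemma deriv_gt0_lt (R : realType) (f df : R -> R) (a b : R) : a < b ->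
  (forall t : R, a <= t <= b -> {for t, continuous f}) ->
  (forall t : R, a < t < b -> is_derive t (1 : R) f (df t)) ->
  (forall t : R, a < t < b -> 0 < df t) -> f a < f b.
Proof.
move=> ab cf dfP df0; have [c cab E] := MVT_pt ab cf dfP.
by rewrite -subr_gt0 E mulr_gt0 ?df0// subr_gt0.
Qed.

(** Integrating from [- N], to the left of both 0 and [x], turns the two cases of [primitive0] into
    the single difference [G y - G 0]. *)
Lemma primitive0_is_derive (R : realType) (f : R -> R) : continuous f ->
  forall x, is_derive x (1 : R) (primitive0 f) (f x).
Proof.
move=> cf x; pose N := `|x| + 1; pose mu := @lebesgue_measure R.
have N0 : - N < 0 by rewrite /N; have := normr_ge0 x; lra.
have Nx : - N + 1 <= x by rewrite /N opprD subrK lerNl -normrN; exact: ler_norm.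
have intf u v : mu.-integrable `[u, v] (EFin \o f).
  apply: continuous_compact_integrable; first exact: segment_compact.
  exact: continuous_subspaceT.
pose G y := (\int[mu]_(t in `[- N, y]) f t)%R.
have GB y z : - N <= y -> y <= z -> G z - G y = (\int[mu]_(t in `[y, z]) f t)%R.
  move=> Ny yz; rewrite /G Rintegral_itvB ?bnd_simp//.
    by apply: Rintegral_itv_obnd_cbnd; apply: integrableS (intf y z) => //;
      exact: subset_itv_oc_cc.
have GE y : - N <= y -> primitive0 f y = G y - G 0.
  move=> Ny; rewrite /primitive0; case: leP => y0.
    by rewrite GB// ltW.
  by rewrite -(GB y 0 Ny (ltW y0)) opprB.
have [|dG G'] := continuous_FTC1_closed (ltr_pwDr ltr01 (lexx x)) (intf (- N) (x + 1)) _ (cf x).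
  by lra.
have dGx : is_derive x (1 : R) G (f x).
  by split; [exact: dG|rewrite -derive1E; exact: G'].
apply: (@is_derive_near _ (fun y => G y - G 0) _ _ _ 1 ltr01).
  move=> u; rewrite ltr_distl => /andP[ux _]; rewrite GE//.
  by apply: le_trans (ltW ux); rewrite lerBrDr.
rewrite -[f x]subr0; exact: (is_deriveB dGx (is_derive_cst (G 0) x 1)).
Qed.

(** Composition with this retraction makes a locally Lipschitz field globally Lipschitz without
    changing it on the segment. *)
Definition clamp (R : realType) (a b x : R) : R := Num.max a (Num.min b x).

Lemma clamp_itv (R : realType) (a b x : R) : a <= b -> a <= clamp a b x <= b.
Proof.
by move=> ab; rewrite /clamp /Num.max /Num.min; case: (ltP b x) => ?; case: ltP => ?;
  apply/andP; split; lra.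
Qed.

Lemma clamp_id (R : realType) (a b x : R) : a <= x <= b -> clamp a b x = x.
Proof. by move=> /andP[ax xb]; rewrite /clamp /Num.max /Num.min; case: (ltP b x) => ?;
  case: ltP => ?; lra. Qed.

Lemma clamp_lip (R : realType) (a b x y : R) : a <= b ->
  `|clamp a b x - clamp a b y| <= `|x - y|.
Proof.
move=> ab; have h1 := ler_norm (x - y); have := ler_norm (y - x).
rewrite distrC => h2; rewrite ler_norml /clamp /Num.max /Num.min.
by case: (ltP b x) => ?; case: (ltP b y) => ?; do 2!case: ltP => ?; apply/andP; split; lra.
Qed.

Lemma lip_cont (R : realType) (f : R -> R) (L : R) :
  (forall x y : R, `|f x - f y| <= L * `|x - y|) -> continuous f.
Proof.
move=> fL x; apply/cvg_realP => e e0.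
have L0 : 0 < `|L| + 1 by have := normr_ge0 L; lra.
exists (e / (`|L| + 1)); first exact: divr_gt0.
move=> u ux; apply: le_lt_trans (fL _ _) _.
apply: (@le_lt_trans _ _ ((`|L| + 1) * `|u - x|)).
  by apply: ler_wpM2r => //; have := ler_norm L; lra.
by rewrite mulrC -ltr_pdivlMr.
Qed.

Lemma clamp_cont (R : realType) (a b : R) : a <= b -> continuous (clamp a b).
Proof. by move=> ab; apply: (@lip_cont _ _ 1) => x y; rewrite mul1r clamp_lip. Qed.

(** As [u] may blow up at both ends, the integral is based at the midpoint. Around a given [t0],
    clamping the argument of [u] to a compact [[c, d]] that contains [t0] and the midpoint does not
    change the integral and gives a continuous integrand. *)
Lemma antiderivative_oo (R : realType) (u : R -> R) (a b : R) : a < b ->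
  (forall t : R, a < t < b -> {for t, continuous u}) ->
  exists U, forall t : R, a < t < b -> is_derive t (1 : R) U (u t).
Proof.
move=> ab cu; pose m := (a + b) / 2.
exists (fun t => primitive0 (fun s => u (s + m)) (t - m)) => t0 /andP[at0 t0b].
have [c [ac ct0 cm]] : exists c, [/\ a < c, c < t0 & c < m].
  exists ((a + Num.min t0 m) / 2); rewrite /m.
  by split; case: (leP t0 ((a + b) / 2)) => ?; lra.
have [d [db dt0 dm]] : exists d, [/\ d < b, t0 < d & m < d].
  exists ((b + Num.max t0 m) / 2); rewrite /m.
  by split; case: (leP t0 ((a + b) / 2)) => ?; lra.
have cd : c <= d by lra.
pose v s := u (clamp c d (s + m)).
have cv : continuous v.
  move=> s; rewrite /v; apply: (@continuous_comp _ _ _ (fun s => clamp c d (s + m)) u).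
    apply: (@continuous_comp _ _ _ (fun s => s + m) (clamp c d)); last exact: clamp_cont.
    by apply: cvgD; [exact: cvg_id|exact: cvg_cst].
  by apply: cu; have := clamp_itv (s + m) cd; lra.
have E t : c <= t <= d -> primitive0 (fun s => u (s + m)) (t - m) = primitive0 v (t - m).
  move=> ctd; rewrite /primitive0; case: leP => tm; [|congr (- _)];
  apply: eq_Rintegral => s; rewrite inE /= in_itv /= => sm; rewrite /v clamp_id//; lra.
apply: (@is_derive_near _ (fun t => primitive0 v (t - m)) _ _ _ (Num.min (t0 - c) (d - t0))).
- by rewrite lt_min !subr_gt0 ct0.
- by move=> t; rewrite lt_min !ltr_distl => /andP[/andP[? ?] /andP[? ?]]; rewrite E//; lra.
have H := primitive0_is_derive cv (t0 - m).
have -> : u t0 = v (t0 - m) * 1 by rewrite /v subrK clamp_id ?mulr1//; lra.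
have H2 : is_derive t0 (1 : R) (fun t => t - m) 1 by apply: is_derive_eq; rewrite subr0.
by apply: (@is_derive1_comp _ (primitive0 v) (fun t => t - m)).
Qed.

Lemma ivt_pt (R : realType) (f : R -> R) (a b v : R) : a <= b ->
  (forall t : R, a <= t <= b -> {for t, continuous f}) -> f a <= v <= f b ->
  exists2 c : R, a <= c <= b & f c = v.
Proof.
move=> ab cf /andP[av vb].
have cf' : {within `[a, b], continuous f}.
  by apply: continuous_in_subspaceT => x; rewrite inE /= in_itv /= => /cf.
have vI : Num.min (f a) (f b) <= v <= Num.max (f a) (f b) by rewrite ge_min le_max av vb orbT.
by have [c + <-] := IVT ab cf' vI; rewrite in_itv /=; exists c.
Qed.

(** The inverse is chosen pointwise and is 0 off the range of [h]. This does no harm: by the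
    intermediate value theorem the range is a neighborhood of each [h x]. *)
Lemma strict_mono_inverse (R : realType) (h : R -> R) :
  {homo h : x y / x < y} -> continuous h ->
  exists k : R -> R, [/\ forall x : R, k (h x) = x,
    forall x : R, {for h x, continuous k} &
    forall x d : R, is_derive x (1 : R) h d -> d != 0 ->
      is_derive (h x) (1 : R) k d^-1].
Proof.
move=> hm ch; have hi : injective h.
  by move=> x y hxy; case: (ltgtP x y) => // /hm; rewrite hxy ltxx.
pose k (p : R) : R := xget (0 : R) [set x : R | h x = p].
have kh x : k (h x) = x.
  by apply: hi; apply: (@xgetPex _ 0 [set y | h y = h x]); exists x.
clearbody k; exists k; split => // [x|x d hd d0].
  apply/cvg_realP => e e0.
  have h1 : h (x - e) < h x by apply: hm; lra.
  have h2 : h x < h (x + e) by apply: hm; lra.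
  exists (Num.min (h x - h (x - e)) (h (x + e) - h x)).
    by rewrite lt_min !subr_gt0 h1.
  move=> p; rewrite lt_min !ltr_distl => /andP[/andP[? ?] /andP[? ?]].
  have [c cx hc] : exists2 c, x - e <= c <= x + e & h c = p.
    by apply: ivt_pt; [lra|move=> t _; exact: ch|apply/andP; split; lra].
  rewrite -hc !kh !lt_neqAle -andbA; case/andP: cx => -> ->; rewrite !andbT.
  by apply/andP; split; apply/eqP => E; [rewrite -E in hc|rewrite E in hc]; lra.
by apply: is_derive_inverse => //; near=> y.
Unshelve. all: by end_near. Qed.

(** [D t * expR (- K * t)] is nonincreasing and [D t * expR (K * t)] nondecreasing. The two bounds
    control solutions forwards and backwards in time. *)
Lemma gronwall (R : realType) (D dD : R -> R) (K a b : R) : a <= b ->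
  (forall t : R, a <= t <= b -> {for t, continuous D}) ->
  (forall t : R, a < t < b -> is_derive t (1 : R) D (dD t)) ->
  (forall t : R, a < t < b -> `|dD t| <= K * D t) ->
  D b <= D a * expR (K * (b - a)) /\ D a <= D b * expR (K * (b - a)).
Proof.
move=> ab cD dDP dDK.
have ce s : forall t : R, is_derive t (1 : R) (fun t => expR (s * t)) (s * expR (s * t)).
  move=> t; have H : is_derive t (1 : R) (fun t => s * t) s.
    by apply: is_derive_eq; rewrite /GRing.scale /= mulr1.
  by rewrite mulrC; apply: (@is_derive1_comp _ expR (fun t => s * t)).
split.
- have : - (D a * expR (- K * a)) <= - (D b * expR (- K * b)).
    apply: (@deriv_ge0_le _ (fun t => - (D t * expR (- K * t)))
      (fun t => - (D t * (- K * expR (- K * t)) + expR (- K * t) * dD t)) _ _ ab) => t tab.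
    + by apply: continuousN; apply: continuousM; [exact: cD|exact: is_derive_cont (ce _ _)].
    + exact: (is_deriveN (is_deriveM (dDP _ tab) (ce (- K) t))).
    + have := dDK _ tab; rewrite ler_norml => /andP[_ h].
      have -> : - (D t * (- K * expR (- K * t)) + expR (- K * t) * dD t) =
        (K * D t - dD t) * expR (- K * t) by ring.
      by apply: mulr_ge0; [lra|exact: expR_ge0].
  rewrite lerN2 => h.
  have -> : K * (b - a) = - K * a - (- K * b) by ring.
  by rewrite expRD expRN mulrA ler_pdivlMr ?expR_gt0.
- have : (D a * expR (K * a)) <= (D b * expR (K * b)).
    apply: (@deriv_ge0_le _ (fun t => (D t * expR (K * t)))
      (fun t => (D t * (K * expR (K * t)) + expR (K * t) * dD t)) _ _ ab) => t tab.
    + by apply: continuousM; [exact: cD|exact: is_derive_cont (ce _ _)].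
    + exact: (is_deriveM (dDP _ tab) (ce K t)).
    + have := dDK _ tab; rewrite ler_norml => /andP[h _].
      have -> : (D t * (K * expR (K * t)) + expR (K * t) * dD t) =
        (K * D t + dD t) * expR (K * t) by ring.
      by apply: mulr_ge0; [lra|exact: expR_ge0].
  move=> h; rewrite mulrBr expRD expRN mulrA ler_pdivlMr ?expR_gt0//.
Qed.

(** * Absolutely continuous functions *)

(** Lists, rather than families indexed by ['I_n], let the intervals collected on two adjacent
    pieces be joined by concatenation. *)
Fixpoint chain (R : realType) (s : R) (l : seq (R * R)) (u : R) : Prop :=
  if l is p :: l' then [/\ s <= p.1, p.1 <= p.2 & chain p.2 l' u] else s <= u.

Lemma chain_cat (R : realType) (s t u : R) (l l' : seq (R * R)) :
  chain s l t -> chain t l' u -> chain s (l ++ l') u.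
Proof.
elim: l s => [|p l IH] s /= => [st|[sp pp /IH h]].
  by case: l' => [|q l'] /=; [exact: le_trans|move=> [? ? ?]; split => //;
    exact: le_trans st _].
by move=> /h; split.
Qed.

Lemma chain_le (R : realType) (s u : R) (l : seq (R * R)) : chain s l u -> s <= u.
Proof.
by elim: l s => //= p l IH s [sp pp /IH]; apply: le_trans; exact: le_trans pp.
Qed.

Lemma chain_nth (R : realType) (s u : R) (l : seq (R * R)) : chain s l u ->
  forall i, (i < size l)%N ->
  [/\ s <= (nth (0, 0) l i).1, (nth (0, 0) l i).1 <= (nth (0, 0) l i).2,
      (nth (0, 0) l i).2 <= u &
      forall j, (i < j < size l)%N -> (nth (0, 0) l i).2 <= (nth (0, 0) l j).1].
Proof.
elim: l s => //= p l IH s [sp pp ch] [_|i].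
  split => //=; first exact: chain_le ch.
  by move=> [//|j] /= /(IH _ ch)[].
rewrite ltnS => il /=; have [h1 h2 h3 h4] := IH _ ch i il; split => //.
  by apply: le_trans h1; exact: le_trans pp.
by move=> [//|j] /=; rewrite !ltnS => /h4.
Qed.

Lemma ac_chain (R : realType) (f : R -> R) (a b : R) :
  absolutely_continuous_on a b (f : R -> R) ->
  forall e : R, 0 < e -> exists2 d : R, 0 < d &
    forall l, chain a l b -> \sum_(p <- l) (p.2 - p.1) < d ->
      \sum_(p <- l) `|f p.2 - f p.1| < e.
Proof.
move=> acf e /acf[d d0 h]; exists d => // l cl; rewrite !(big_nth (0, 0)) !big_mkord => ld.
have cn := chain_nth cl.
apply: (h (size l) (fun i => (nth (0, 0) l i).1) (fun i => (nth (0, 0) l i).2)) => //.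
  by move=> i; have [] := cn i (ltn_ord i).
move=> i j _ _ [x [] /=]; rewrite !in_itv /= => /andP[xi xi'] /andP[xj xj'].
case: (ltngtP i j) => [ij|ji|/val_inj//].
  have [_ _ _ /(_ j)] := cn i (ltn_ord i); rewrite ij ltn_ord => /(_ erefl) H.
  by have := lt_trans xj (lt_le_trans xi' H); rewrite ltxx.
have [_ _ _ /(_ i)] := cn j (ltn_ord j); rewrite ji ltn_ord => /(_ erefl) H.
by have := lt_trans xi (lt_le_trans xj' H); rewrite ltxx.
Qed.

(** This stands in for writing [f] as the integral of its derivative. A tagged partition is cut in
    two: at tags off [N] the derivative controls the increment, and the intervals tagged in [N] have
    small total length, so that absolute continuity controls theirs. *)
Lemma ac_mean_value (R : realType) (f : R -> R) (N : set R) (a b c e : R) :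
  a <= b -> 0 <= e -> absolutely_continuous_on a b (f : R -> R) ->
  (@lebesgue_measure R).-negligible N ->
  (forall t : R, a <= t <= b -> ~ N t ->
     exists2 d : R, is_derive t (1 : R) f d & `|d - c| <= e) ->
  `|f b - f a - c * (b - a)| <= e * (b - a).
Proof.
move=> ab e0 acf [B [mB B0 NB]] dfP; pose mu := @lebesgue_measure R.
suff H (h : R) : 0 < h -> `|f b - f a - c * (b - a)| <= (e + h) * (b - a) + h * (1 + `|c|).
  apply/ler_addgt0Pr => k k0.
  pose M := (b - a) + 1 + `|c|.
  have M0 : 0 < M by have := normr_ge0 c; rewrite /M; lra.
  have := H (k / M) (divr_gt0 k0 M0).
  have E : k / M * M = k by rewrite divfK// gt_eqF.
  have -> : (e + k / M) * (b - a) + k / M * (1 + `|c|) = e * (b - a) + k / M * M.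
    by rewrite /M; ring.
  by rewrite E.
move=> h0.
have [d d0 hd] := ac_chain acf h0.
pose dd := Num.min d h.
have dd0 : 0 < dd by rewrite lt_min d0.
have [|U [oU BU mUB]] := @lebesgue_regularity_outer R B dd mB _ dd0.
  exact: (eq_ind_r (fun z => (z < +oo)%E) (ltry _) B0).
have mU : measurable U by exact: open_measurable.
have muU : (mu U < dd%:E)%E.
  have E : mu (B `|` (U `\` B)) = (mu B + mu (U `\` B))%E.
    by apply: measureU; [exact: mB|exact: measurableD|exact: setDIK].
  by rewrite -(setDUK BU) E (_ : mu B = 0%E)// add0e.
pose m s u := fine (mu (U `&` `]s, u])).
have mfin s u : mu (U `&` `]s, u]) \is a fin_num.
  rewrite ge0_fin_numE//; apply: le_lt_trans (_ : (mu U < +oo)%E).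
    by apply: le_measure; rewrite ?inE//; exact: measurableI.
  by apply: lt_trans muU _; rewrite ltry.
have mD s t u : s <= t -> t <= u -> m s u = m s t + m t u.
  move=> st tu; rewrite /m -fineD//; congr fine.
  have E : mu ((U `&` `]s, t]) `|` (U `&` `]t, u])) = (mu (U `&` `]s, t]) + mu (U `&` `]t,
    u]))%E.
    apply: measureU; [exact: measurableI|exact: measurableI|].
    rewrite setIACA; apply/seteqP; split => // x [_ []] /=; rewrite !in_itv /=; lra.
  rewrite -E -setIUr; congr (mu (U `&` _)); apply/seteqP.
  by split=> x /=; rewrite !in_itv /=; [case: (leP x t) => ?; [left|right]; lra|case=> ?;
    lra].
have m0 s u : 0 <= m s u by rewrite /m fine_ge0.
have mle : m a b < dd.
  rewrite /m -lte_fin fineK//; apply: le_lt_trans muU.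
  by apply: le_measure; rewrite ?inE//; exact: measurableI.
have msub s u : s <= u -> `]s, u] `<=` U -> u - s = m s u.
  move=> su sU; rewrite /m setIidr// /mu lebesgue_measure_itv /= lte_fin.
  by case: ltP => [_ //|us] /=; lra.
pose P s u := exists l, [/\ chain s l u, \sum_(p <- l) (p.2 - p.1) <= m s u &
  `|f u - f s - c * (u - s)|
    <= (e + h) * (u - s) + \sum_(p <- l) (`|f p.2 - f p.1| + `|c| * (p.2 - p.1))].
(* Intervals tagged by a point of [N] lie in [U] and are collected in [l]; their
   total length is at most the measure of [U]. *)
have : P a b.
  apply: (cousin ab) => [t tab|s t u st tu [l [cl sl fl]] [l' [cl' sl' fl']]]; last first.
    exists (l ++ l'); split; rewrite ?big_cat /=.
    + exact: chain_cat cl cl'.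
    + by rewrite (mD s t u)// lerD.
    + have -> : f u - f s - c * (u - s)
      = (f t - f s - c * (t - s)) + (f u - f t - c * (u - t)) by ring.
      by apply: le_trans (ler_normD _ _) _; lra.
  have [Nt|Nt] := pselect (N t).
    have /nbhs_ballP[r /= r0 rU] : nbhs t U by apply: open_nbhs_nbhs; split => //;
      apply/BU/NB.
    exists r => // s u as_ ub ts st tu ut.
    exists [:: (s, u)]; rewrite !big_cons !big_nil /= !addr0; split.
    + by split => //; exact: le_trans tu.
    + rewrite (msub s u) //; first exact: le_trans tu.
      move=> x /=; rewrite in_itv /= => xsu; apply: rU; rewrite /ball /= ltr_distl; lra.
    + have eu : 0 <= (e + h) * (u - s).
        by apply: mulr_ge0; lra.
      apply: le_trans (ler_normB _ _) _; rewrite normrM (ger0_norm (_ : 0 <= u - s)); lra.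
  have [l fl lc] := dfP t tab Nt.
  have [r r0 hr] := (is_deriveP f t l).1 fl h h0.
  exists r => // s u as_ ub ts st tu ut.
  exists [::]; rewrite !big_nil addr0; split => //=; first exact: le_trans tu.
  have hs : `|f s - f t - l * (s - t)| <= h * (t - s).
    by have := hr s; rewrite distrC (ger0_norm (_ : 0 <= t - s)) 1?distrC; [apply; lra|lra].
  have hu : `|f u - f t - l * (u - t)| <= h * (u - t).
    by have := hr u; rewrite (ger0_norm (_ : 0 <= u - t)); [apply; lra|lra].
  have hc : `|(l - c) * (u - s)| <= e * (u - s).
    by rewrite normrM (ger0_norm (_ : 0 <= u - s)) ?ler_wpM2r//; lra.
  have -> : f u - f s - c * (u - s)
    = (f u - f t - l * (u - t)) - (f s - f t - l * (s - t)) + (l - c) * (u - s) by ring.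
  apply: le_trans (ler_normD _ _) _.
  have := ler_normB (f u - f t - l * (u - t)) (f s - f t - l * (s - t)).
  lra.
move=> [l [cl sl /le_trans]]; apply.
rewrite big_split /= -mulr_sumr.
have sld : \sum_(p <- l) (p.2 - p.1) < d by move: mle sl; rewrite /dd lt_min; lra.
have slh : \sum_(p <- l) (p.2 - p.1) <= h by move: mle sl; rewrite /dd lt_min; lra.
have := hd l cl sld; have : `|c| * \sum_(p <- l) (p.2 - p.1) <= `|c| * h by exact: ler_wpM2l.
lra.
Qed.

(** * Existence and continuous dependence for Lipschitz Lienard fields *)

(** [2 * A / 2 ^+ n] is the tail of the geometric series, so the intervals of this radius about
    [u n] are nested; the limit is the supremum of their left ends. *)
Lemma geometric_cauchy (R : realType) (u : nat -> R) (A : R) :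
  (forall n, `|u n.+1 - u n| <= A / 2 ^+ n) ->
  exists l : R, forall n, `|u n - l| <= 2 * A / 2 ^+ n.
Proof.
move=> uA; have E n : 2 * A / 2 ^+ n.+1 = A / 2 ^+ n.
  by rewrite exprS; field; rewrite expf_eq0 /= pnatr_eq0 andbF.
have E2 n : 2 * A / 2 ^+ n = A / 2 ^+ n + A / 2 ^+ n by ring.
have A0 n : 0 <= A / 2 ^+ n by exact: le_trans (normr_ge0 _) (uA n).
pose lo n := u n - 2 * A / 2 ^+ n; pose hi n := u n + 2 * A / 2 ^+ n.
have loS n : lo n <= lo n.+1.
  by rewrite /lo E E2; have := uA n; rewrite ler_norml => /andP[]; lra.
have hiS n : hi n.+1 <= hi n.
  by rewrite /hi E E2; have := uA n; rewrite ler_norml => /andP[]; lra.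
have lom n k : lo n <= lo (n + k)%N.
  by elim: k => [|k IH]; rewrite ?addn0// addnS; exact: le_trans (loS _).
have him n k : hi (n + k)%N <= hi n.
  by elim: k => [|k IH]; rewrite ?addn0// addnS; exact: le_trans (hiS _) IH.
have lohi n m : lo n <= hi m.
  apply: le_trans (lom n m) _; apply: le_trans (him m n); rewrite addnC /lo /hi.
  by have := A0 (m + n)%N; have := E2 (m + n)%N; lra.
have ub m : ubound (range lo) (hi m) by move=> _ [n _ <-].
have ne : range lo !=set0 by exists (lo 0%N), 0%N.
exists (sup (range lo)) => n; rewrite ler_norml.
have h1 : lo n <= sup (range lo) by apply: ub_le_sup; [exists (hi 0%N)|exists n].
have h2 : sup (range lo) <= hi n by apply: ge_sup.
by move: h1 h2; rewrite /lo /hi => ? ?; apply/andP; split; lra.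
Qed.

Lemma half_pow_small (R : realType) (A e : R) : 0 < e -> exists n, A / 2 ^+ n < e.
Proof.
move=> e0; exists (Num.bound (A / e)).
rewrite ltr_pdivrMr ?exprn_gt0// mulrC -ltr_pdivrMr//.
exact: upper_nthrootP.
Qed.

(** The derivative of [u] is compared with that of the exponential bound, so for nonnegative times
    the bound plus or minus [u] is nondecreasing. Negative times follow by reflection. *)
Lemma exp_growth_bound (R : realType) (u du : R -> R) (A K : R) : 0 <= A ->
  u 0 = 0 -> (forall t, is_derive t (1 : R) u (du t)) ->
  (forall t, `|du t| <= A * (K * expR (K * `|t|))) ->
  forall t, `|u t| <= A * expR (K * `|t|).
Proof.
move=> A0.
have main (v dv : R -> R) : v 0 = 0 -> (forall t, is_derive t (1 : R) v (dv t)) ->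
  (forall t, `|dv t| <= A * (K * expR (K * `|t|))) ->
  forall t, 0 <= t -> `|v t| <= A * expR (K * t).
  move=> v0 dvP dvA t t0.
  have ce s : is_derive s (1 : R) (fun t => expR (K * t)) (K * expR (K * s)).
    have H : is_derive s (1 : R) (fun t => K * t) K.
      by apply: is_derive_eq; rewrite /GRing.scale /= mulr1.
    by rewrite mulrC; apply: (@is_derive1_comp _ expR (fun t => K * t)).
  have d1 s : is_derive s (1 : R) (fun t =>
    A * expR (K * t) - v t) (A * (K * expR (K * s)) - dv s).
    by have := dvP s; have := ce s => H1 H2; apply: is_derive_eq.
  have d2 s : is_derive s (1 : R) (fun t =>
    A * expR (K * t) + v t) (A * (K * expR (K * s)) + dv s).
    by have := dvP s; have := ce s => H1 H2; apply: is_derive_eq.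
  have h1 : A * expR (K * 0) - v 0 <= A * expR (K * t) - v t.
    apply: (deriv_ge0_le t0 (fun s _ => is_derive_cont (d1 s)) (fun s _ => d1 s)) =>
      s /andP[s0 _].
    by have := dvA s; rewrite ler_norml (gtr0_norm s0) => /andP[]; lra.
  have h2 : A * expR (K * 0) + v 0 <= A * expR (K * t) + v t.
    apply: (deriv_ge0_le t0 (fun s _ => is_derive_cont (d2 s)) (fun s _ => d2 s)) =>
      s /andP[s0 _].
    by have := dvA s; rewrite ler_norml (gtr0_norm s0) => /andP[]; lra.
  by move: h1 h2; rewrite mulr0 expR0 v0 ler_norml => ? ?; apply/andP; split; lra.
move=> u0 duP duA t; have [t0|t0] := leP 0 t; first by rewrite (ger0_norm t0) (main u du).
rewrite -[X in u X]opprK (ltr0_norm t0).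
apply: (main (fun s => u (- s)) (fun s => - du (- s))); rewrite ?oppr0//; last lra.
  move=> s; have := duP (- s) => H; rewrite -mulrN1.
  by apply: (@is_derive1_comp _ u (fun s => - s)).
by move=> s; rewrite normrN; apply: le_trans (duA _) _; rewrite normrN.
Qed.

Lemma lip_comp_cont (R : realType) (f g : R -> R) (L : R) :
  (forall x y : R, `|f x - f y| <= L * `|x - y|) -> continuous g ->
  continuous (fun t => f (g t)).
Proof.
by move=> fL cg t; apply: (@continuous_comp _ _ _ g f); [exact: cg|exact: lip_cont fL _].
Qed.

Lemma primitive0_0 (R : realType) (f : R -> R) : primitive0 f 0 = 0.
Proof. by rewrite /primitive0 lexx set_itv1 Rintegral_set1. Qed.

Section Picard.
Variables (R : realType) (Phi Gam : R -> R) (L : R).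
Hypothesis PhiL : forall x y : R, `|Phi x - Phi y| <= L * `|x - y|.
Hypothesis GamL : forall x y : R, `|Gam x - Gam y| <= L * `|x - y|.

Let L0 : 0 <= L.
Proof. by have := le_trans (normr_ge0 _) (PhiL 1 0); rewrite subr0 normr1 mulr1. Qed.

Variables x0 y0 : R.

Fixpoint picard_iter (n : nat) : (R -> R) * (R -> R) :=
  if n is m.+1 then
    let z := picard_iter m in
    (fun t => x0 + primitive0 (fun s => Phi (z.1 s) - z.2 s) t,
     fun t => y0 + primitive0 (fun s => Gam (z.1 s)) t)
  else (fun=> x0, fun=> y0).

Let X n := (picard_iter n).1.
Let Y n := (picard_iter n).2.

Lemma picard_iter_cont n : continuous (X n) /\ continuous (Y n).
Proof.
elim: n => [|n [cX cY]]; first by split; move=> t; exact: cvg_cst.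
have c1 : continuous (fun s => Phi (X n s) - Y n s).
  by move=> t; apply: cvgB; [exact: (lip_comp_cont PhiL cX)|exact: cY].
have c2 : continuous (fun s => Gam (X n s)) by exact: (lip_comp_cont GamL cX).
split=> t; apply: continuousD; try exact: cvg_cst.
  exact: is_derive_cont (primitive0_is_derive c1 t).
exact: is_derive_cont (primitive0_is_derive c2 t).
Qed.

Lemma picard_solution : exists x y : R -> R,
  [/\ x 0 = x0, y 0 = y0, forall t, is_derive t (1 : R) x (Phi (x t) - y t)
    & forall t, is_derive t (1 : R) y (Gam (x t))].
Proof.
(* With an exponential weight of rate [K], one iteration shrinks distances by the factor
   [(L + 1) / K], where [L] comes from [Phi] and 1 from the term -y. This [K] makes the factor
   1/2. *)
have L0p := L0; pose K := 2 * (L + 1); have K1 : 1 <= K by rewrite /K; lra.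
pose C := `|Phi x0 - y0| + `|Gam x0|.
have C0 : 0 <= C by rewrite addr_ge0.
have p20 n : (0 : R) < 2 ^+ n by rewrite exprn_gt0.
have cF n : continuous (fun s => Phi (X n s) - Y n s).
  by move=> t; apply: cvgB;
    [exact: (lip_comp_cont PhiL (picard_iter_cont n).1)|exact: (picard_iter_cont n).2].
have cG n : continuous (fun s => Gam (X n s))
  by exact: (lip_comp_cont GamL (picard_iter_cont n).1).
have dX n t : is_derive t (1 : R) (X n.+1) (Phi (X n t) - Y n t).
  have H := primitive0_is_derive (cF n) t.
  change (is_derive t (1 : R) (fun t => x0 + primitive0 (fun s =>
    Phi (X n s) - Y n s) t) (Phi (X n t) - Y n t)).
  by apply: is_derive_eq; ring.
have dY n t : is_derive t (1 : R) (Y n.+1) (Gam (X n t)).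
  have H := primitive0_is_derive (cG n) t.
  change (is_derive t (1 : R) (fun t => y0 + primitive0 (fun s =>
    Gam (X n s)) t) (Gam (X n t))).
  by apply: is_derive_eq; ring.
have X00 n : X n 0 = x0 by case: n => //= n; rewrite /X /= primitive0_0 addr0.
have Y00 n : Y n 0 = y0 by case: n => //= n; rewrite /Y /= primitive0_0 addr0.
have e1 (t : R) : 1 <= expR (K * `|t|) by rewrite -expR0 ler_expR mulr_ge0//; lra.
(* The weight [expR (K * `|t|)] makes the iteration contract on the whole line. *)
have dist n : forall t, `|X n.+1 t - X n t| <= C / 2 ^+ n * expR (K * `|t|) /\
                        `|Y n.+1 t - Y n t| <= C / 2 ^+ n * expR (K * `|t|).
  elim: n => [|n IH].
    rewrite expr0 divr1.
    have KE (t : R) : C <= C * (K * expR (K * `|t|)).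
      by rewrite ler_peMr// mulr_ege1.
    move=> t; split.
      apply: (@exp_growth_bound _ (fun t => X 1 t - X 0 t) (fun t => Phi x0 - y0)) => //.
      - by rewrite !X00 subrr.
      - by move=> s; apply: (is_derive_eq (is_deriveB (dX 0%N s) (is_derive_cst x0 s 1)));
        rewrite subr0.
      - by move=> s; apply: le_trans (KE s); rewrite /C lerDl.
    apply: (@exp_growth_bound _ (fun t => Y 1 t - Y 0 t) (fun t => Gam x0)) => //.
    - by rewrite !Y00 subrr.
    - by move=> s; apply: (is_derive_eq (is_deriveB (dY 0%N s) (is_derive_cst y0 s 1)));
      rewrite subr0.
    - by move=> s; apply: le_trans (KE s); rewrite /C lerDr.
  have E (t : R) : C / 2 ^+ n.+1 * (K * expR (K * `|t|))
    = (L + 1) * (C / 2 ^+ n * expR (K * `|t|)).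
    by rewrite /K exprS; field; rewrite lt0r_neq0.
  have A0 : 0 <= C / 2 ^+ n.+1 by rewrite divr_ge0// ltW.
  have B0 (t : R) : 0 <= C / 2 ^+ n * expR (K * `|t|)
    by rewrite mulr_ge0 ?expR_ge0 ?divr_ge0// ltW.
  move=> t; split.
    apply: (@exp_growth_bound _ (fun t => X n.+2 t - X n.+1 t)
      (fun t => (Phi (X n.+1 t) - Y n.+1 t) - (Phi (X n t) - Y n t))) => //.
    - by rewrite !X00 subrr.
    - move=> s; rewrite E.
      have [h1 h2] := IH s; have := PhiL (X n.+1 s) (X n s).
      have h3 := ler_wpM2l L0 h1.
      have -> : (Phi (X n.+1 s) - Y n.+1 s) - (Phi (X n s) - Y n s) =
        (Phi (X n.+1 s) - Phi (X n s)) - (Y n.+1 s - Y n s) by ring.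
      move=> h4; apply: le_trans (ler_normB _ _) _; lra.
  apply: (@exp_growth_bound _ (fun t => Y n.+2 t - Y n.+1 t)
    (fun t => Gam (X n.+1 t) - Gam (X n t))) => //.
  - by rewrite !Y00 subrr.
  - move=> s; rewrite E.
    have [h1 h2] := IH s; have := GamL (X n.+1 s) (X n s).
    by have h3 := ler_wpM2l L0 h1; have := B0 s; lra.
have limX (t : R) : exists l : R, forall n,
  `|X n t - l| <= 2 * (C * expR (K * `|t|)) / 2 ^+ n.
  by apply: geometric_cauchy => n; have [+ _] := dist n t; rewrite mulrAC.
have limY (t : R) : exists l : R, forall n,
  `|Y n t - l| <= 2 * (C * expR (K * `|t|)) / 2 ^+ n.
  by apply: geometric_cauchy => n; have [_ +] := dist n t; rewrite mulrAC.
have [x xP] := choice limX; have [y yP] := choice limY.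
(* At distance less than 1 from [t] the exponential weight is bounded, hence the convergence is
   locally uniform. *)
have ucont (U : nat -> R -> R) (w : R -> R) : (forall n, continuous (U n)) ->
    (forall t n, `|U n t - w t| <= 2 * (C * expR (K * `|t|)) / 2 ^+ n) -> continuous w.
  move=> cU Uw t; apply/cvg_realP => e e0.
  have e30 : 0 < e / 3 by rewrite divr_gt0.
  have [n hn] := half_pow_small (2 * (C * expR (K * (`|t| + 1)))) e30.
  have [d d0 hd] := (cvg_realP (U n) t (U n t)).1 (cU n t) _ e30.
  exists (Num.min d 1) => [|u]; first by rewrite lt_min d0 ltr01.
  rewrite lt_min => /andP[ud u1].
  have small (s : R) : `|s - t| < 1 -> `|U n s - w s| < e / 3.
    move=> st; apply: le_lt_trans (Uw s n) _; apply: le_lt_trans hn.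
    rewrite ler_pM2r ?invr_gt0// ler_pM2l// ler_wpM2l// ler_expR ler_pM2l; last lra.
    have := ler_normD (s - t) t; rewrite subrK; lra.
  have h1 := small u u1; have h2 := small t; rewrite subrr normr0 ltr01 in h2.
  have h3 := hd u ud.
  have -> : w u - w t = (U n u - U n t) - (U n u - w u) + (U n t - w t) by ring.
  apply: le_lt_trans (ler_normD _ _) _; have := h2 isT.
  have := ler_normB (U n u - U n t) (U n u - w u); lra.
have cx : continuous x by apply: (ucont X) => // n; exact: (picard_iter_cont n).1.
have cy : continuous y by apply: (ucont Y) => // n; exact: (picard_iter_cont n).2.
have cFx : continuous (fun s => Phi (x s) - y s).
  by move=> t; apply: cvgB; [exact: (lip_comp_cont PhiL cx)|exact: cy].
have cGx : continuous (fun s => Gam (x s)) by exact: (lip_comp_cont GamL cx).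
have eq0 (a A : R) : (forall n, `|a| <= A / 2 ^+ n) -> a = 0.
  move=> aA; apply/eqP; rewrite -normr_le0; apply/ler_addgt0Pr => e e0.
  by have [n hn] := half_pow_small A e0; rewrite add0r; apply: le_trans (aA n) (ltW hn).
have E2 n (t : R) : 2 * (C / 2 ^+ n) * (K * expR (K * `|t|)) =
    2 * (L + 1) * (2 * (C * expR (K * `|t|)) / 2 ^+ n).
  by rewrite /K; field; rewrite lt0r_neq0.
have A0 n : 0 <= 2 * (C / 2 ^+ n) by rewrite mulr_ge0// divr_ge0// ltW.
(* No limit is taken under the integral: [X n.+1 - w] vanishes at 0 and has a derivative of order
   [2 ^- n], so [exp_growth_bound] places [w] as close to [X n.+1] as [x] is, up to a constant. *)
have xE t : x t = x0 + primitive0 (fun s => Phi (x s) - y s) t.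
  apply/eqP; rewrite -subr_eq0; apply/eqP.
  apply: (@eq0 _ (4 * (C * expR (K * `|t|)))) => n.
  pose w t := x0 + primitive0 (fun s => Phi (x s) - y s) t.
  have w0 : X n.+1 0 - w 0 = 0 by rewrite X00 /w primitive0_0 addr0 subrr.
  have dw (s : R) : is_derive s (1 : R) w (Phi (x s) - y s).
    by rewrite -[Phi (x s) - y s]add0r;
      exact: is_deriveD (is_derive_cst x0 s 1) (primitive0_is_derive cFx s).
  have dXw (s : R) := is_deriveB (dX n s) (dw s).
  have bd (s : R) : `|(Phi (X n s) - Y n s) - (Phi (x s) - y s)|
    <= 2 * (C / 2 ^+ n) * (K * expR (K * `|s|)).
    rewrite E2.
    have h1 := xP s n; have h2 := yP s n; have h3 := PhiL (X n s) (x s).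
    have h4 := ler_wpM2l L0 h1.
    have -> : (Phi (X n s) - Y n s) - (Phi (x s) - y s) =
      (Phi (X n s) - Phi (x s)) - (Y n s - y s) by ring.
    have h5 := le_trans (normr_ge0 _) h1.
    have h6 : 0 <= L * (2 * (C * expR (K * `|s|)) / 2 ^+ n) by exact: mulr_ge0.
    apply: le_trans (ler_normB _ _) _; lra.
  have h := exp_growth_bound (A0 n) w0 dXw bd t.
  rewrite -/(w t).
  have := xP t n.+1; rewrite exprS => h'.
  have -> : x t - w t = (X n.+1 t - w t) - (X n.+1 t - x t) by ring.
  apply: le_trans (ler_normB _ _) _.
  have E3 : 2 * (C * expR (K * `|t|)) / (2 * 2 ^+ n) = C * expR (K * `|t|) / 2 ^+ n.
    by field; rewrite lt0r_neq0.
  rewrite E3 in h'.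
  have E4 : 2 * (C / 2 ^+ n) * expR (K * `|t|) = 2 * (C * expR (K * `|t|) / 2 ^+ n) by ring.
  have E5 : 4 * (C * expR (K * `|t|)) / 2 ^+ n = 4 * (C * expR (K * `|t|) / 2 ^+ n) by ring.
  have h5 := le_trans (normr_ge0 _) h'; rewrite E4 in h; rewrite E5; lra.
have yE t : y t = y0 + primitive0 (fun s => Gam (x s)) t.
  apply/eqP; rewrite -subr_eq0; apply/eqP.
  apply: (@eq0 _ (4 * (C * expR (K * `|t|)))) => n.
  pose w t := y0 + primitive0 (fun s => Gam (x s)) t.
  have w0 : Y n.+1 0 - w 0 = 0 by rewrite Y00 /w primitive0_0 addr0 subrr.
  have dw (s : R) : is_derive s (1 : R) w (Gam (x s)).
    by rewrite -[Gam (x s)]add0r;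
      exact: is_deriveD (is_derive_cst y0 s 1) (primitive0_is_derive cGx s).
  have dYw (s : R) := is_deriveB (dY n s) (dw s).
  have bd (s : R) : `|Gam (X n s) - Gam (x s)| <= 2 * (C / 2 ^+ n) * (K * expR (K * `|s|)).
    rewrite E2.
    have h1 := xP s n; have h3 := GamL (X n s) (x s).
    have h4 := ler_wpM2l L0 h1.
    have h5 := le_trans (normr_ge0 _) h1.
    have h6 : 0 <= L * (2 * (C * expR (K * `|s|)) / 2 ^+ n) by exact: mulr_ge0.
    lra.
  have h := exp_growth_bound (A0 n) w0 dYw bd t.
  rewrite -/(w t).
  have := yP t n.+1; rewrite exprS => h'.
  have -> : y t - w t = (Y n.+1 t - w t) - (Y n.+1 t - y t) by ring.
  apply: le_trans (ler_normB _ _) _.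
  have E3 : 2 * (C * expR (K * `|t|)) / (2 * 2 ^+ n) = C * expR (K * `|t|) / 2 ^+ n.
    by field; rewrite lt0r_neq0.
  rewrite E3 in h'.
  have E4 : 2 * (C / 2 ^+ n) * expR (K * `|t|) = 2 * (C * expR (K * `|t|) / 2 ^+ n) by ring.
  have E5 : 4 * (C * expR (K * `|t|)) / 2 ^+ n = 4 * (C * expR (K * `|t|) / 2 ^+ n) by ring.
  have h5 := le_trans (normr_ge0 _) h'; rewrite E4 in h; rewrite E5; lra.
exists x, y; split => [||t|t].
- by rewrite xE primitive0_0 addr0.
- by rewrite yE primitive0_0 addr0.
- rewrite -[Phi (x t) - y t]add0r [X in is_derive _ _ X _](funext xE : x = _).
  exact: is_deriveD (is_derive_cst x0 t 1) (primitive0_is_derive cFx t).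
- rewrite -[Gam (x t)]add0r [X in is_derive _ _ X _](funext yE : y = _).
  exact: is_deriveD (is_derive_cst y0 t 1) (primitive0_is_derive cGx t).
Qed.

End Picard.

(** The squared distance is used because it is differentiable. In the bound for its derivative, the
    product of the increments of x and [Phi] contributes [2 * L], that of x and y contributes 1, and
    that of y and [Gam] contributes [L]. Derivatives are needed only in the open interval, so arcs
    may end on the y-axis. *)
Lemma ode_gronwall (R : realType) (Phi Gam x1 y1 x2 y2 : R -> R) (L a b : R) :
  a <= b -> 0 <= L ->
  (forall t : R, a <= t <= b -> [/\ {for t, continuous x1}, {for t, continuous y1},
     {for t, continuous x2} & {for t, continuous y2}]) ->
  (forall t : R, a < t < b -> is_derive t (1 : R) x1 (Phi (x1 t) - y1 t) /\
     is_derive t (1 : R) y1 (Gam (x1 t))) ->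
  (forall t : R, a < t < b -> is_derive t (1 : R) x2 (Phi (x2 t) - y2 t) /\
     is_derive t (1 : R) y2 (Gam (x2 t))) ->
  (forall t : R, a < t < b -> `|Phi (x1 t) - Phi (x2 t)| <= L * `|x1 t - x2 t| /\
     `|Gam (x1 t) - Gam (x2 t)| <= L * `|x1 t - x2 t|) ->
  let D t := (x1 t - x2 t) ^+ 2 + (y1 t - y2 t) ^+ 2 in
  D b <= D a * expR ((3 * L + 1) * (b - a)) /\
  D a <= D b * expR ((3 * L + 1) * (b - a)).
Proof.
move=> ab L0 cz d1 d2 lip D.
pose dD t := 2 * (x1 t - x2 t) * ((Phi (x1 t) - y1 t) - (Phi (x2 t) - y2 t)) +
  2 * (y1 t - y2 t) * (Gam (x1 t) - Gam (x2 t)).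
have cD t : a <= t <= b -> {for t, continuous D}.
  move=> /cz[c1 c2 c3 c4]; have c5 := continuousB c1 c3; have c6 := continuousB c2 c4.
  exact: (continuousD (continuousM c5 c5) (continuousM c6 c6)).
have DD t : a < t < b -> is_derive t (1 : R) D (dD t).
  move=> tab; have [e1 e1'] := d1 t tab; have [e2 e2'] := d2 t tab.
  have h1 := is_deriveB e1 e2; have h2 := is_deriveB e1' e2'.
  apply: (is_derive_eq (is_deriveD (is_deriveM h1 h1) (is_deriveM h2 h2))).
  by rewrite /dD /GRing.scale /= !fctE; ring.
have dDK t : a < t < b -> `|dD t| <= (3 * L + 1) * D t.
  move=> /lip[]; rewrite /dD /D.
  set dx := x1 t - x2 t; set dy := y1 t - y2 t.
  set p := Phi (x1 t); set q := Phi (x2 t).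
  set dp := p - q; set dg := _ - _ => hp hg.
  have -> : 2 * dx * (p - y1 t - (q - y2 t)) + 2 * dy * dg =
     2 * (dx * dp) - 2 * (dx * dy) + 2 * (dy * dg) by rewrite /dx /dy /dp; ring.
  have a1 : `|dx * dp| <= L * dx ^+ 2.
    by rewrite normrM -[dx ^+ 2]real_normK ?num_real// expr2 mulrCA ler_wpM2l.
  have a0 : `|dx * dy| <= (dx ^+ 2 + dy ^+ 2) / 2.
    rewrite normrM -[dx ^+ 2]real_normK ?num_real// -[dy ^+ 2]real_normK ?num_real//.
    have := sqr_ge0 (`|dx| - `|dy|); rewrite sqrrB; lra.
  have a2 : `|dy * dg| <= L * ((dx ^+ 2 + dy ^+ 2) / 2).
    apply: (@le_trans _ _ (L * `|dx * dy|)); last exact: ler_wpM2l.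
    have -> : L * `|dx * dy| = `|dy| * (L * `|dx|) by rewrite normrM; ring.
    by rewrite normrM ler_wpM2l.
  have n2 u : `|2 * u| = 2 * `|u| by rewrite normrM ger0_norm.
  have := ler_normD (2 * (dx * dp) - 2 * (dx * dy)) (2 * (dy * dg)).
  have := ler_normB (2 * (dx * dp)) (2 * (dx * dy)); rewrite !n2.
  have := mulr_ge0 L0 (sqr_ge0 dy); have := mulr_ge0 L0 (sqr_ge0 dx).
  lra.
exact: (gronwall ab cD DD dDK).
Qed.

(** * Arcs of a half-system *)

(* The left half-plane is put in this form by (x, t) |-> (-x, -t), that is with
   F(x) = F^-(-x), f(x) = - f^-(-x) and g(x) = - g^-(-x). *)
Record side (R : realType) (F f g : R -> R) : Prop := Side {
  side_0 : F 0 = 0;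
  side_derive : forall x : R, is_derive x (1 : R) F (f x);
  side_cont : continuous f;
  side_pos : forall x : R, 0 < x -> 0 < f x;
  side_lip : forall M : R, exists2 L : R, 0 <= L & forall x y : R,
    `|x| <= M -> `|y| <= M ->
    `|F x - F y| <= L * `|x - y| /\ `|g x - g y| <= L * `|x - y| }.

(** The equations are required only in the open interval, because an arc may be a piece of a
    solution whose y has no derivative on the axis. The strict signs of [y] at the ends make both
    crossings transversal, as the derivative of x there is -y. *)
Record arc (R : realType) (F g x y : R -> R) (T : R) : Prop := Arc {
  arc_gt0 : 0 < T;
  arc_contx : continuous x;
  arc_conty : continuous y;
  arc_x0 : x 0 = 0;
  arc_xT : x T = 0;
  arc_pos : forall t : R, 0 < t < T -> 0 < x t;
  arc_derx : forall t : R, 0 < t < T -> is_derive t (1 : R) x (F (x t) - y t);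
  arc_dery : forall t : R, 0 < t < T -> is_derive t (1 : R) y (g (x t));
  arc_y0 : y 0 < 0;
  arc_yT : 0 < y T }.

Lemma side_contF (R : realType) (F f g : R -> R) : side F f g -> continuous F.
Proof. by move=> sd x; exact: is_derive_cont (side_derive sd x). Qed.

Lemma side_contg (R : realType) (F f g : R -> R) : side F f g -> continuous g.
Proof.
move=> sd x; have [L L0 hL] := side_lip sd (`|x| + 1).
apply/cvg_realP => e e0; exists (Num.min 1 (e / (L + 1))) => [|u].
  by rewrite lt_min ltr01 divr_gt0//; lra.
rewrite lt_min => /andP[u1 ue].
have [] := hL u x; first by have := ler_normD (u - x) x; rewrite subrK; lra.
  by lra.
move=> _ h; apply: le_lt_trans h _; apply: (@le_lt_trans _ _ ((L + 1) * `|u - x|)).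
  by rewrite ler_wpM2r//; lra.
by rewrite mulrC -ltr_pdivlMr//; lra.
Qed.

Lemma side_mono (R : realType) (F f g : R -> R) : side F f g ->
  forall x y : R, 0 <= x -> x < y -> F x < F y.
Proof.
move=> sd x y x0 xy; apply: (deriv_gt0_lt xy (df := f)) => t txy.
- exact: side_contF sd _.
- exact: side_derive sd _.
- by apply: side_pos sd _ _; lra.
Qed.

Lemma side_ge0 (R : realType) (F f g : R -> R) : side F f g ->
  forall x : R, 0 <= x -> 0 <= F x.
Proof.
move=> sd x; rewrite le_eqVlt => /predU1P[<-|x0]; first by rewrite (side_0 sd).
by rewrite -(side_0 sd) ltW// (side_mono sd).
Qed.

Lemma side_inj (R : realType) (F f g : R -> R) : side F f g ->
  forall x y : R, 0 <= x -> 0 <= y -> F x = F y -> x = y.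
Proof.
move=> sd x y x0 y0 E; case: (ltgtP x y) => // h.
  by have := side_mono sd x0 h; rewrite E ltxx.
by have := side_mono sd y0 h; rewrite E ltxx.
Qed.

(** [F] is monotone only on the right half-line. Continuing it by the identity on negative numbers
    gives a function to which [strict_mono_inverse] applies, with an inverse continuous also at
    0. *)
Lemma side_ext (R : realType) (F f g : R -> R) : side F f g ->
  exists h : R -> R,
  [/\ {homo h : x y / x < y}, continuous h & forall x : R, 0 <= x -> h x = F x].
Proof.
move=> sd; pose h x := F (Num.max x 0) + Num.min x 0; exists h.
have hp x : 0 <= x -> h x = F x by move=> x0; rewrite /h max_l// min_r// addr0.
have hn x : x <= 0 -> h x = x by move=> x0; rewrite /h max_r// min_l// (side_0 sd) add0r.
split => // [x y xy|x].
  have [x0|x0] := leP 0 x; first by rewrite !hp ?(side_mono sd)//; lra.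
  rewrite (hn x) ?ltW//; have [y0|y0] := leP 0 y; last by rewrite hn ?ltW.
  by rewrite hp//; apply: lt_le_trans x0 (side_ge0 sd y0).
have cm : continuous (fun x : R => Num.max x 0).
  by apply: (@lip_cont _ _ 1) => u v; rewrite mul1r; have := ler_norm (u - v);
    have := ler_norm (v - u); rewrite distrC /Num.max => *; rewrite ler_norml;
    case: (ltP u 0) => ?; case: (ltP v 0) => ?; lra.
have cn : continuous (fun x : R => Num.min x 0).
  by apply: (@lip_cont _ _ 1) => u v; rewrite mul1r; have := ler_norm (u - v);
    have := ler_norm (v - u); rewrite distrC /Num.min => *; rewrite ler_norml;
    case: (ltP u 0) => ?; case: (ltP v 0) => ?; lra.
have cF : continuous (fun x : R => F (Num.max x 0)).
  by move=> u; apply: (@continuous_comp _ _ _ (fun x : R => Num.max x 0) F);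
    [exact: cm|exact: side_contF sd _].
exact: (continuousD (cF x) (cn x)).
Qed.

(* [theta] takes the values 0 and [T] below and above the range of [S] on ]0, T[. *)
Lemma pseudo_inverse (R : realType) (S : R -> R) (T : R) : 0 < T ->
  (forall s t : R, 0 < s -> s < t -> t < T -> S s < S t) ->
  exists theta : R -> R, [/\ continuous theta, forall tau : R, 0 <= theta tau <= T,
    forall t tau : R, 0 < t < T -> S t <= tau -> t <= theta tau &
    forall t tau : R, 0 < t < T -> tau <= S t -> theta tau <= t].
Proof.
move=> T0 Sm.
pose E tau : set R := [set t | t = 0 \/ (0 < t < T /\ S t <= tau)].
have E0 tau : E tau 0 by left.
have ET tau : ubound (E tau) T by move=> t [->|[/andP[_ /ltW]]]//; exact: ltW.
pose theta tau := sup (E tau).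
have th0T tau : 0 <= theta tau <= T.
  by apply/andP; split; [apply: ub_le_sup => //; exists T|apply: ge_sup => //; exists 0].
have tha t tau : 0 < t < T -> S t <= tau -> t <= theta tau.
  by move=> tT St; apply: ub_le_sup; [exists T|right].
have thb t tau : 0 < t < T -> tau <= S t -> theta tau <= t.
  move=> /andP[t0 tT] St; apply: ge_sup; first by exists 0.
  move=> s [->|[/andP[s0 sT] Ss]]; first exact: ltW.
  rewrite leNgt; apply/negP => ts; have := Sm _ _ t0 ts sT; lra.
exists theta; split => // tau; apply/cvg_realP => e e0.
have [d1 d10 h1] : exists2 d : R, 0 < d & forall u : R, u < tau + d ->
  theta u < theta tau + e.
  have [h|h] := ltP T (theta tau + e).
    by exists 1 => // u _; have := th0T u; lra.
  have tT : 0 < theta tau + e / 2 < T by have := th0T tau; lra.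
  have tS : tau < S (theta tau + e / 2).
    by rewrite ltNge; apply/negP => /(tha _ _ tT); lra.
  exists (S (theta tau + e / 2) - tau) => [|u us]; first by rewrite subr_gt0.
  have /(thb _ _ tT) : u <= S (theta tau + e / 2) by lra.
  lra.
have [d2 d20 h2] : exists2 d : R, 0 < d & forall u : R, tau - d < u ->
  theta tau - e < theta u.
  have [h|h] := ltP (theta tau - e) 0.
    by exists 1 => // u _; have := th0T u; lra.
  have tT : 0 < theta tau - e / 2 < T by have := th0T tau; lra.
  have tT' : 0 < theta tau - e / 4 < T by have := th0T tau; lra.
  have SS : S (theta tau - e / 2) < S (theta tau - e / 4) by apply: Sm; lra.
  have tS : S (theta tau - e / 4) < tau.
    by rewrite ltNge; apply/negP => /(thb _ _ tT'); lra.
  exists (tau - S (theta tau - e / 2)) => [|u us]; first by lra.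
  have /(tha _ _ tT) : S (theta tau - e / 2) <= u by lra.
  lra.
exists (Num.min d1 d2) => [|u]; first by rewrite lt_min d10.
rewrite lt_min !ltr_distl => /andP[/andP[_ u1] /andP[u2 _]].
by rewrite h1// h2.
Qed.

(** The equality of the ratios g/f at a common value of p, cleared of denominators and symmetric in
    the two sides. *)
Definition same_ratio (R : realType) (f1 g1 F1 f2 g2 F2 : R -> R) : Prop :=
  forall u v : R, 0 < u -> 0 < v -> F1 u = F2 v -> g1 u * f2 v = g2 v * f1 u.

(** Besides having equal end heights, the two arcs have the same trace in the (p, y)-plane, where p
    is the value of F. *)
Definition arcs_match (R : realType) (F1 x y : R -> R) (T : R)
    (F2 X Y : R -> R) (S : R) : Prop :=
  [/\ Y 0 = y 0, Y S = y T,
      forall t : R, 0 <= t <= S ->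
        exists2 s : R, 0 <= s <= T & Y t = y s /\ F2 (X t) = F1 (x s) &
      forall s : R, 0 <= s <= T ->
        exists2 t : R, 0 <= t <= S & Y t = y s /\ F2 (X t) = F1 (x s)].

Lemma arc_x_ge0 (R : realType) (F g x y : R -> R) (T : R) : arc F g x y T ->
  forall t : R, 0 <= t <= T -> 0 <= x t.
Proof.
move=> a t /andP[]; rewrite le_eqVlt => /predU1P[<- _|t0]; first by rewrite (arc_x0 a).
rewrite le_eqVlt => /predU1P[->|tT]; first by rewrite (arc_xT a).
by apply/ltW/(arc_pos a); rewrite t0.
Qed.

Lemma is_derive_shift1 (R : realType) (s t : R) : is_derive t (1 : R) (fun t => s + t) 1.
Proof. by rewrite -[X in is_derive _ _ _ X]add0r; exact: is_deriveD. Qed.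

(* Change of time dS = f1(x) / f2(X) dt along X = F2^-1(F1(x)). *)
Lemma arc_transfer (R : realType) (F1 f1 g1 F2 f2 g2 x y : R -> R) (T m : R) :
  side F1 f1 g1 -> side F2 f2 g2 -> same_ratio f1 g1 F1 f2 g2 F2 ->
  arc F1 g1 x y T -> 0 <= m -> (forall t : R, 0 <= t <= T -> F1 (x t) < F2 m) ->
  exists X Y S, arc F2 g2 X Y S /\ arcs_match F1 x y T F2 X Y S.
Proof.
move=> sd1 sd2 rat a m0 xm; have T0 := arc_gt0 a.
have [h [hm ch hE]] := side_ext sd2.
have [k [kh ck dk]] := strict_mono_inverse hm ch.
have xge := arc_x_ge0 a; have cy : continuous y by exact: arc_conty a.
pose X2 t := k (F1 (x t)).
have X2P t : 0 <= t <= T -> 0 <= X2 t /\ F2 (X2 t) = F1 (x t).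
  move=> tT; have [u /andP[u0 um] hu] : exists2 u : R, 0 <= u <= m & F2 u = F1 (x t).
    apply: ivt_pt => //; first by move=> s _; exact: side_contF sd2 _.
    by rewrite (side_0 sd2) (side_ge0 sd1) ?xge//= ltW// xm.
  by rewrite /X2 -hu -(hE u u0) kh hE.
have hX2 t : 0 <= t <= T -> h (X2 t) = F1 (x t).
  by move=> /X2P[X20 <-]; rewrite hE.
have X2_0 : X2 0 = 0.
  rewrite /X2 (arc_x0 a) (side_0 sd1).
  have := kh 0; rewrite hE // (side_0 sd2) //.
have X2_T : X2 T = 0 by rewrite -X2_0 /X2 (arc_xT a) (arc_x0 a).
have X2pos t : 0 < t < T -> 0 < X2 t.
  move=> tT; have [|X20 E] := X2P t; first by lra.
  rewrite lt_neqAle X20 andbT; apply/eqP => E0.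
  have := side_mono sd1 (lexx 0) (arc_pos a tT).
  by rewrite -E -E0 (side_0 sd2) (side_0 sd1) ltxx.
have cX2 t : 0 <= t <= T -> {for t, continuous X2}.
  move=> tT; apply: (@continuous_comp _ _ _ (fun t => F1 (x t)) k).
    by apply: (@continuous_comp _ _ _ x F1); [exact: arc_contx a _|exact: side_contF sd1 _].
  by rewrite /= -hX2//; exact: ck.
pose rho t := f1 (x t) / f2 (X2 t).
have f2pos t : 0 < t < T -> 0 < f2 (X2 t) by move=> /X2pos; exact: side_pos sd2 _.
have f1pos t : 0 < t < T -> 0 < f1 (x t) by move=> /(arc_pos a); exact: side_pos sd1 _.
have rhopos t : 0 < t < T -> 0 < rho t by move=> tT; rewrite divr_gt0 ?f1pos ?f2pos.
have dX2 t : 0 < t < T -> is_derive t (1 : R) X2 (rho t * (F2 (X2 t) - y t)).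
  move=> tT; have tT' : 0 <= t <= T by lra.
  have dh : is_derive (X2 t) (1 : R) h (f2 (X2 t)).
    apply: (is_derive_near (X2pos t tT)) (side_derive sd2 _) => u.
    by rewrite ltr_distl => hu; rewrite hE//; lra.
  have := dk _ _ dh (lt0r_neq0 (f2pos t tT)); rewrite hX2// => dk'.
  have dF := @is_derive1_comp _ F1 x t _ _ (side_derive sd1 (x t)) (arc_derx a tT).
  have := @is_derive1_comp _ k (F1 \o x) t _ _ dk' dF.
  move=> H; apply: (is_derive_eq H); rewrite /rho (X2P t tT').2; ring.
(* The equality of ratios makes the factor [rho], found from the first equation, fit the second one
   as well. *)
have dy t : 0 < t < T -> is_derive t (1 : R) y (rho t * g2 (X2 t)).
  move=> tT; have tT' : 0 <= t <= T by lra.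
  apply: (is_derive_eq (arc_dery a tT)).
  have := rat (x t) (X2 t) (arc_pos a tT) (X2pos t tT) (esym (X2P t tT').2).
  move=> E; apply: (mulIf (lt0r_neq0 (f2pos t tT))); rewrite E /rho.
  by field; exact: lt0r_neq0 (f2pos t tT).
have crho t : 0 < t < T -> {for t, continuous rho}.
  move=> tT; apply: continuousM.
    by apply: (@continuous_comp _ _ _ x f1); [exact: arc_contx a _|exact: side_cont sd1 _].
  apply: (@continuousV _ _ (fun t => f2 (X2 t))); first exact: lt0r_neq0 (f2pos t tT).
  by apply: (@continuous_comp _ _ _ X2 f2); [apply: cX2; lra|exact: side_cont sd2 _].
(* [rho] may blow up at the end points, but X2' = rho (F2(X2) - y) with F2(X2) - y
   bounded away from 0 there, so the new time [S] remains bounded. *)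
have [S dS] := antiderivative_oo T0 crho.
have Sm s t : 0 < s -> s < t -> t < T -> S s < S t.
  move=> s0 st tT; apply: (deriv_gt0_lt st (df := rho)) => u us.
  - by apply: is_derive_cont (dS u _); lra.
  - by apply: dS; lra.
  - by apply: rhopos; lra.
have [Blo hlo] : exists B, forall t, 0 < t < T -> B <= S t.
  have y0 := arc_y0 a; pose c := - y 0 / 2; have c0 : 0 < c by rewrite /c; lra.
  have [d d0 hd] := (cvg_realP _ _ _).1 (cy 0) c c0.
  pose e := Num.min d T / 2.
  have [e0 eT ed] : [/\ 0 < e, e < T & e < d].
    by clear -d0 T0; rewrite /e /Num.min; case: (ltP d T) => ?; split; lra.
  (* Before [e] one has [y < - c], so [X2 - c * S] is nondecreasing there; as [X2] is positive,
     [c * (S e - S t)] is at most [X2 e]. *)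
  exists (S e - X2 e / c) => t tT.
  have Xe : 0 <= X2 e / c by rewrite divr_ge0 ?ltW// X2pos// e0.
  have [et|te] := leP e t.
    move: et; rewrite le_eqVlt => /predU1P[<-|et]; first lra.
    by have := Sm _ _ e0 et; have /andP[_ tT'] := tT => /(_ tT'); lra.
  have dd u : 0 < u < T -> is_derive u (1 : R) (fun u => X2 u - c * S u)
      (rho u * (F2 (X2 u) - y u) - c * rho u).
    by move=> uT; exact: is_deriveB (dX2 u uT) (is_deriveZ c (dS u uT)).
  have : X2 t - c * S t <= X2 e - c * S e.
    apply: (deriv_ge0_le (ltW te) _ (fun u hu => dd u _)) => [u hu|u hu|u hu].
    - by apply: is_derive_cont (dd u _); lra.
    - by lra.
    have uT : 0 < u < T by lra.
    have -> : rho u * (F2 (X2 u) - y u) - c * rho u = rho u * (F2 (X2 u) - y u - c) by ring.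
    rewrite mulr_ge0//; first by rewrite ltW// rhopos.
    have uT' : 0 <= u <= T by lra.
    have := side_ge0 sd2 (X2P u uT').1.
    have := hd u; rewrite subr0 ger0_norm; last lra.
    have ud : u < d by lra.
    move=> /(_ ud); rewrite ltr_distl /c; lra.
  move=> hh; have := X2pos t tT.
  rewrite -(ler_pM2l c0) mulrBr mulrCA divff ?mulr1; last exact: lt0r_neq0.
  lra.
have [Bhi hhi] : exists B, forall t, 0 < t < T -> S t <= B.
  (* Near [T], [y] exceeds [3 * c], while [F2 (X2)], equal to [F1 (x)], is below [c] because it
     vanishes at [T]. Their difference therefore exceeds [c]. *)
  have yT := arc_yT a; pose c := y T / 4; have c0 : 0 < c by rewrite /c; lra.
  have [d d0 hd] := (cvg_realP _ _ _).1 (cy T) c c0.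
  have cFx : {for T, continuous (fun t => F1 (x t))}.
    by apply: (@continuous_comp _ _ _ x F1); [exact: arc_contx a _|exact: side_contF sd1 _].
  have [d' d'0 hd'] := (cvg_realP _ _ _).1 cFx c c0.
  have [r [r0 rT rd rd']] : exists r, [/\ 0 < r, r < T, r < d & r < d'].
    clear -d0 d'0 T0; exists (Num.min (Num.min d d') T / 2).
    by rewrite /Num.min; case: (ltP d d') => ?; [case: (ltP d T)|case: (ltP d' T)] => ?;
      split; lra.
  pose e := T - r.
  have e0 : 0 < e by rewrite /e; lra.
  have eT : e < T by rewrite /e; lra.
  have Xe : 0 <= X2 e / c by rewrite divr_ge0 ?ltW// X2pos// e0.
  exists (S e + X2 e / c) => t tT.
  have [te|et] := leP t e.
    move: te; rewrite le_eqVlt => /predU1P[->|te]; first lra.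
    by have /andP[t0 _] := tT; have := Sm _ _ t0 te eT; lra.
  have dd u : 0 < u < T -> is_derive u (1 : R) (fun u => - (X2 u + c * S u))
      (- (rho u * (F2 (X2 u) - y u) + c * rho u)).
    by move=> uT; exact: is_deriveN (is_deriveD (dX2 u uT) (is_deriveZ c (dS u uT))).
  have : - (X2 e + c * S e) <= - (X2 t + c * S t).
    apply: (deriv_ge0_le (ltW et) _ (fun u hu => dd u _)) => [u hu|u hu|u hu].
    - by apply: is_derive_cont (dd u _); lra.
    - by lra.
    have uT : 0 < u < T by lra.
    have -> : - (rho u * (F2 (X2 u) - y u) + c * rho u) = rho u * (y u - F2 (X2 u) - c)
      by ring.
    rewrite mulr_ge0//; first by rewrite ltW// rhopos.
    have uT' : 0 <= u <= T by lra.
    rewrite (X2P u uT').2.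
    have uTr : `|u - T| < r by rewrite ltr_distl; move: hu; rewrite /e; lra.
    have := hd u (lt_trans uTr rd); have := hd' u (lt_trans uTr rd').
    rewrite (arc_xT a) (side_0 sd1) !ltr_distl /c; lra.
  move=> hh; have := X2pos t tT.
  rewrite -(ler_pM2l c0) mulrDr mulrCA divff ?mulr1; last exact: lt0r_neq0.
  lra.
pose rS : set R := [set S t | t in [set t : R | 0 < t < T]].
have rS0 : rS !=set0 by exists (S (T / 2)), (T / 2) => //=; lra.
have lbS : has_lbound rS by exists Blo => _ [t /= tT <-]; exact: hlo.
have ubS : has_ubound rS by exists Bhi => _ [t /= tT <-]; exact: hhi.
(* These are the limits of [S] at 0 and at [T]. The values of [S] at the end points are not
   controlled, so [theta] serves as the continuous extension of its inverse to [[S0, S1]]. *)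
pose S0 := inf rS; pose S1 := sup rS.
have S0le t : 0 < t < T -> S0 <= S t by move=> tT; apply: ge_inf => //; exists t.
have S1ge t : 0 < t < T -> S t <= S1 by move=> tT; apply: ub_le_sup => //; exists t.
have S01 : S0 < S1.
  have h1 : 0 < T / 3 < T by lra.
  have h2 : 0 < T / 2 < T by lra.
  have : S (T / 3) < S (T / 2) by apply: Sm; lra.
  by have := S0le _ h1; have := S1ge _ h2; lra.
have [theta [cth th0T tha thb]] := pseudo_inverse T0 Sm.
have thS0 : theta S0 = 0.
  apply/eqP; rewrite eq_le; have /andP[-> thT] := th0T S0; rewrite andbT leNgt.
  apply/negP => th0; have hh : 0 < theta S0 / 2 < T by lra.
  by have := thb _ _ hh (S0le _ hh); lra.
have thS1 : theta S1 = T.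
  apply/eqP; rewrite eq_le; have /andP[th0 ->] := th0T S1; rewrite /= leNgt.
  apply/negP => thT; have hh : 0 < (theta S1 + T) / 2 < T by lra.
  by have := tha _ _ hh (S1ge _ hh); lra.
have thK t : 0 < t < T -> theta (S t) = t.
  by move=> tT; apply/eqP; rewrite eq_le tha// thb.
have Sth tau : S0 < tau < S1 -> exists2 t : R, 0 < t < T & S t = tau /\ theta tau = t.
  move=> /andP[h1 h2].
  have [_ [t1 /= t1T <-] l1] := inf_adherent (eps := tau - S0) (ltac:(lra)) (conj rS0 lbS).
  have [_ [t2 /= t2T <-] l2] := sup_adherent (eps := S1 - tau) (ltac:(lra)) (conj rS0 ubS).
  have t12 : t1 < t2.
    rewrite ltNge; apply/negP; rewrite le_eqVlt => /predU1P[E|t21].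
      by move: l1 l2; rewrite E -/S0 -/S1; lra.
    by have := Sm t2 t1; move: l1 l2; rewrite -/S0 -/S1 => l1 l2 /(_ _ t21); lra.
  have [t tt St] : exists2 t : R, t1 <= t <= t2 & S t = tau.
    apply: ivt_pt; first exact: ltW.
      by move=> u hu; apply: is_derive_cont (dS u _); lra.
    by move: l1 l2; rewrite -/S0 -/S1; lra.
  have tT : 0 < t < T by lra.
  by exists t => //; split => //; rewrite -St thK.
have dth tau : S0 < tau < S1 -> is_derive tau (1 : R) theta (rho (theta tau))^-1.
  move=> /Sth[t tT [St ->]]; rewrite -St.
  have nt : \forall u \near t, 0 < u < T.
    have /andP[t0 tT'] := tT.
    by near=> u; apply/andP; split; near: u; [exact: lt_nbhsr|exact: lt_nbhsl].
  apply: is_derive_inverse.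
  - by apply: filterS nt => u; exact: thK.
  - by apply: filterS nt => u uT; exact: is_derive_cont (dS u uT).
  - exact: dS.
  - exact: lt0r_neq0 (rhopos t tT).
exists (fun tau => X2 (theta (S0 + tau))), (fun tau => y (theta (S0 + tau))), (S1 - S0).
have cth' : continuous (fun tau => theta (S0 + tau)).
  move=> tau; apply: (@continuous_comp _ _ _ (fun tau => S0 + tau) theta); last exact: cth.
  exact: is_derive_cont (is_derive_shift1 S0 tau).
have dth' tau : 0 < tau < S1 - S0 ->
    is_derive tau (1 : R) (fun tau => theta (S0 + tau)) (rho (theta (S0 + tau)))^-1.
  move=> ht; rewrite -[X in is_derive _ _ _ X]mulr1.
  apply: (@is_derive1_comp _ theta (fun tau => S0 + tau)); last exact: is_derive_shift1.
  by apply: dth; lra.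
have thin tau : 0 < tau < S1 - S0 -> 0 < theta (S0 + tau) < T.
  move=> ht; have [|t tT [_ ->]//] := Sth (S0 + tau); lra.
split; split.
- by rewrite subr_gt0.
- move=> tau; apply: (@continuous_comp _ _ _ (fun tau => theta (S0 + tau)) X2);
  first exact: cth'.
  by apply: cX2; exact: th0T.
- move=> tau; apply: (@continuous_comp _ _ _ (fun tau => theta (S0 + tau)) y);
  first exact: cth'.
  exact: arc_conty a _.
- by rewrite addr0 thS0.
- by rewrite addrC subrK thS1.
- by move=> t /thin; exact: X2pos.
- move=> t ht; have := thin t ht => tT.
  apply: (is_derive_eq (is_derive1_comp (f := X2) (dX2 _ tT) (dth' t ht))).
  by field; exact: lt0r_neq0 (rhopos _ tT).
- move=> t ht; have := thin t ht => tT.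
  apply: (is_derive_eq (is_derive1_comp (f := y) (dy _ tT) (dth' t ht))).
  by field; exact: lt0r_neq0 (rhopos _ tT).
- by rewrite addr0 thS0; exact: arc_y0 a.
- by rewrite addrC subrK thS1; exact: arc_yT a.
- by rewrite addr0 thS0.
- by rewrite addrC subrK thS1.
- move=> t ht; exists (theta (S0 + t)); first exact: th0T.
  by split => //; rewrite (X2P _ (th0T _)).2.
- move=> s /andP[]; rewrite le_eqVlt => /predU1P[<- _|s0].
    exists 0; first by rewrite lexx subr_ge0 ltW.
    by have [|_ E] := X2P 0; [rewrite lexx ltW|rewrite addr0 thS0].
  rewrite le_eqVlt => /predU1P[->|sT].
    exists (S1 - S0); first by rewrite lexx subr_ge0 ltW.
    by have [|_ E] := X2P T; [rewrite lexx ltW|rewrite addrC subrK thS1].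
  have hs : 0 < s < T by rewrite s0.
  exists (S s - S0); first by rewrite subr_ge0 S0le// lerB// S1ge.
  by have [|_ E] := X2P s; [lra|rewrite addrC subrK thK].
Unshelve. all: by end_near. Qed.

(** * Perturbation of arcs *)

(** The width [eta] is uniform by compactness: adjacent pieces take the smaller of their two
    widths. *)
Lemma tube (R : realType) (x y : R -> R) (a b : R) (Q : set (R * R)) :
  a <= b -> continuous x -> continuous y ->
  (forall t : R, a <= t <= b -> nbhs (x t, y t) Q) ->
  exists2 eta : R, 0 < eta & forall t p q : R, a <= t <= b ->
    `|p - x t| < eta -> `|q - y t| < eta -> Q (p, q).
Proof.
move=> ab cx cy nQ.
apply: (cousin (P := fun s u => exists2 eta : R, 0 < eta & forall t p q : R, s <= t <= u ->
    `|p - x t| < eta -> `|q - y t| < eta ->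
      Q (p, q)) ab) => [t tab|s t u st tu [e1 e10 h1] [e2 e20 h2]].
  have /nbhs_ballP[r /= r0 rQ] := nQ t tab.
  have r20 : 0 < r / 2 by rewrite divr_gt0.
  have [d d0 hd] := (cvg_realP _ _ _).1 (cx t) _ r20.
  have [d' d'0 hd'] := (cvg_realP _ _ _).1 (cy t) _ r20.
  exists (Num.min d d') => [|s u as_ ub]; first by rewrite lt_min d0.
  rewrite ltrBlDr -ltrBlDl lt_min => /andP[sd sd'] st tu.
  rewrite -ltrBlDl lt_min => /andP[ud ud'].
  exists (r / 2) => // v p q vsu pv qv; apply: rQ; split => /=.
    rewrite /ball /= distrC; have := hd v; have -> : `|v - t| < d by rewrite ltr_distl; lra.
    move=> /(_ isT) hv; have := ler_normD (p - x v) (x v - x t).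
    rewrite (_ : p - x v + (x v - x t) = p - x t); [lra|ring].
  rewrite /ball /= distrC; have := hd' v; have -> : `|v - t| < d' by rewrite ltr_distl; lra.
  move=> /(_ isT) hv; have := ler_normD (q - y v) (y v - y t).
  rewrite (_ : q - y v + (y v - y t) = q - y t); [lra|ring].
exists (Num.min e1 e2) => [|v p q vsu]; first by rewrite lt_min e10.
rewrite !lt_min => /andP[p1 p2] /andP[q1 q2].
by have [vt|tv] := leP v t; [apply: (h1 v)|apply: (h2 v)] => //; lra.
Qed.

Lemma side_clamp (R : realType) (F f g : R -> R) (M : R) : side F f g -> 0 <= M ->
  exists2 L : R, 0 <= L & forall u v : R,
    `|F (clamp (- M) M u) - F (clamp (- M) M v)| <= L * `|u - v| /\
    `|g (clamp (- M) M u) - g (clamp (- M) M v)| <= L * `|u - v|.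
Proof.
move=> sd M0; have [L L0 hL] := side_lip sd M; exists L => // u v.
have MM : - M <= M by lra.
have [] := hL (clamp (- M) M u) (clamp (- M) M v).
- by rewrite ler_norml; exact: clamp_itv.
- by rewrite ler_norml; exact: clamp_itv.
by move=> h1 h2; have h3 := ler_wpM2l L0 (clamp_lip u v MM); split; apply: le_trans h3.
Qed.

Lemma picard_at (R : realType) (Phi Gam : R -> R) (L : R) :
  (forall x y : R, `|Phi x - Phi y| <= L * `|x - y|) ->
  (forall x y : R, `|Gam x - Gam y| <= L * `|x - y|) ->
  forall s x0 y0 : R, exists x y : R -> R,
  [/\ x s = x0, y s = y0, forall t, is_derive t (1 : R) x (Phi (x t) - y t)
    & forall t, is_derive t (1 : R) y (Gam (x t))].
Proof.
move=> PL GL s x0 y0; have [x [y [h1 h2 h3 h4]]] := picard_solution PL GL x0 y0.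
exists (fun t => x (- s + t)), (fun t => y (- s + t)).
rewrite addNr; split => // t.
  rewrite -[X in is_derive _ _ _ X]mulr1.
  exact: (is_derive1_comp (f := x) (h3 (- s + t)) (is_derive_shift1 (- s) t)).
rewrite -[X in is_derive _ _ _ X]mulr1.
exact: (is_derive1_comp (f := y) (h4 (- s + t)) (is_derive_shift1 (- s) t)).
Qed.

Lemma sum_sqr_eq0 (R : realType) (a b : R) : a ^+ 2 + b ^+ 2 <= 0 -> a = 0 /\ b = 0.
Proof.
move=> h; have h1 := sqr_ge0 a; have h2 := sqr_ge0 b.
by split; apply/eqP; rewrite -sqrf_eq0 eq_le; apply/andP; split; lra.
Qed.

Lemma arc_bounded (R : realType) (F g x y : R -> R) (T : R) : arc F g x y T ->
  exists2 M : R, 0 <= M & forall t : R, 0 <= t <= T -> x t <= M.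
Proof.
move=> a; have cx : {within `[0, T], continuous x}.
  by apply: continuous_subspaceT; exact: arc_contx a.
have [c cT hc] := EVT_max (ltW (arc_gt0 a)) cx.
exists (x c); first by apply: (arc_x_ge0 a); rewrite in_itv /= in cT.
by move=> t tT; apply: hc; rewrite in_itv.
Qed.

Lemma flow_close (R : realType) (Phi Gam x y : R -> R) (L W eta : R) : 0 <= L ->
  (forall u v : R, `|Phi u - Phi v| <= L * `|u - v|) ->
  (forall u v : R, `|Gam u - Gam v| <= L * `|u - v|) ->
  (forall t, is_derive t (1 : R) x (Phi (x t) - y t)) ->
  (forall t, is_derive t (1 : R) y (Gam (x t))) -> 0 < eta ->
  exists2 r : R, 0 < r & forall s p q : R, `|p - x s| < r -> `|q - y s| < r ->
    exists X Y : R -> R, [/\ X s = p /\ Y s = q,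
      forall t, is_derive t (1 : R) X (Phi (X t) - Y t),
      forall t, is_derive t (1 : R) Y (Gam (X t)) &
      forall t, `|t - s| <= W -> `|X t - x t| < eta /\ `|Y t - y t| < eta].
Proof.
move=> L0 PL GL dx dy eta0.
pose E := expR ((3 * L + 1) * W).
have E0 : 0 < E by exact: expR_gt0.
(* An initial squared distance of at most [2 * r ^+ 2], enlarged by the factor [E] over the time
   window, must remain below [eta ^+ 2]. The choice is the same for all starting times [s]. *)
pose r := eta / (2 * (E + 1)).
have E20 : 0 < 2 * (E + 1) by lra.
have r0 : 0 < r by rewrite divr_gt0.
have rE : 2 * r ^+ 2 * E < eta ^+ 2.
  have -> : 2 * r ^+ 2 * E = eta ^+ 2 * (E / (2 * (E + 1) ^+ 2)).
    by rewrite /r; field; apply: lt0r_neq0; lra.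
  rewrite gtr_pMr ?exprn_gt0// ltr_pdivrMr ?mul1r; last by rewrite mulr_gt0// exprn_gt0//;
    lra.
  by have := sqr_ge0 E; rewrite sqrrD expr1n; lra.
exists r => // s p q pr qr.
have [X [Y [Xs Ys dX dY]]] := picard_at PL GL s p q.
exists X, Y; split => // t tW.
pose D t := (X t - x t) ^+ 2 + (Y t - y t) ^+ 2.
have cz u : [/\ {for u, continuous X}, {for u, continuous Y}, {for u,
  continuous x} & {for u, continuous y}].
  by split; [exact: is_derive_cont (dX u)|exact: is_derive_cont (dY u)
            |exact: is_derive_cont (dx u)|exact: is_derive_cont (dy u)].
have Ds : D s <= 2 * r ^+ 2.
  rewrite /D Xs Ys.
  have sq u : `|u| < r -> u ^+ 2 <= r ^+ 2.
    by move=> ur; rewrite -[u ^+ 2]real_normK ?num_real// ler_pXn2r ?nnegrE ?normr_ge0// ltW.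
  by rewrite [2 * _]mulr_natl mulr2n lerD// sq.
have Dt : D t < eta ^+ 2.
  apply: le_lt_trans rE; apply: (@le_trans _ _ (D s * E)); last first.
    by rewrite ler_wpM2r// ltW.
  have Ebd u : u <= W -> D s * expR ((3 * L + 1) * u) <= D s * E.
    move=> uW; rewrite ler_wpM2l ?addr_ge0 ?sqr_ge0// ler_expR ler_wpM2l// addr_ge0// mulr_ge0//.
  have [st|ts] := leP s t.
    have [||||h _] := @ode_gronwall _ Phi Gam X Y x y L s t st L0 => [u _|u _|u _|u _|];
      try by split.
    - exact: cz.
    - by apply: le_trans h (Ebd _ _); rewrite -(ger0_norm (_ : 0 <= t - s))// subr_ge0.
  have [||||_ h] := @ode_gronwall _ Phi Gam X Y x y L t s (ltW ts) L0 =>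
    [u _|u _|u _|u _|]; try by split.
  - exact: cz.
  - by apply: le_trans h (Ebd _ _);
    rewrite -(ger0_norm (_ : 0 <= s - t)) ?subr_ge0 1?distrC// ltW.
have sq u : u ^+ 2 < eta ^+ 2 -> `|u| < eta.
  by rewrite -[u ^+ 2]real_normK ?num_real// ltr_pXn2r ?nnegrE ?normr_ge0// ltW.
split; apply: sq; apply: le_lt_trans Dt; rewrite /D; [rewrite lerDl|rewrite lerDr];
  exact: sqr_ge0.
Qed.

(** [X] increases strictly from a negative to a positive value on [[a, b]], is positive on [[b, c]],
    and decreases strictly to a negative value on [[c, d]]. It thus has exactly two zeros, and
    [0 <= X s] places [s] between them, so the arc they bound passes through the point at time
    [s]. *)
Lemma arc_of_crossings (R : realType) (F g Phi Gam X Y : R -> R) (M a b c d s : R)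
    (V : set (R * R)) :
  (forall u, `|u| <= M -> Phi u = F u) -> (forall u, `|u| <= M -> Gam u = g u) ->
  Phi 0 = 0 ->
  (forall t, is_derive t (1 : R) X (Phi (X t) - Y t)) ->
  (forall t, is_derive t (1 : R) Y (Gam (X t))) ->
  a < b -> b < c -> c < d ->
  (forall t, a <= t <= b -> 0 < Phi (X t) - Y t) ->
  (forall t, b <= t <= c -> 0 < X t) ->
  (forall t, c <= t <= d -> Phi (X t) - Y t < 0) ->
  (forall t, a <= t <= d -> `|X t| <= M /\ V (X t, Y t)) ->
  X a < 0 -> X d < 0 -> a <= s <= d -> 0 <= X s ->
  exists x y S, [/\ arc F g x y S,
    exists2 t : R, 0 <= t <= S & x t = X s /\ y t = Y s &
    forall t : R, 0 <= t <= S -> V (x t, y t)].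
Proof.
move=> PhiE GamE Phi0 dX dY ab bc cd K1 K2 K3 KV Xa Xd sad Xs0.
have cX : continuous X by move=> t; exact: is_derive_cont (dX t).
have cY : continuous Y by move=> t; exact: is_derive_cont (dY t).
have Xinc u v : a <= u -> u < v -> v <= b -> X u < X v.
  move=> ue uv ve; apply: (deriv_gt0_lt uv (fun t _ => cX t) (fun t _ => dX t)) => t ht.
  by apply: K1; clear -ue ve ht; lra.
have dXN t := is_deriveN (dX t).
have Xdec u v : c <= u -> u < v -> v <= d -> X v < X u.
  move=> ue uv ve; rewrite -ltrN2.
  apply: (deriv_gt0_lt uv (fun t _ => is_derive_cont (dXN t)) (fun t _ => dXN t)) => t ht.
  by rewrite oppr_gt0; apply: K3; clear -ue ve ht; lra.
have Xb : 0 < X b by apply: K2; rewrite lexx ltW.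
have Xc : 0 < X c by apply: K2; rewrite lexx andbT ltW.
have [t1 /andP[at1 t1b] Xt1] : exists2 t : R, a <= t <= b & X t = 0.
  by apply: ivt_pt; [exact: ltW|move=> t _; exact: cX|rewrite !ltW].
have [t2 /andP[ct2 t2d] Xt2'] : exists2 t : R, c <= t <= d & - X t = 0.
  apply: (ivt_pt (f := fun t => - X t)); first exact: ltW.
    by move=> t _; apply: continuousN; exact: cX.
  by rewrite oppr_le0 oppr_ge0 !ltW.
have Xt2 : X t2 = 0 by rewrite -[LHS]opprK Xt2' oppr0.
have t12 : t1 < t2 by clear -t1b ct2 bc; lra.
have Xpos t : t1 < t < t2 -> 0 < X t.
  move=> /andP[h1 h2]; have [h|h] := leP t b.
    by rewrite -Xt1; apply: Xinc.
  have [h'|h'] := leP t c; first by apply: K2; rewrite h' ltW.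
  by rewrite -Xt2; apply: Xdec => //; exact: ltW.
have [as_ sd] := andP sad.
have s1 : t1 <= s.
  by rewrite leNgt; apply/negP => h; have := Xinc _ _ as_ h t1b; rewrite Xt1 ltNge Xs0.
have s2 : s <= t2.
  by rewrite leNgt; apply/negP => h; have := Xdec _ _ ct2 h sd; rewrite Xt2 ltNge Xs0.
have inad t : 0 <= t <= t2 - t1 -> a <= t1 + t <= d by clear -at1 t2d; lra.
have inad' t : 0 < t < t2 - t1 -> `|X (t1 + t)| <= M.
  by move=> /andP[/ltW t0 /ltW tt];
    have [] := KV (t1 + t) (inad t (introT andP (conj t0 tt))).
exists (fun t => X (t1 + t)), (fun t => Y (t1 + t)), (t2 - t1).
have dXs t := is_derive1_comp (f := X) (dX (t1 + t)) (is_derive_shift1 t1 t).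
have dYs t := is_derive1_comp (f := Y) (dY (t1 + t)) (is_derive_shift1 t1 t).
split; first split.
- by rewrite subr_gt0.
- by move=> t; exact: is_derive_cont (dXs t).
- by move=> t; exact: is_derive_cont (dYs t).
- by rewrite addr0.
- by rewrite addrC subrK.
- by move=> t ht; apply: Xpos; clear -ht; lra.
- by move=> t ht; rewrite -PhiE ?inad'//; apply: (is_derive_eq (dXs t)); rewrite mulr1.
- by move=> t ht; rewrite -GamE ?inad'//; apply: (is_derive_eq (dYs t)); rewrite mulr1.
- by have := K1 t1; rewrite addr0 Xt1 Phi0 sub0r oppr_gt0; apply; rewrite at1.
- by rewrite addrC subrK; have := K3 t2; rewrite Xt2 Phi0 sub0r oppr_lt0; apply; rewrite ct2.
- by exists (s - t1); [rewrite subr_ge0 s1 lerB|rewrite /= addrC subrK].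
- by move=> t /inad /KV[].
Qed.

(** Past its ends the arc is continued by the clamped right half-system, not by the nonsmooth one.
    The continuation enters x < 0, so the ends become sign changes, which persist under
    perturbation. The strict bound by [M] leaves room for nearby solutions on which clamping has no
    effect either. *)
Lemma arc_extends (R : realType) (F f g x y : R -> R) (T : R) :
  side F f g -> arc F g x y T ->
  exists M L Phi Gam X Y, [/\ 0 <= L /\ (forall t : R, 0 <= t <= T -> `|x t| < M),
    (forall u v : R, `|Phi u - Phi v| <= L * `|u - v|) /\
    (forall u v : R, `|Gam u - Gam v| <= L * `|u - v|),
    (forall u : R, `|u| <= M -> Phi u = F u) /\ (forall u : R, `|u| <= M -> Gam u = g u),
    (forall t, is_derive t (1 : R) X (Phi (X t) - Y t)) /\
    (forall t, is_derive t (1 : R) Y (Gam (X t))) &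
    forall t : R, 0 <= t <= T -> X t = x t /\ Y t = y t].
Proof.
move=> sd a.
have [M0 M00 xM0] := arc_bounded a; pose M := M0 + 1.
have M0' : 0 <= M by rewrite /M; lra.
have [L L0 hL] := side_clamp sd M0'.
pose Phi u := F (clamp (- M) M u); pose Gam u := g (clamp (- M) M u).
have PL u v : `|Phi u - Phi v| <= L * `|u - v| by exact: (hL u v).1.
have GL u v : `|Gam u - Gam v| <= L * `|u - v| by exact: (hL u v).2.
have PhiE u : `|u| <= M -> Phi u = F u by move=> hu; rewrite /Phi clamp_id// -ler_norml.
have GamE u : `|u| <= M -> Gam u = g u by move=> hu; rewrite /Gam clamp_id// -ler_norml.
have [x1 [y1 [x10 y10 dx1 dy1]]] := picard_at PL GL 0 (x 0) (y 0).
have xM t : 0 <= t <= T -> `|x t| < M.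
  by move=> tT; rewrite ger0_norm ?(arc_x_ge0 a)//; have := xM0 t tT; rewrite /M; lra.
exists M, L, Phi, Gam, x1, y1; split => // t /andP[t0 tT].
have [||||h _] := @ode_gronwall _ Phi Gam x1 y1 x y L 0 t t0 L0.
- by move=> u _; split; [exact: is_derive_cont (dx1 u)|exact: is_derive_cont (dy1 u)
     |exact: arc_contx a _|exact: arc_conty a _].
- by move=> u _; split.
- move=> u ut; have uT : 0 < u < T by clear -ut tT; lra.
  have uT' : 0 <= u <= T by clear -uT; lra.
  rewrite PhiE ?ltW ?xM// GamE ?ltW ?xM//.
  by split; [exact: arc_derx a _ uT|exact: arc_dery a _ uT].
- by move=> u _; split.
move: h; rewrite /= x10 y10 !subrr expr0n /= addr0 mul0r => /sum_sqr_eq0[].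
by move=> /eqP + /eqP; rewrite !subr_eq0 => /eqP -> /eqP ->.
Qed.

(** The perturbed solution is started at time [s], not at an end of the new arc; the ends are
    recovered by [arc_of_crossings]. The case [p = 0] covers points of the y-axis near the ends of
    the given arc. *)
Lemma arc_perturb (R : realType) (F f g x y : R -> R) (T : R) (V : set (R * R)) :
  side F f g -> arc F g x y T ->
  (forall t : R, 0 <= t <= T -> nbhs (x t, y t) V) ->
  forall s : R, 0 <= s <= T -> exists2 r : R, 0 < r &
    forall p q : R, `|p - x s| < r -> `|q - y s| < r -> 0 <= p ->
      exists X Y S, [/\ arc F g X Y S,
        exists2 t : R, 0 <= t <= S & X t = p /\ Y t = q &
        forall t : R, 0 <= t <= S -> V (X t, Y t)].
Proof.
move=> sd a nV s sT; have T0 := arc_gt0 a.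
have [M [L [Phi [Gam [x1 [y1 [[L0 xM] [PL GL] [PhiE GamE] [dx1 dy1] agree]]]]]]] := arc_extends sd a.
have cx1 : continuous x1 by move=> t; exact: is_derive_cont (dx1 t).
have cy1 : continuous y1 by move=> t; exact: is_derive_cont (dy1 t).
pose Vt : set (R * R) := V `&` [set q | `|q.1| < M].
have cfst : continuous (fst : R * R -> R) by move=> q; exact: cvg_fst.
have csnd : continuous (snd : R * R -> R) by move=> q; exact: cvg_snd.
have cPhi : continuous Phi by exact: lip_cont PL.
have cfield : continuous (fun q : R * R => Phi q.1 - q.2).
  move=> q; have cq : {for q, continuous (Phi \o (fst : R * R -> R))}.
    by apply: continuous_comp; [exact: cfst|exact: cPhi].
  exact: (cvgB cq (csnd q)).
have ngt (h : R * R -> R) q c : {for q, continuous h} -> c < h q -> nbhs q [set u | c < h u].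
  by move=> ch hq; apply: (ch [set v | c < v]); exact: lt_nbhsr.
have nlt (h : R * R -> R) q c : {for q, continuous h} -> h q < c -> nbhs q [set u | h u < c].
  by move=> ch hq; apply: (ch [set v | v < c]); exact: lt_nbhsl.
have nVt t : 0 <= t <= T -> nbhs (x1 t, y1 t) Vt.
  move=> tT; have [E1 E2] := agree t tT; rewrite E1 E2; apply: filterI; first exact: nV.
  apply: (nlt (fun q : R * R => `|q.1|)); first by apply: cvg_norm; exact: cfst.
  exact: xM.
(* These conditions hold on neighborhoods of the extended arc near its start, in its middle and near
   its end. Where they persist, a solution crosses the axis exactly once to the right and once to
   the left. *)
pose Q1 : set (R * R) := Vt `&` [set q | 0 < Phi q.1 - q.2].
pose Q2 : set (R * R) := Vt `&` [set q | 0 < q.1].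
pose Q3 : set (R * R) := Vt `&` [set q | Phi q.1 - q.2 < 0].
have c1 t : {for t, continuous (fun t => (x1 t, y1 t))}.
  exact: (cvg_pair (cx1 t) (cy1 t)).
have local c Q : nbhs (x1 c, y1 c) Q ->
    exists2 e : R, 0 < e & forall t, `|t - c| < e -> nbhs (x1 t, y1 t) Q.
  move=> /nbhs_interior nQ; have := c1 c _ nQ => /nbhs_ballP[e /= e0 he].
  by exists e => // t; rewrite distrC => /he.
have T00 : (0 : R) <= 0 <= T by rewrite lexx ltW.
have TTT : 0 <= T <= T by rewrite lexx andbT ltW.
have Phi0 : Phi 0 = 0.
  by rewrite PhiE ?(side_0 sd)// normr0; apply: le_trans (normr_ge0 (x 0)) (ltW (xM 0 T00)).
have [e1 e10 he1] : exists2 e : R, 0 < e & forall t, `|t - 0| < e -> nbhs (x1 t, y1 t) Q1.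
  apply: local; apply: filterI; first exact: nVt.
  apply: ngt; first exact: cfield.
  by have [-> ->] := agree 0 T00; rewrite /= (arc_x0 a) Phi0 sub0r oppr_gt0 (arc_y0 a).
have [e2 e20 he2] : exists2 e : R, 0 < e & forall t, `|t - T| < e -> nbhs (x1 t, y1 t) Q3.
  apply: local; apply: filterI; first exact: nVt.
  apply: nlt; first exact: cfield.
  by have [-> ->] := agree T TTT; rewrite /= (arc_xT a) Phi0 sub0r oppr_lt0 (arc_yT a).
have [e [e0 ee1 ee2 eT]] : exists e, [/\ 0 < e, e < e1, e < e2 & e < T / 3].
  clear -e10 e20 T0.
  pose m := Num.min (Num.min e1 e2) (T / 3).
  have [m0 m1 m2 m3] : [/\ 0 < m, m <= e1, m <= e2 & m <= T / 3].
    by rewrite /m !lt_min !ge_min !lexx ?orbT e10 e20 divr_gt0.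
  by exists (m / 2); split; lra.
have n1 t : - e <= t <= e -> nbhs (x1 t, y1 t) Q1.
  by move=> te; apply: he1; rewrite subr0 ltr_norml; clear -te ee1; lra.
have n3 t : T - e <= t <= T + e -> nbhs (x1 t, y1 t) Q3.
  by move=> te; apply: he2; rewrite ltr_distl; clear -te ee2; lra.
have n2 t : e <= t <= T - e -> nbhs (x1 t, y1 t) Q2.
  move=> te; have tT : 0 < t < T by clear -te e0; lra.
  have tT' : 0 <= t <= T by clear -tT; lra.
  apply: filterI; first by apply: nVt.
  apply: ngt; first exact: cfst.
  by have [-> _] := agree t tT'; apply: (arc_pos a).
have [i1 i2 i3] : [/\ - e < e, e < T - e & T - e < T + e] by clear -e0 eT; split; lra.
have [h1 h10 H1] := @tube _ x1 y1 (- e) e Q1 (ltW i1) cx1 cy1 n1.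
have [h2 h20 H2] := @tube _ x1 y1 e (T - e) Q2 (ltW i2) cx1 cy1 n2.
have [h3 h30 H3] := @tube _ x1 y1 (T - e) (T + e) Q3 (ltW i3) cx1 cy1 n3.
have dx1N t := is_deriveN (dx1 t).
have xneg1 : x1 (- e) < 0.
  rewrite -(arc_x0 a) -(agree 0 T00).1.
  have e0' : - e < 0 by rewrite oppr_lt0.
  apply: (deriv_gt0_lt e0' (fun t _ => cx1 t) (fun t _ => dx1 t)) => t ht.
  have te : - e <= t <= e by clear -ht e0; lra.
  by have /nbhs_singleton[_] := n1 t te.
have xneg2 : x1 (T + e) < 0.
  rewrite -(arc_xT a) -(agree T TTT).1 -ltrN2.
  have e0' : T < T + e by rewrite ltrDl.
  apply: (deriv_gt0_lt e0' (fun t _ => is_derive_cont (dx1N t)) (fun t _ => dx1N t)) => t ht.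
  have te : T - e <= t <= T + e by clear -ht e0; lra.
  by have /nbhs_singleton[_] := n3 t te; rewrite /= oppr_gt0.
(* An [eta]-close solution stays in the three tubes and still has negative x at the times [- e] and
   [T + e]. *)
have [eta [eta0 eta1 eta2 eta3 [eta4 eta5]]] : exists eta, [/\ 0 < eta, eta <= h1,
  eta <= h2, eta <= h3 &
    eta <= - x1 (- e) /\ eta <= - x1 (T + e)].
  exists (Num.min (Num.min h1 h2) (Num.min h3 (Num.min (- x1 (- e)) (- x1 (T + e))))).
  by rewrite !lt_min !ge_min !lexx ?orbT h10 h20 h30 !oppr_gt0 xneg1 xneg2.
have [r r0 hr] := flow_close (T + 2 * e) L0 PL GL dx1 dy1 eta0.
exists r => // p q pr qr p0.
have [xs1 ys1] := agree s sT.
have [|| X [Y [[Xs Ys] dX dY close]]] := hr s p q; [by rewrite xs1|by rewrite ys1|].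
have near t : - e <= t <= T + e -> `|X t - x1 t| < eta /\ `|Y t - y1 t| < eta.
  by move=> te; apply: close; rewrite ler_distl; clear -te sT e0; lra.
have K1 t : - e <= t <= e -> Q1 (X t, Y t).
  move=> te; have te' : - e <= t <= T + e by clear -te T0; lra.
  by have [c c'] := near t te'; apply: (H1 t) => //;
    [exact: lt_le_trans c _|exact: lt_le_trans c' _].
have K2 t : e <= t <= T - e -> Q2 (X t, Y t).
  move=> te; have te' : - e <= t <= T + e by clear -te e0; lra.
  by have [c c'] := near t te'; apply: (H2 t) => //;
    [exact: lt_le_trans c _|exact: lt_le_trans c' _].
have K3 t : T - e <= t <= T + e -> Q3 (X t, Y t).
  move=> te; have te' : - e <= t <= T + e by clear -te i1 i2; lra.
  by have [c c'] := near t te'; apply: (H3 t) => //;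
    [exact: lt_le_trans c _|exact: lt_le_trans c' _].
rewrite -Xs -Ys.
apply: (@arc_of_crossings _ F g Phi Gam X Y M (- e) e (T - e) (T + e) s V PhiE GamE Phi0 dX dY i1 i2 i3).
- by move=> t /K1[].
- by move=> t /K2[].
- by move=> t /K3[].
- move=> t /andP[te1 te2].
  have VtE q' : Vt q' -> `|q'.1| <= M /\ V q' by move=> [? /= /ltW].
  have [h|h] := leP t e; first by have [/VtE] := K1 t (introT andP (conj te1 h)).
  have [h'|h'] := leP t (T - e); first by have [/VtE] := K2 t (introT andP (conj (ltW h) h')).
  by have [/VtE] := K3 t (introT andP (conj (ltW h') te2)).
- have te' : - e <= - e <= T + e by clear -i1 i2 i3; lra.
  by have [+ _] := near _ te'; rewrite ltr_distl; clear -eta4; lra.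
- have te' : - e <= T + e <= T + e by clear -i1 i2 i3; lra.
  by have [+ _] := near _ te'; rewrite ltr_distl; clear -eta5; lra.
- by clear -sT e0; lra.
- by rewrite Xs.
Qed.

(** * Closing up two arcs *)

(** The left half-system enters in the reflected form of [side], so that exchanging the half-planes
    amounts to swapping the indices 1 and 2. *)
Definition inclusion (R : realType) (F1 g1 F2 g2 : R -> R) : R * R -> set (R * R) :=
  filippov_field (fun q => (F1 q.1 - q.2, g1 q.1))
    (fun q => (F2 (- q.1) - q.2, - g2 (- q.1))).

Definition closed_curve (R : realType) (x1 y1 : R -> R) (T1 : R) (x2 y2 : R -> R) (T2 : R) :
    set (R * R) :=
  [set q | (exists2 t : R, 0 <= t <= T1 & q = (x1 t, y1 t)) \/
           (exists2 t : R, 0 <= t <= T2 & q = (- x2 t, y2 t))].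

(** The backward bound of [ode_gronwall] against the constant solution would give [x 0 = x t],
    whereas [x 0 = 0 < x t]. *)
Lemma arc_no_equilibrium (R : realType) (F f g x y : R -> R) (T : R) :
  side F f g -> arc F g x y T ->
  forall t : R, 0 < t < T -> ~ (F (x t) - y t = 0 /\ g (x t) = 0).
Proof.
move=> sd a t tT [eF eg].
have [M M0 xM] := arc_bounded a; have [L L0 hL] := side_lip sd M.
have /andP[t0 tT'] := tT.
have tT0 : 0 <= t <= T by rewrite !ltW.
have xMn u : 0 <= u <= T -> `|x u| <= M.
  by move=> uT; rewrite ger0_norm ?xM// (arc_x_ge0 a).
have [||||_ h] := @ode_gronwall _ F g x y (fun=> x t) (fun=> y t) L 0 t (ltW t0) L0.
- move=> u _; split; try exact: cvg_cst; [exact: arc_contx a _|exact: arc_conty a _].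
- move=> u /andP[u0 ut]; have uT : 0 < u < T by rewrite u0 (lt_trans ut).
  by split; [exact: arc_derx a _ uT|exact: arc_dery a _ uT].
- by move=> u _; rewrite eF eg; split; exact: is_derive_cst.
- move=> u /andP[u0 ut]; apply: hL; apply: xMn => //.
  by rewrite !ltW// (lt_trans ut).
move: h; rewrite /= !subrr expr0n /= addr0 mul0r => /sum_sqr_eq0[/eqP + _].
rewrite subr_eq0 (arc_x0 a) => /eqP E.
by have := arc_pos a tT; rewrite -E ltxx.
Qed.

Lemma lip_of_deriv (R : realType) (f u : R -> R) (C T : R) :
  continuous f -> (forall t : R, 0 < t < T -> is_derive t (1 : R) f (u t)) ->
  (forall t : R, 0 <= t <= T -> `|u t| <= C) ->
  forall s t : R, 0 <= s <= T -> 0 <= t <= T -> `|f s - f t| <= C * `|s - t|.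
Proof.
move=> cf df uC.
have main s t : 0 <= s -> s <= t -> t <= T -> `|f t - f s| <= C * `|t - s|.
  move=> s0; rewrite le_eqVlt => /predU1P[->|st] tT; first by rewrite !subrr normr0 mulr0.
  have [c /andP[sc ct] ->] : exists2 c : R, s < c < t & f t - f s = u c * (t - s).
    apply: MVT_pt => // [r _|r /andP[sr rt]]; first exact: cf.
    by apply: df; rewrite (le_lt_trans s0 sr) (lt_le_trans rt).
  rewrite normrM ler_wpM2r// uC// (le_trans s0 (ltW sc))/=.
  exact: le_trans (ltW ct) tT.
move=> s t /andP[s0 sT] /andP[t0 tT]; have [st|ts] := leP s t.
  by rewrite distrC [`|s - t|]distrC main.
by rewrite main// ltW.
Qed.

Lemma arc_lip (R : realType) (F f g x y : R -> R) (T : R) :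
  side F f g -> arc F g x y T ->
  exists2 C : R, 0 <= C & forall s t : R, 0 <= s <= T -> 0 <= t <= T ->
    `|x s - x t| <= C * `|s - t| /\ `|y s - y t| <= C * `|s - t|.
Proof.
move=> sd a.
have bdd (u : R -> R) : continuous u ->
  exists2 C : R, 0 <= C & forall t : R, 0 <= t <= T -> `|u t| <= C.
  move=> cu; have cu' : {within `[0, T], continuous (fun t => `|u t|)}.
    by apply: continuous_subspaceT => t; apply: cvg_norm; exact: cu.
  have [c cT hc] := EVT_max (ltW (arc_gt0 a)) cu'.
  by exists `|u c| => // t tT; apply: hc; rewrite in_itv.
have [|C1 C10 h1] := bdd (fun t => F (x t) - y t).
  move=> t; apply: continuousB; last exact: arc_conty a _.
  by apply: (@continuous_comp _ _ _ x F); [exact: arc_contx a _|exact: side_contF sd _].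
have [|C2 C20 h2] := bdd (fun t => g (x t)).
  by move=> t; apply: (@continuous_comp _ _ _ x g);
    [exact: arc_contx a _|exact: side_contg sd _].
exists (C1 + C2) => [|s t sT tT]; first exact: addr_ge0.
split.
  apply: le_trans (lip_of_deriv (arc_contx a) (arc_derx a) h1 sT tT) _.
  by rewrite ler_wpM2r// lerDl.
apply: le_trans (lip_of_deriv (arc_conty a) (arc_dery a) h2 sT tT) _.
by rewrite ler_wpM2r// lerDr.
Qed.

Definition periodic_part (R : realType) (T t : R) : R := t - T * (Num.floor (t / T))%:~R.

Lemma periodic_part_itv (R : realType) (T t : R) : 0 < T -> 0 <= periodic_part T t < T.
Proof.
move=> T0; have /andP[h1 h2] := floor_itv (t / T).
rewrite /periodic_part mulrC subr_ge0 -ler_pdivlMr// h1 /=.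
by rewrite ltrBlDr addrC -[X in _ + X]mul1r -mulrDl -intrD1 -ltr_pdivrMr.
Qed.

Lemma periodic_part_eq (R : realType) (T t : R) (n : int) : 0 < T ->
  0 <= t - T * n%:~R < T -> periodic_part T t = t - T * n%:~R.
Proof.
move=> T0 /andP[h1 h2]; rewrite /periodic_part (_ : Num.floor (t / T) = n)//.
apply: floor_def; rewrite ler_pdivlMr// ltr_pdivrMr// mulrC -subr_ge0 h1 /=.
by rewrite intrD1 mulrDl mul1r mulrC -ltrBlDl.
Qed.

Lemma periodic_partDr (R : realType) (T t : R) : 0 < T ->
  periodic_part T (t + T) = periodic_part T t.
Proof.
move=> T0; set n := Num.floor (t / T); have h := periodic_part_itv t T0.
have E : t + T - T * (n + 1)%:~R = periodic_part T t.
  by rewrite /periodic_part -/n intrD1; ring.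
have := @periodic_part_eq _ T (t + T) (n + 1) T0.
by rewrite E; apply.
Qed.

Lemma periodic_part_id (R : realType) (T t : R) : 0 <= t < T -> periodic_part T t = t.
Proof.
move=> /andP[t0 tT]; rewrite (@periodic_part_eq _ _ _ 0) ?mulr0 ?subr0 ?t0//.
exact: le_lt_trans tT.
Qed.

(** Since one constant serves at all points, the local bounds add up along a partition given by
    [cousin]. *)
Lemma local_lip (R : realType) (f : R -> R) (C : R) :
  (forall t : R, exists2 d : R, 0 < d & forall u : R, `|u - t| < d ->
    `|f u - f t| <= C * `|u - t|) ->
  forall s t : R, `|f s - f t| <= C * `|s - t|.
Proof.
move=> loc.
have main s t : s <= t -> `|f t - f s| <= C * `|t - s|.
  move=> st; apply: (cousin (P := fun s u => `|f u - f s| <= C * `|u - s|) st).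
    move=> u _; have [d d0 hd] := loc u; exists d => // a b _ _ da au ub bd.
    have h1 := hd a; have h2 := hd b.
    have {}h1 : `|f a - f u| <= C * `|a - u| by apply: h1;
      rewrite ltr_distl da (le_lt_trans au) ?ltrDl.
    have {}h2 : `|f b - f u| <= C * `|b - u|.
      by apply: h2; rewrite ltr_distl bd andbT; apply: lt_le_trans ub; rewrite gtrDl oppr_lt0.
    have -> : f b - f a = (f b - f u) - (f a - f u) by ring.
    apply: le_trans (ler_normB _ _) _.
    rewrite (ger0_norm (_ : 0 <= b - a)); last by rewrite subr_ge0 (le_trans au).
    move: h1 h2; rewrite (ger0_norm (_ : 0 <= b - u)) ?subr_ge0//.
    rewrite (ler0_norm (_ : a - u <= 0)) ?subr_le0//; clear; lra.
  move=> a u b au ub h1 h2; have -> : f b - f a = (f b - f u) + (f u - f a) by ring.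
  apply: le_trans (ler_normD _ _) _.
  rewrite (ger0_norm (_ : 0 <= b - a)); last by rewrite subr_ge0 (le_trans au).
  move: h1 h2; rewrite (ger0_norm (_ : 0 <= b - u)) ?subr_ge0//.
  rewrite (ger0_norm (_ : 0 <= u - a)) ?subr_ge0//; clear; lra.
move=> s t; have [st|ts] := leP s t; first by rewrite distrC [`|s - t|]distrC main.
by rewrite main// ltW.
Qed.

Lemma periodic_lip (R : realType) (f : R -> R) (T C : R) : 0 < T -> f 0 = f T ->
  (forall s t : R, 0 <= s <= T -> 0 <= t <= T -> `|f s - f t| <= C * `|s - t|) ->
  forall s t : R, `|f (periodic_part T s) - f (periodic_part T t)| <= C * `|s - t|.
Proof.
move=> T0 f0T fL; apply: (@local_lip _ (fun t => f (periodic_part T t))) => t.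
set r := periodic_part T t; set n := Num.floor (t / T).
have rE : r = t - T * n%:~R by [].
have /andP[r0 rT] := periodic_part_itv t T0; rewrite -/r in r0 rT.
have near (u : R) : 0 <= r + (u - t) < T -> `|f (periodic_part T u) - f r| <= C * `|u - t|.
  move=> ur; have E : u - T * n%:~R = r + (u - t) by rewrite rE; ring.
  have := @periodic_part_eq _ T u n T0; rewrite E => /(_ ur) ->; have /andP[h1 h2] := ur.
  have -> : u - t = (r + (u - t)) - r by ring.
  rewrite [r + (r + (u - t) - r)](_ : _ = r + (u - t)); last by ring.
  by apply: fL; rewrite ?r0 ?h1 ltW.
move: r0; rewrite le_eqVlt => /predU1P[r0|r0]; last first.
  exists (Num.min r (T - r)) => [|u]; first by rewrite lt_min r0 subr_gt0.
  rewrite lt_min !ltr_distl => /andP[/andP[a1 a2] /andP[a3 a4]]; apply: near.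
  by clear -a1 a4; lra.
exists T => // u; rewrite ltr_distl => /andP[u1 u2]; have [tu|ut] := leP t u.
  by apply: near; rewrite -r0 add0r subr_ge0 tu; clear -u2; lra.
(* Here [t] is a multiple of [T] and [u] lies to its left: the floor drops by one and the periodic
   part wraps round to the end of the period, where [f] has the same value as at 0. *)
have E : u - T * (n - 1)%:~R = T - (t - u).
  by rewrite intrB mulrBr mulr1; move: rE; rewrite -r0; clear; lra.
have h0 : 0 <= T - (t - u) < T by clear -ut u1; lra.
have := @periodic_part_eq _ T u (n - 1) T0; rewrite E => /(_ h0) ->.
rewrite -r0 f0T; have -> : `|u - t| = `|T - (t - u) - T| by congr (`|_|); ring.
by apply: fL; [have /andP[-> /ltW ->] := h0|rewrite lexx andbT ltW].
Qed.

Lemma countable_ae (R : realType) (P : R -> Prop) (A : set R) :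
  (forall t, ~ P t -> A t) -> countable A -> {ae lebesgue_measure, forall t : R, P t}.
Proof.
move=> sub cA; exists A; split; last exact: sub.
- exact: countable_measurable.
- exact: countable_lebesgue_measure0.
Qed.

Lemma ae_negligible (R : realType) (P : R -> Prop) :
  {ae lebesgue_measure, forall t : R, P t} ->
  exists2 N : set R, (@lebesgue_measure R).-negligible N & forall t, ~ N t -> P t.
Proof.
move=> [A [mA A0 sub]]; exists A; first by exists A; split.
by move=> t nA; apply: contrapT => nP; apply: nA; apply: sub.
Qed.

Lemma pair_derive1 (R : realType) (x y : R -> R) (t dx dy : R) :
  is_derive t (1 : R) x dx -> is_derive t (1 : R) y dy ->
  derivable (fun t => (x t, y t)) t 1 /\ (fun t => (x t, y t))^`()%classic t = (dx, dy).
Proof.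
move=> [hx <-] [hy <-].
have cv : h^-1 *: (((fun t =>
  (x t, y t)) \o shift t) (h *: (1 : R)) - (x t, y t)) @[h --> 0^'] -->
    ('D_1 x t, 'D_1 y t) by exact: (cvg_pair hx hy).
split; first by apply/cvg_ex; exists ('D_1 x t, 'D_1 y t).
by rewrite derive1E; apply/cvg_lim.
Qed.

Lemma derive1_pair (R : realType) (z : R -> R * R) (t : R) :
  derivable z t 1 -> is_derive t (1 : R) (fun t => (z t).1) (z^`()%classic t).1 /\
                     is_derive t (1 : R) (fun t => (z t).2) (z^`()%classic t).2.
Proof.
move=> dz; rewrite derive1E.
have cv : h^-1 *: ((z \o shift t) (h *: (1 : R)) - z t) @[h --> 0^'] --> 'D_1 z t
  by exact: dz.
have cvx : (h^-1 *: ((z \o shift t) (h *: (1 : R)) - z t)).1 @[h --> 0^'] --> ('D_1 z t).1.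
  by apply: (@cvg_comp _ _ _ _ fst _ _ _ cv); exact: cvg_fst.
have cvy : (h^-1 *: ((z \o shift t) (h *: (1 : R)) - z t)).2 @[h --> 0^'] --> ('D_1 z t).2.
  by apply: (@cvg_comp _ _ _ _ snd _ _ _ cv); exact: cvg_snd.
split; split.
- by apply/cvg_ex; exists ('D_1 z t).1; exact: cvx.
- by apply/cvg_lim => //; exact: cvx.
- by apply/cvg_ex; exists ('D_1 z t).2; exact: cvy.
- by apply/cvg_lim => //; exact: cvy.
Qed.

Lemma lip_absolutely_continuous (R : realType) (x y : R -> R) (C a b : R) : 0 <= C ->
  (forall s t : R, `|x s - x t| <= C * `|s - t|) ->
  (forall s t : R, `|y s - y t| <= C * `|s - t|) ->
  absolutely_continuous_on a b (fun t => (x t, y t)).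
Proof.
move=> C0 xL yL e e0; have C1 : 0 < C + 1 by lra.
exists (e / (C + 1)) => [|n s t st _]; first exact: divr_gt0.
rewrite ltr_pdivlMr// mulrC => h; apply: le_lt_trans h.
rewrite mulr_sumr; apply: ler_sum => i _; have [_ sti _] := st i.
have E : `|t i - s i| = t i - s i by rewrite ger0_norm// subr_ge0.
apply: (@le_trans _ _ (C * (t i - s i))); last first.
  by rewrite ler_wpM2r ?subr_ge0// lerDl.
by rewrite prod_normE /= ge_max -E xL yL.
Qed.

Section Glue.
Variables (R : realType) (F1 f1 g1 F2 f2 g2 x1 y1 x2 y2 : R -> R) (T1 T2 : R).
Hypotheses (sd1 : side F1 f1 g1) (sd2 : side F2 f2 g2).
Hypotheses (a1 : arc F1 g1 x1 y1 T1) (a2 : arc F2 g2 x2 y2 T2).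
Hypotheses (y0 : y2 0 = y1 0) (yT : y2 T2 = y1 T1).

Let T := T1 + T2.
(** The second arc is run backwards, because the reflection into the left half-plane reverses time.
    It starts at its end [T2] when [t = T1] and returns to its start when [t = T]. *)
Let xw t := if t < T1 then x1 t else - x2 (T - t).
Let yw t := if t < T1 then y1 t else y2 (T - t).
Let X t := xw (periodic_part T t).
Let Y t := yw (periodic_part T t).

Let T1gt0 : 0 < T1. Proof. exact: arc_gt0 a1. Qed.
Let T2gt0 : 0 < T2. Proof. exact: arc_gt0 a2. Qed.
Let Tgt0 : 0 < T. Proof. by rewrite /T addr_gt0. Qed.
Let T1T : T1 < T. Proof. by rewrite /T ltrDl. Qed.

Lemma glue_lip (u v w : R -> R) (C1 C2 : R) : 0 <= C1 -> 0 <= C2 ->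
  (forall t, w t = if t < T1 then u t else v (T - t)) -> v T2 = u T1 ->
  (forall s t : R, 0 <= s <= T1 -> 0 <= t <= T1 -> `|u s - u t| <= C1 * `|s - t|) ->
  (forall s t : R, 0 <= s <= T2 -> 0 <= t <= T2 -> `|v s - v t| <= C2 * `|s - t|) ->
  forall s t : R, 0 <= s <= T -> 0 <= t <= T -> `|w s - w t| <= (C1 + C2) * `|s - t|.
Proof.
move=> C10 C20 wE vu uL vL.
have wu t : 0 <= t <= T1 -> w t = u t.
  move=> /andP[t0]; rewrite wE le_eqVlt => /predU1P[->|->//].
  by rewrite ltxx /T addrAC subrr add0r.
have wv t : T1 <= t <= T -> w t = v (T - t).
  by move=> /andP[h _]; rewrite wE ltNge h.
have B1 s t : 0 <= s <= T1 -> 0 <= t <= T1 -> `|w s - w t| <= (C1 + C2) * `|s - t|.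
  move=> hs ht; rewrite !wu//; apply: le_trans (uL _ _ hs ht) _.
  by rewrite ler_wpM2r// lerDl.
have B2 s t : T1 <= s <= T -> T1 <= t <= T -> `|w s - w t| <= (C1 + C2) * `|s - t|.
  move=> hs ht; rewrite !wv//; have inT2 r : T1 <= r <= T -> 0 <= T - r <= T2.
    by rewrite /T; lra.
  apply: le_trans (vL _ _ (inT2 _ hs) (inT2 _ ht)) _.
  have -> : `|T - s - (T - t)| = `|s - t| by rewrite distrC; congr (`|_|); ring.
  by rewrite ler_wpM2r// lerDr.
have T11 : 0 <= T1 <= T1 by rewrite lexx ltW.
have T12 : T1 <= T1 <= T by rewrite lexx ltW.
have main s t : 0 <= s -> s <= t -> t <= T -> `|w s - w t| <= (C1 + C2) * `|s - t|.
  move=> s0 st tT; have [h|h] := leP t T1; first by apply: B1; apply/andP; split => //;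
    exact: le_trans h || exact: le_trans st.
  have [h'|h'] := leP T1 s; first by apply: B2; apply/andP; split => //;
    [exact: le_trans tT|exact: ltW].
  have b1 : `|w s - w T1| <= (C1 + C2) * `|s - T1| by apply: B1 => //; rewrite s0 ltW.
  have b2 : `|w T1 - w t| <= (C1 + C2) * `|T1 - t| by apply: B2 => //; rewrite tT ltW.
  have -> : w s - w t = (w s - w T1) + (w T1 - w t) by ring.
  apply: le_trans (ler_normD _ _) _; apply: le_trans (lerD b1 b2) _.
  rewrite -mulrDr ler_wpM2l ?addr_ge0// !ler0_norm; last 3 first.
  - by rewrite subr_le0.
  - by rewrite subr_le0 ltW.
  - by rewrite subr_le0 ltW.
  by lra.
move=> s t /andP[s0 sT] /andP[t0 tT]; have [st|ts] := leP s t; first exact: main.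
by rewrite distrC [`|s - t|]distrC main// ltW.
Qed.

Lemma glue_local t : let r := periodic_part T t in
  (0 < r < T1 -> exists2 d : R, 0 < d & forall u : R, `|u - t| < d ->
     X u = x1 (u - (t - r)) /\ Y u = y1 (u - (t - r))) /\
  (T1 < r -> exists2 d : R, 0 < d & forall u : R, `|u - t| < d ->
     X u = - x2 (T - (u - (t - r))) /\ Y u = y2 (T - (u - (t - r)))).
Proof.
move=> r; set n := Num.floor (t / T).
have rE : t - r = T * n%:~R by rewrite /r /periodic_part -/n; ring.
have /andP[r0 rT] := periodic_part_itv t Tgt0; rewrite -/r in r0 rT.
have E u : 0 <= u - (t - r) < T -> periodic_part T u = u - (t - r).
  by rewrite rE; exact: periodic_part_eq.
split=> [/andP[rp rT1]|rT1].
  exists (Num.min r (T1 - r)) => [|u]; first by rewrite lt_min rp subr_gt0.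
  rewrite lt_min !ltr_distl => /andP[/andP[h1 h2] /andP[h3 h4]].
  have h : u - (t - r) < T1 by lra.
  rewrite /X /Y E; first by rewrite /xw /yw h.
  by rewrite (lt_trans h T1T) andbT; lra.
exists (Num.min (r - T1) (T - r)) => [|u]; first by rewrite lt_min !subr_gt0 rT1.
rewrite lt_min !ltr_distl => /andP[/andP[h1 h2] /andP[h3 h4]].
have h : T1 <= u - (t - r) by lra.
rewrite /X /Y E; first by rewrite /xw /yw ltNge h.
by rewrite (le_trans (ltW T1gt0) h); lra.
Qed.

Lemma glue_regular t : let r := periodic_part T t in r != 0 -> r != T1 ->
  derivable (fun t => (X t, Y t)) t 1 /\
  inclusion F1 g1 F2 g2 (X t, Y t) ((fun t => (X t, Y t))^`()%classic t).
Proof.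
move=> r rn0 rnT1; have [loc1 loc2] := glue_local t; rewrite -/r in loc1 loc2.
have /andP[r0 rT] := periodic_part_itv t Tgt0; rewrite -/r in r0 rT.
have {rn0}r0 : 0 < r by rewrite lt_neqAle eq_sym rn0.
have [rT1|T1r|/eqP] := ltgtP r T1; last by rewrite (negbTE rnT1).
  have hr : 0 < r < T1 by rewrite r0.
  have [d d0 hd] := loc1 hr.
  have tr : t - (t - r) = r by ring.
  have ds : is_derive t (1 : R) (fun u => u - (t - r)) 1.
    by rewrite -[X in is_derive _ _ _ X]addr0; exact: is_deriveD.
  have [Xt Yt] := hd t (ltac:(by rewrite subrr normr0)).
  have dX : is_derive t (1 : R) X (F1 (x1 r) - y1 r).
    apply: (is_derive_near d0 (f := fun u => x1 (u - (t - r)))).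
      by move=> u /hd[-> _].
    rewrite -[X in is_derive _ _ _ X]mulr1; apply: (is_derive1_comp (f := x1) _ ds).
    by rewrite tr; exact: arc_derx a1 _ hr.
  have dY : is_derive t (1 : R) Y (g1 (x1 r)).
    apply: (is_derive_near d0 (f := fun u => y1 (u - (t - r)))).
      by move=> u /hd[_ ->].
    rewrite -[X in is_derive _ _ _ X]mulr1; apply: (is_derive1_comp (f := y1) _ ds).
    by rewrite tr; exact: arc_dery a1 _ hr.
  have [dd ->] := pair_derive1 dX dY; split => //.
  by rewrite /inclusion /filippov_field /= Xt Yt tr (arc_pos a1).
have [d d0 hd] := loc2 T1r.
have tr : T - (t - (t - r)) = T - r by ring.
have hr : 0 < T - r < T2 by rewrite subr_gt0 rT /T; lra.
have ds : is_derive t (1 : R) (fun u => T - (u - (t - r))) (- 1).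
  rewrite (_ : (fun _ => _) = (fun u => (T + (t - r)) - u)); last by apply/funext => u; ring.
  by rewrite -[X in is_derive _ _ _ X]add0r; exact: is_deriveB.
have [Xt Yt] := hd t (ltac:(by rewrite subrr normr0)).
have dX : is_derive t (1 : R) X (F2 (x2 (T - r)) - y2 (T - r)).
  apply: (is_derive_near d0 (f := fun u => - x2 (T - (u - (t - r))))).
    by move=> u /hd[-> _].
  rewrite -[X in is_derive _ _ _ X]opprK -[X in is_derive _ _ _ (- X)]mulrN1;
    apply: is_deriveN.
  apply: (is_derive1_comp (f := x2) _ ds).
  by rewrite tr; exact: arc_derx a2 _ hr.
have dY : is_derive t (1 : R) Y (- g2 (x2 (T - r))).
  apply: (is_derive_near d0 (f := fun u => y2 (T - (u - (t - r))))).
    by move=> u /hd[_ ->].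
  rewrite -[X in is_derive _ _ _ X]mulrN1; apply: (is_derive1_comp (f := y2) _ ds).
  by rewrite tr; exact: arc_dery a2 _ hr.
have [dd ->] := pair_derive1 dX dY; split => //.
have px := arc_pos a2 hr.
rewrite /inclusion /filippov_field /= Xt Yt tr oppr_gt0 ltNge (ltW px) /= oppr_lt0 px.
by rewrite opprK.
Qed.

Lemma glue_solution : filippov_solution (inclusion F1 g1 F2 g2) (fun t => (X t, Y t)).
Proof.
split=> [a b|].
  have [C1 C10 L1] := arc_lip sd1 a1; have [C2 C20 L2] := arc_lip sd2 a2.
  have wT (u v w : R -> R) : (forall t, w t = if t < T1 then u t else v (T - t)) ->
      v 0 = u 0 -> w 0 = w T.
    by move=> wE uv; rewrite !wE T1gt0 ltNge (ltW T1T) /= subrr.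
  apply: (@lip_absolutely_continuous _ _ _ (C1 + C2)); first exact: addr_ge0.
    apply: periodic_lip => //; first by apply: (wT x1 (fun s => - x2 s)) => //;
      rewrite (arc_x0 a2) (arc_x0 a1) oppr0.
    apply: (@glue_lip x1 (fun s => - x2 s)) => //.
    - by rewrite (arc_xT a2) (arc_xT a1) oppr0.
    - by move=> s t hs ht; have [] := L1 s t hs ht.
    - by move=> s t hs ht; rewrite -opprD normrN; have [] := L2 s t hs ht.
  apply: periodic_lip => //; first by apply: (wT y1 y2).
  apply: (@glue_lip y1 y2) => //.
  - by move=> s t hs ht; have [] := L1 s t hs ht.
  - by move=> s t hs ht; have [] := L2 s t hs ht.
(* The times on the y-axis, two per period, are countably many; at these the velocity may jump. *)
pose A := range (fun p : int * bool => (if p.2 then T1 else 0) + T * p.1%:~R).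
have cA : countable A by apply: sub_countable (card_image_le _ _) (countableP _).
have inA (b : bool) t : periodic_part T t = (if b then T1 else 0) -> A t.
  by move=> E; exists (Num.floor (t / T), b) => //=; rewrite -E /periodic_part; ring.
apply: (countable_ae _ cA) => t nP; apply: contrapT => nAt; apply: nP.
by apply: glue_regular; apply/eqP => E; apply: nAt; [exact: (inA false)|exact: (inA true)].
Qed.

(** On the y-axis every vector of the Filippov segment has first component -y, which is nonzero at
    the ends of the arcs. Inside the arcs [arc_no_equilibrium] applies. *)
Lemma glue_no_equilibrium t : ~ equilibrium (inclusion F1 g1 F2 g2) (X t, Y t).
Proof.
set r := periodic_part T t.
have /andP[r0 rT] := periodic_part_itv t Tgt0; rewrite -/r in r0 rT.
have [rT1|T1r] := ltP r T1.
  move: r0; rewrite le_eqVlt => /predU1P[r0|r0].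
    have -> : X t = 0 by rewrite /X /xw -/r rT1 -r0 (arc_x0 a1).
    have -> : Y t = y1 0 by rewrite /Y /yw -/r rT1 -r0.
    rewrite /equilibrium /inclusion /filippov_field /= ltxx oppr0 (side_0 sd1) (side_0 sd2).
    case=> l _ [E _]; have := arc_y0 a1; move: E; rewrite /GRing.scale /= sub0r.
    by lra.
  have hr : 0 < r < T1 by rewrite r0.
  have -> : X t = x1 r by rewrite /X /xw -/r rT1.
  have -> : Y t = y1 r by rewrite /Y /yw -/r rT1.
  rewrite /equilibrium /inclusion /filippov_field /= (arc_pos a1 hr) => -[E1 E2].
  by apply: (arc_no_equilibrium sd1 a1 hr).
have Xt : X t = - x2 (T - r) by rewrite /X /xw -/r ltNge T1r.
have Yt : Y t = y2 (T - r) by rewrite /Y /yw -/r ltNge T1r.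
move: T1r; rewrite le_eqVlt => /predU1P[E|T1r].
  have TT2 : T - r = T2 by rewrite -E /T addrAC subrr add0r.
  rewrite Xt Yt TT2 (arc_xT a2) oppr0.
  rewrite /equilibrium /inclusion /filippov_field /= ltxx oppr0 (side_0 sd1) (side_0 sd2).
  case=> l _ [E1 _]; have := arc_yT a2; move: E1; rewrite /GRing.scale /= sub0r.
  by lra.
have hr : 0 < T - r < T2 by rewrite subr_gt0 rT /T; lra.
have px := arc_pos a2 hr.
rewrite Xt Yt /equilibrium /inclusion /filippov_field /= oppr_gt0 ltNge (ltW px) /= oppr_lt0 px opprK.
move=> -[E1 E2]; apply: (arc_no_equilibrium sd2 a2 hr); split; first by rewrite -E1.
by rewrite -[LHS]opprK -E2 oppr0.
Qed.

Lemma glue_range : closed_curve x1 y1 T1 x2 y2 T2 = range (fun t => (X t, Y t)).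
Proof.
have id t : 0 <= t < T -> (X t, Y t) = (xw t, yw t).
  by move=> h; rewrite /X /Y periodic_part_id.
apply/seteqP; split=> [q [[t /andP[t0 tT] ->]|[t /andP[t0 tT] ->]]|_ [t _ <-]].
- exists t => //; rewrite id; last by rewrite t0 (le_lt_trans tT).
  move: tT; rewrite le_eqVlt => /predU1P[->|tT]; last by rewrite /xw /yw tT.
  have -> : (xw T1, yw T1) = (- x2 T2, y2 T2).
    by rewrite /xw /yw ltxx (_ : T - T1 = T2)// /T addrAC subrr add0r.
  by rewrite (arc_xT a1) (arc_xT a2) oppr0 yT.
- move: t0; rewrite le_eqVlt => /predU1P[<-|t0].
    exists 0 => //; rewrite id ?lexx// /xw /yw T1gt0 (arc_x0 a1) (arc_x0 a2) y0 oppr0//.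
  exists (T - t) => //; rewrite id;
    last by rewrite subr_ge0 gtrDl oppr_lt0 t0 (le_trans tT)// /T lerDr ltW.
  have -> : (xw (T - t), yw (T - t)) = (- x2 t, y2 t); last by [].
  have h : (T - t < T1) = false by rewrite /T; apply/negbTE; rewrite -leNgt; lra.
  by rewrite /xw /yw h; have -> : T - (T - t) = t by ring.
set r := periodic_part T t.
have /andP[r0 rT] := periodic_part_itv t Tgt0; rewrite -/r in r0 rT.
have [rT1|T1r] := ltP r T1.
  left; exists r; first by rewrite r0 ltW.
  by rewrite /X /Y /xw /yw -/r rT1.
right; exists (T - r); first by rewrite subr_ge0 (ltW rT) /T; lra.
by rewrite /X /Y /xw /yw -/r ltNge T1r.
Qed.

Lemma glue_arcs : exists z : R -> R * R, [/\ filippov_solution (inclusion F1 g1 F2 g2) z,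
  forall t, z (t + T) = z t, forall t, ~ equilibrium (inclusion F1 g1 F2 g2) (z t),
  closed_curve x1 y1 T1 x2 y2 T2 = range z & z 0 = (0, y1 0)].
Proof.
exists (fun t => (X t, Y t)); split.
- exact: glue_solution.
- by move=> t; rewrite /X /Y periodic_partDr.
- exact: glue_no_equilibrium.
- exact: glue_range.
- by rewrite /X /Y periodic_part_id ?lexx// /xw /yw T1gt0 (arc_x0 a1).
Qed.

End Glue.

(** * Filippov solutions avoiding the origin *)

(** The function of x from which y is subtracted in the first component of the field. It is
    continuous because both [F1] and [F2] vanish at 0, so x obeys an ordinary equation even on the
    axis. *)
Definition side_map (R : realType) (F1 F2 : R -> R) (x : R) : R :=
  if 0 <= x then F1 x else F2 (- x).

(** The classical content of a Filippov solution that avoids the origin: x is differentiable at all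
    times, while y is merely continuous at crossings, where x has nonzero derivative by
    [reg_axis]. *)
Record regular_solution (R : realType) (F1 g1 F2 g2 x y : R -> R) : Prop := RegularSolution {
  reg_x : forall t : R, is_derive t (1 : R) x (side_map F1 F2 (x t) - y t);
  reg_conty : continuous y;
  reg_pos : forall t : R, 0 < x t -> is_derive t (1 : R) y (g1 (x t));
  reg_neg : forall t : R, x t < 0 -> is_derive t (1 : R) y (- g2 (- x t));
  reg_axis : forall t : R, x t = 0 -> y t <> 0 }.

Lemma ac_cont (R : realType) (f : R -> R) :
  (forall a b : R, absolutely_continuous_on a b (f : R -> R)) -> continuous f.
Proof.
move=> acf t; apply/cvg_realP => e e0.
have [d d0 hd] := acf (t - 1) (t + 1) e e0.
have one (s u : R) : t - 1 <= s -> s <= u -> u <= t + 1 -> u - s < d -> `|f u - f s| < e.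
  move=> ts su ut usd; have := hd 1%N (fun=> s) (fun=> u).
  rewrite !big_ord1; apply => //.
  by move=> i j _ _ _; rewrite [i]ord1 [j]ord1.
exists (Num.min d 1) => [|u]; first by rewrite lt_min d0 ltr01.
rewrite lt_min => /andP[ud u1]; have a1 := ler_norm (u - t).
have := ler_norm (t - u); rewrite distrC => a2.
have [tu|ut] := leP t u; first by apply: one => //; lra.
by rewrite distrC; apply: one; lra.
Qed.

(** Near [t0] the almost everywhere derivative is within [e] of [h t0], so [ac_mean_value] bounds
    the difference quotients at [t0] itself. *)
Lemma ac_is_derive (R : realType) (f h : R -> R) (N : set R) (t0 r : R) :
  (forall a b : R, absolutely_continuous_on a b (f : R -> R)) ->
  (@lebesgue_measure R).-negligible N -> 0 < r ->
  (forall t : R, `|t - t0| < r -> ~ N t -> is_derive t (1 : R) f (h t)) ->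
  {for t0, continuous h} -> is_derive t0 (1 : R) f (h t0).
Proof.
move=> acf N0 r0 fh ch; apply/is_deriveP => e e0.
have [d d0 hd] := (cvg_realP _ _ _).1 ch e e0.
exists (Num.min r d) => [|u]; first by rewrite lt_min r0.
rewrite lt_min !ltr_distl => /andP[/andP[u1 u2] /andP[u3 u4]].
have main (a b : R) : a <= b -> t0 - r < a -> t0 - d < a -> b < t0 + r -> b < t0 + d ->
    `|f b - f a - h t0 * (b - a)| <= e * (b - a).
  move=> ab a1 a2 b1 b2; apply: (ac_mean_value ab (ltW e0) (acf a b) N0) => t tab Nt.
  exists (h t); first by apply: fh => //; rewrite ltr_distl; lra.
  by apply/ltW/hd; rewrite ltr_distl; lra.
have [tu|ut] := leP t0 u.
  rewrite (ger0_norm (_ : 0 <= u - t0)) ?subr_ge0//; apply: (main t0 u) => //; lra.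
rewrite (ltr0_norm (_ : u - t0 < 0)) ?subr_lt0// opprB.
have -> : f u - f t0 - h t0 * (u - t0) = - (f t0 - f u - h t0 * (t0 - u)) by ring.
by rewrite normrN; apply: (main u t0) => //; lra.
Qed.

Lemma side_map_cont (R : realType) (F1 f1 g1 F2 f2 g2 : R -> R) :
  side F1 f1 g1 -> side F2 f2 g2 -> continuous (side_map F1 F2).
Proof.
move=> sd1 sd2.
have E : side_map F1 F2 = (fun x => F1 (Num.max x 0) + F2 (Num.max (- x) 0)).
  apply/funext => x; rewrite /side_map; have [x0|x0] := leP 0 x.
    by rewrite max_r ?oppr_le0// (side_0 sd2) addr0.
  by rewrite max_l ?oppr_ge0 ?ltW// (side_0 sd1) add0r.
have cm : continuous (fun x : R => Num.max x 0).
  by move=> x; apply: (@continuous_max _ _ id (fun=> 0)); [exact: cvg_id|exact: cvg_cst].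
rewrite E => x; apply: continuousD.
  by apply: (@continuous_comp _ _ _ (fun x : R => Num.max x 0) F1);
    [exact: cm|exact: side_contF sd1 _].
apply: (@continuous_comp _ _ _ (fun x : R => Num.max (- x) 0) F2);
  last exact: side_contF sd2 _.
apply: (@continuous_comp _ _ _ -%R (fun x : R => Num.max x 0)); last exact: cm.
exact: opp_continuous.
Qed.

Lemma same_ratio_sym (R : realType) (f1 g1 F1 f2 g2 F2 : R -> R) :
  same_ratio f1 g1 F1 f2 g2 F2 -> same_ratio f2 g2 F2 f1 g1 F1.
Proof. by move=> h u v u0 v0 E; rewrite h. Qed.

(** Arbitrarily small [u] and [w] with [F1 u = F2 w] exist; at such a pair the two sides of the
    ratio identity would have opposite signs. In the original system, g^+(0) and g^-(0) cannot both
    be positive; swapping the sides, nor both negative. *)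
Lemma same_ratio_sign (R : realType) (F1 f1 g1 F2 f2 g2 : R -> R) :
  side F1 f1 g1 -> side F2 f2 g2 -> same_ratio f1 g1 F1 f2 g2 F2 ->
  0 < g1 0 -> g2 0 < 0 -> False.
Proof.
move=> sd1 sd2 rat gp gn.
have cg1 : continuous g1 by exact: side_contg sd1.
have cg2 : continuous g2 by exact: side_contg sd2.
have cF1 : continuous F1 by exact: side_contF sd1.
have [d1 d10 h1] := (cvg_realP _ _ _).1 (cg1 0) _ gp.
have gn' : 0 < - g2 0 by rewrite oppr_gt0.
have [d2 d20 h2] := (cvg_realP _ _ _).1 (cg2 0) _ gn'.
pose v := d2 / 2; have v0 : 0 < v by rewrite /v; lra.
have Fv : 0 < F2 v by rewrite -(side_0 sd2); apply: side_mono sd2 _ _ _ _.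
have [d3 d30 h3] := (cvg_realP _ _ _).1 (cF1 0) _ Fv.
pose u := Num.min d1 d3 / 2.
have [u0 ud1 ud3] : [/\ 0 < u, u < d1 & u < d3].
  by rewrite /u /Num.min; case: (ltP d1 d3) => ?; split; lra.
have Fu : 0 < F1 u by rewrite -(side_0 sd1); apply: side_mono sd1 _ _ _ _.
have Fuv : F1 u < F2 v.
  by have := h3 u; rewrite subr0 gtr0_norm// (side_0 sd1) subr0 gtr0_norm//; apply.
have [w /andP[w0 wv] Fw] : exists2 w : R, 0 <= w <= v & F2 w = F1 u.
  apply: ivt_pt; first exact: ltW.
    by move=> t _; exact: side_contF sd2 _.
  by rewrite (side_0 sd2) !ltW.
have {}w0 : 0 < w.
  by rewrite lt_neqAle w0 andbT; apply/eqP => E; move: Fu; rewrite -Fw -E (side_0 sd2) ltxx.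
have := rat u w u0 w0 (esym Fw).
have G1 : 0 < g1 u by have := h1 u;
  rewrite subr0 gtr0_norm// ltr_distl subrr => /(_ ud1)/andP[].
have G2 : g2 w < 0.
  have := h2 w; rewrite subr0 gtr0_norm// ltr_distl => h.
  have wd : w < d2 by rewrite (le_lt_trans wv)// /v; lra.
  by have /andP[_] := h wd; rewrite subrr.
move=> E; have : 0 < g1 u * f2 w by rewrite mulr_gt0// (side_pos sd2).
by rewrite E nmulr_rgt0// ltNge ltW// (side_pos sd1).
Qed.

(** At the origin the Filippov segment joins [(0, g1 0)] to [(0, - g2 0)]. Since [g1 0] and [g2 0]
    do not have strictly opposite signs, 0 lies on it; the weight [g2 0 / (g1 0 + g2 0)] solves the
    linear equation when both are nonzero. *)
Lemma origin_equilibrium (R : realType) (F1 f1 g1 F2 f2 g2 : R -> R) :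
  side F1 f1 g1 -> side F2 f2 g2 -> same_ratio f1 g1 F1 f2 g2 F2 ->
  equilibrium (inclusion F1 g1 F2 g2) (0, 0).
Proof.
move=> sd1 sd2 rat; rewrite /equilibrium /inclusion /filippov_field /= ltxx oppr0.
rewrite (side_0 sd1) (side_0 sd2) addr0.
have H1 := same_ratio_sign sd1 sd2 rat.
have H2 := same_ratio_sign sd2 sd1 (same_ratio_sym rat).
suff [l l01 lE] : exists2 l : R, 0 <= l <= 1 & l * g1 0 + (1 - l) * - g2 0 = 0.
  exists l; first by rewrite /= in_itv.
  have -> : (l *: (0, g1 0) + (1 - l) *: (0, - g2 0) : R * R) =
    (l * 0 + (1 - l) * 0, l * g1 0 + (1 - l) * - g2 0) by [].
  by rewrite lE !mulr0 addr0.
case: (ltgtP (g1 0) 0) (ltgtP (g2 0) 0) => [n1|p1|z1] [n2|p2|z2] //.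
- exists (g2 0 / (g1 0 + g2 0)); last by field; lra.
  by rewrite ler_ndivlMr ?ler_ndivrMr ?mul0r ?mul1r; lra.
- by case: (H2 p2 n1).
- by exists 0; [lra|rewrite z2; ring].
- by case: (H1 p1 n2).
- exists (g2 0 / (g1 0 + g2 0)); last by field; lra.
  by rewrite ler_pdivlMr ?ler_pdivrMr ?mul0r ?mul1r; lra.
- by exists 0; [lra|rewrite z2; ring].
- by exists 1; [lra|rewrite z1; ring].
- by exists 1; [lra|rewrite z1; ring].
- by exists 1; [lra|rewrite z1; ring].
Qed.

(** [ac_is_derive] upgrades the almost everywhere inclusion: for x at every time, because [side_map]
    is continuous, and for y off the axis. On the axis, y = 0 would be the equilibrium at the
    origin. *)
Lemma filippov_regular (R : realType) (F1 f1 g1 F2 f2 g2 : R -> R) (z : R -> R * R) :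
  side F1 f1 g1 -> side F2 f2 g2 -> same_ratio f1 g1 F1 f2 g2 F2 ->
  filippov_solution (inclusion F1 g1 F2 g2) z ->
  (forall t, ~ equilibrium (inclusion F1 g1 F2 g2) (z t)) ->
  regular_solution F1 g1 F2 g2 (fun t => (z t).1) (fun t => (z t).2).
Proof.
move=> sd1 sd2 rat [acz aez] neq.
have acx a b : absolutely_continuous_on a b (fun t => (z t).1 : R).
  move=> e e0; have [d d0 hd] := acz a b e e0; exists d => // n s t h1 h2 h3.
  apply: le_lt_trans (hd n s t h1 h2 h3); apply: ler_sum => i _.
  by rewrite prod_normE /= le_max lexx.
have acy a b : absolutely_continuous_on a b (fun t => (z t).2 : R).
  move=> e e0; have [d d0 hd] := acz a b e e0; exists d => // n s t h1 h2 h3.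
  apply: le_lt_trans (hd n s t h1 h2 h3); apply: ler_sum => i _.
  by rewrite prod_normE /= le_max lexx orbT.
have cx := ac_cont acx; have cy := ac_cont acy.
have [N N0 hN] := ae_negligible aez.
have cg1 : continuous g1 by exact: side_contg sd1.
have cg2 : continuous g2 by exact: side_contg sd2.
have loc c (P : R -> Prop) : nbhs (z c).1 [set u | P u] ->
    exists2 r : R, 0 < r & forall t, `|t - c| < r -> P (z t).1.
  move=> /(cx c) /nbhs_ballP[r /= r0 hr]; exists r => // t tr.
  by apply: hr; rewrite /ball /= distrC.
split.
- move=> c; apply: (@ac_is_derive _ _ (fun t =>
  side_map F1 F2 (z t).1 - (z t).2) _ _ _ acx N0 ltr01).
    move=> t _ /hN[dz Kz]; have [dx _] := derive1_pair dz.
    apply: (is_derive_eq dx); move: Kz; rewrite /inclusion /filippov_field /side_map.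
    have [xp|xn|x0] := ltgtP 0 (z t).1.
    + by move=> ->.
    + by move=> ->.
    + move=> [l _ <-]; rewrite -x0 /= oppr0 (side_0 sd1) (side_0 sd2) /GRing.scale /=; ring.
  apply: continuousB; last exact: cy.
  by apply: (@continuous_comp _ _ _ (fun t => (z t).1) (side_map F1 F2));
    [exact: cx|exact: side_map_cont sd1 sd2 _].
- exact: cy.
- move=> c xp; have [r r0 hr] := loc c _ (lt_nbhsr xp).
  apply: (@ac_is_derive _ _ (fun t => g1 (z t).1) _ _ _ acy N0 r0).
    move=> t /hr tp /hN[dz Kz]; have [_ dy] := derive1_pair dz.
    by apply: (is_derive_eq dy); move: Kz; rewrite /inclusion /filippov_field tp => ->.
  by apply: (@continuous_comp _ _ _ (fun t => (z t).1) g1); [exact: cx|exact: cg1].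
- move=> c xn; have [r r0 hr] := loc c _ (lt_nbhsl xn).
  apply: (@ac_is_derive _ _ (fun t => - g2 (- (z t).1)) _ _ _ acy N0 r0).
    move=> t /hr tp /hN[dz Kz]; have [_ dy] := derive1_pair dz.
    apply: (is_derive_eq dy); move: Kz; rewrite /inclusion /filippov_field.
    by rewrite ltNge (ltW tp) /= tp => ->.
  apply: continuousN; apply: (@continuous_comp _ _ _ (fun t => - (z t).1) g2);
    last exact: cg2.
  by apply: continuousN; exact: cx.
- move=> t x0 y0; apply: (neq t); rewrite (_ : z t = (0, 0)).
    exact: origin_equilibrium sd1 sd2 rat.
  by move: x0 y0; case: (z t) => /= u v -> ->.
Qed.

Lemma deriv_sign (R : realType) (x : R -> R) (t c : R) :
  is_derive t (1 : R) x c -> x t = 0 -> 0 < c ->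
  exists2 d : R, 0 < d & forall u : R, `|u - t| < d ->
    (t < u -> 0 < x u) /\ (u < t -> x u < 0).
Proof.
move=> /is_deriveP dx x0 c0; have c20 : 0 < c / 2 by rewrite divr_gt0.
have [d d0 hd] := dx _ c20; exists d => // u /hd; rewrite x0 subr0 ler_norml => /andP[h1 h2].
split=> tu.
  move: h1; rewrite gtr0_norm ?subr_gt0// => h1.
  have : 0 < c / 2 * (u - t) by rewrite mulr_gt0// subr_gt0.
  lra.
move: h2; rewrite ltr0_norm ?subr_lt0// => h2.
have : 0 < c / 2 * (t - u) by rewrite mulr_gt0// subr_gt0.
lra.
Qed.

Lemma regular_crossing (R : realType) (F1 f1 g1 F2 g2 x y : R -> R) (t : R) :
  side F1 f1 g1 -> regular_solution F1 g1 F2 g2 x y -> x t = 0 ->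
  (y t < 0 -> exists2 d : R, 0 < d & forall u : R, `|u - t| < d ->
     (t < u -> 0 < x u) /\ (u < t -> x u < 0)) /\
  (0 < y t -> exists2 d : R, 0 < d & forall u : R, `|u - t| < d ->
     (t < u -> x u < 0) /\ (u < t -> 0 < x u)).
Proof.
move=> sd1 reg x0; have := reg_x reg t; rewrite x0 /side_map lexx (side_0 sd1) sub0r => dx.
split=> y0; first by apply: (deriv_sign dx x0); rewrite oppr_gt0.
have := is_deriveN dx; rewrite opprK => dxN.
have [|d d0 hd] := deriv_sign dxN _ y0; first by rewrite fctE x0 oppr0.
exists d => // u /hd[h1 h2]; split=> h.
  by have := h1 h; rewrite fctE oppr_gt0.
by have := h2 h; rewrite fctE oppr_lt0.
Qed.

Lemma regular_contx (R : realType) (F1 g1 F2 g2 x y : R -> R) :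
  regular_solution F1 g1 F2 g2 x y -> continuous x.
Proof. by move=> reg t; exact: is_derive_cont (reg_x reg t). Qed.

(** The symmetry (x, t) |-> (-x, -t) swaps the two sides, so results on right arcs also serve for
    left ones. *)
Lemma regular_mirror (R : realType) (F1 f1 g1 F2 f2 g2 x y : R -> R) :
  side F1 f1 g1 -> side F2 f2 g2 -> regular_solution F1 g1 F2 g2 x y ->
  regular_solution F2 g2 F1 g1 (fun t => - x (- t)) (fun t => y (- t)).
Proof.
move=> sd1 sd2 reg.
have dN (t : R) : is_derive t (1 : R) (fun t : R => - t) (- 1) by exact: is_deriveNid.
have comp (u : R -> R) t c : is_derive (- t) (1 : R) u c ->
  is_derive t (1 : R) (fun t => u (- t)) (- c).
  by move=> h; rewrite -[- c]mulrN1; exact: (is_derive1_comp (f := u) h (dN t)).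
split.
- move=> t; have := is_deriveN (comp _ _ _ (reg_x reg (- t))); rewrite opprK.
  move=> h; apply: (is_derive_eq h); congr (_ - _); rewrite /side_map oppr_ge0.
  by have [] := ltgtP (x (- t)) 0 => [xn|xp|->];
    rewrite ?oppr0 ?opprK ?(side_0 sd1) ?(side_0 sd2).
- move=> t; apply: (@continuous_comp _ _ _ -%R y); first exact: opp_continuous.
  exact: reg_conty reg _.
- by move=> t; rewrite oppr_gt0 => /(reg_neg reg)/comp; rewrite opprK.
- by move=> t; rewrite oppr_lt0 opprK => /(reg_pos reg)/comp.
- by move=> t /eqP; rewrite oppr_eq0 => /eqP /(reg_axis reg).
Qed.

Lemma regular_shift (R : realType) (F1 g1 F2 g2 x y : R -> R) (s : R) :
  regular_solution F1 g1 F2 g2 x y ->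
  regular_solution F1 g1 F2 g2 (fun t => x (s + t)) (fun t => y (s + t)).
Proof.
move=> reg.
have comp (u : R -> R) t c : is_derive (s + t) (1 : R) u c ->
  is_derive t (1 : R) (fun t => u (s + t)) c.
  by move=> h; rewrite -[c]mulr1; exact: (is_derive1_comp (f := u) h (is_derive_shift1 s t)).
split.
- by move=> t; apply: comp; exact: reg_x reg _.
- move=> t; apply: (@continuous_comp _ _ _ (fun t => s + t) y); last exact: reg_conty reg _.
  exact: is_derive_cont (is_derive_shift1 s t).
- by move=> t /(reg_pos reg)/comp.
- by move=> t /(reg_neg reg)/comp.
- by move=> t /(reg_axis reg).
Qed.

(** The half-plane entered just after [t] is decided by the state at [t] alone, so two solutions
    with the same state enter the same one and obey the same Lipschitz field there. *)
Lemma eventually_nonzero (R : realType) (F1 f1 g1 F2 g2 x y : R -> R) (t : R) :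
  side F1 f1 g1 -> regular_solution F1 g1 F2 g2 x y ->
  exists2 d : R, 0 < d & if (0 < x t) || (x t == 0) && (y t < 0)
    then forall u : R, t < u < t + d -> 0 < x u
    else forall u : R, t < u < t + d -> x u < 0.
Proof.
move=> sd1 reg; have cx := regular_contx reg.
have [xp|xn|x0] := ltgtP 0 (x t) => /=.
- have [d d0 hd] := (cvg_realP _ _ _).1 (cx t) _ xp; exists d => // u /andP[tu ud].
  have := hd u; rewrite !ltr_distl subrr.
  have h : t - d < u < t + d by rewrite ud andbT (lt_trans _ tu)// gtrDl oppr_lt0.
  by move=> /(_ h)/andP[].
- have xn' : 0 < - x t by rewrite oppr_gt0.
  have [d d0 hd] := (cvg_realP _ _ _).1 (cx t) _ xn'; exists d => // u /andP[tu ud].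
  have := hd u; rewrite !ltr_distl subrr.
  have h : t - d < u < t + d by rewrite ud andbT (lt_trans _ tu)// gtrDl oppr_lt0.
  by move=> /(_ h)/andP[].
- rewrite -?x0 ?eqxx /=; have [h1 h2] := regular_crossing sd1 reg (esym x0).
  have [yn|yp|/(reg_axis reg (esym x0))//] := ltgtP (y t) 0.
    have [d d0 hd] := h1 yn; exists d => // u /andP[tu ud].
    by have [|h _] := hd u;
      [rewrite ltr_distl ud andbT (lt_trans _ tu)// gtrDl oppr_lt0|exact: h].
  have [d d0 hd] := h2 yp; exists d => // u /andP[tu ud].
  by have [|h _] := hd u;
    [rewrite ltr_distl ud andbT (lt_trans _ tu)// gtrDl oppr_lt0|exact: h].
Qed.

Lemma side_lip_neg (R : realType) (F f g : R -> R) (M : R) : side F f g ->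
  exists2 L : R, 0 <= L & forall u v : R, `|u| <= M -> `|v| <= M ->
    `|F (- u) - F (- v)| <= L * `|u - v| /\ `|- g (- u) - - g (- v)| <= L * `|u - v|.
Proof.
move=> sd; have [L L0 hL] := side_lip sd M; exists L => // u v uM vM.
have [] := hL (- u) (- v); rewrite ?normrN//.
have -> : - u - - v = - (u - v) by ring.
have -> : - g (- u) - - g (- v) = - (g (- u) - g (- v)) by ring.
by rewrite !normrN.
Qed.

Lemma regular_unique_local (R : realType) (F1 f1 g1 F2 f2 g2 x y X Y : R -> R) (t : R) :
  side F1 f1 g1 -> side F2 f2 g2 ->
  regular_solution F1 g1 F2 g2 x y -> regular_solution F1 g1 F2 g2 X Y ->
  x t = X t -> y t = Y t ->
  exists2 d : R, 0 < d & forall u : R, t <= u < t + d -> x u = X u /\ y u = Y u.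
Proof.
move=> sd1 sd2 reg Reg xX yY.
have [d1 d10 h1] := eventually_nonzero t sd1 reg.
have [d2 d20 h2] := eventually_nonzero t sd1 Reg.
(* From here on both solutions branch on the same condition. *)
rewrite -xX -yY in h2.
have cx := regular_contx reg; have cX := regular_contx Reg.
have cy : continuous y by exact: reg_conty reg.
have cY : continuous Y by exact: reg_conty Reg.
have [d3 d30 h3] := (cvg_realP _ _ _).1 (cx t) 1 ltr01.
have [d4 d40 h4] := (cvg_realP _ _ _).1 (cX t) 1 ltr01.
pose d := Num.min (Num.min d1 d2) (Num.min d3 d4).
have [d0 dd1 dd2 dd3 dd4] : [/\ 0 < d, d <= d1, d <= d2, d <= d3 & d <= d4].
  by rewrite /d !lt_min !ge_min !lexx ?orbT d10 d20 d30 d40.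
exists d => // u /andP[tu ud].
pose M := `|x t| + 1.
have near v : t < v < u -> [/\ t < v < t + d1, t < v < t + d2, `|x v| <= M & `|X v| <= M].
  move=> /andP[tv vu]; have vd : v < t + d by exact: lt_trans vu ud.
  have vt e : d <= e -> t < v < t + e by move=> de; rewrite tv (lt_le_trans vd)// lerD2l.
  have vt' e : 0 < e -> d <= e -> `|v - t| < e.
    by move=> e0 /vt/andP[_ h]; rewrite gtr0_norm ?subr_gt0// ltrBlDl.
  split; [exact: vt|exact: vt| |].
    have := h3 v (vt' _ d30 dd3); rewrite /M => h.
    by have := ler_normD (x v - x t) (x t); rewrite subrK; clear -h; lra.
  have := h4 v (vt' _ d40 dd4); rewrite /M xX => h.
  by have := ler_normD (X v - X t) (X t); rewrite subrK; clear -h; lra.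
have cz v : [/\ {for v, continuous x}, {for v, continuous y}, {for v,
  continuous X} & {for v, continuous Y}].
  by split; [exact: cx|exact: cy|exact: cX|exact: cY].
suff [h] : (exists2 K : R, True & (x u - X u) ^+ 2 + (y u - Y u) ^+ 2 <=
    ((x t - X t) ^+ 2 + (y t - Y t) ^+ 2) * K).
  move=> _; rewrite xX yY !subrr expr0n /= addr0 mul0r => /sum_sqr_eq0[].
  by move=> /eqP + /eqP; rewrite !subr_eq0 => /eqP -> /eqP ->.
case: ifP h1 h2 => _ h1 h2.
  have [L L0 hL] := side_lip sd1 M.
  have [||||h _] := @ode_gronwall _ F1 g1 x y X Y L t u tu L0.
  - by move=> v _; exact: cz.
  - move=> v /near[/h1 xp _ _ _]; split; last exact: reg_pos reg _ xp.
    by have := reg_x reg v; rewrite /side_map (ltW xp).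
  - move=> v /near[_ /h2 xp _ _]; split; last exact: reg_pos Reg _ xp.
    by have := reg_x Reg v; rewrite /side_map (ltW xp).
  - by move=> v /near[_ _ ? ?]; exact: hL.
  by eexists; last exact: h.
have [L L0 hL] := side_lip_neg M sd2.
have [||||h _] := @ode_gronwall _ (fun v => F2 (- v)) (fun v =>
  - g2 (- v)) x y X Y L t u tu L0.
- by move=> v _; exact: cz.
- move=> v /near[/h1 xn _ _ _]; split; last exact: reg_neg reg _ xn.
  by have := reg_x reg v; rewrite /side_map leNgt xn.
- move=> v /near[_ /h2 xn _ _]; split; last exact: reg_neg Reg _ xn.
  by have := reg_x Reg v; rewrite /side_map leNgt xn.
- by move=> v /near[_ _ ? ?]; exact: hL.
by eexists; last exact: h.
Qed.

Lemma regular_unique (R : realType) (F1 f1 g1 F2 f2 g2 x y X Y : R -> R) (s t : R) :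
  side F1 f1 g1 -> side F2 f2 g2 ->
  regular_solution F1 g1 F2 g2 x y -> regular_solution F1 g1 F2 g2 X Y ->
  x s = X s -> y s = Y s -> s <= t -> x t = X t /\ y t = Y t.
Proof.
move=> sd1 sd2 reg Reg xX yY st.
pose eqat u := x u = X u /\ y u = Y u.
(* Where the two solutions differ, they differ at all nearby times by continuity,
   so that the implication is locally vacuous. *)
suff : eqat s -> eqat t by apply.
apply: (cousin (P := fun s u => eqat s -> eqat u) st) => [u _|a b c _ _ h1 h2 /h1/h2//].
have [[xu yu]|neq] := pselect (eqat u).
  have [d d0 hd] := regular_unique_local sd1 sd2 reg Reg xu yu.
  by exists d => // a b _ _ _ _ ub bd _; apply: hd; rewrite ub.
pose D v := `|x v - X v| + `|y v - Y v|.
have Du : 0 < D u.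
  rewrite lt_neqAle addr_ge0// andbT eq_sym; apply/negP => /eqP.
  move=> /eqP; rewrite paddr_eq0// !normr_eq0 !subr_eq0 => /andP[/eqP ? /eqP ?].
  exact: neq.
have cD : {for u, continuous D}.
  apply: continuousD; apply: cvg_norm; apply: continuousB.
  - exact: regular_contx reg _.
  - exact: regular_contx Reg _.
  - exact: reg_conty reg _.
  - exact: reg_conty Reg _.
have [d d0 hd] := (cvg_realP _ _ _).1 cD _ Du; exists d => // a b _ _ da au _ _ [xa ya].
have := hd a; rewrite {1}/D xa ya !subrr normr0 addr0 sub0r normrN (ger0_norm (ltW Du)) ltxx.
by rewrite ltr_distl da (le_lt_trans au) ?ltrDl// => /(_ isT).
Qed.

Lemma last_zero (R : realType) (x : R -> R) (a b : R) : continuous x -> a < b ->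
  x a <= 0 -> 0 < x b -> exists2 c : R, a <= c < b & x c = 0 /\ forall t, c < t <= b ->
    0 < x t.
Proof.
move=> cx ab xa xb; pose S : set R := [set t | a <= t <= b /\ x t <= 0].
have Sa : S a by split; rewrite // lexx ltW.
have Sub : ubound S b by move=> t [/andP[]].
have supS : has_sup S by split; [exists a|exists b].
set c := sup S.
have ac : a <= c by apply: ub_le_sup => //; exists b.
have cb : c <= b by apply: ge_sup => //; exists a.
have gt t : c < t <= b -> 0 < x t.
  move=> /andP[ct tb]; rewrite ltNge; apply/negP => xt.
  have : t <= c by apply: ub_le_sup; [exists b|split; rewrite // tb (le_trans ac (ltW ct))].
  by rewrite leNgt ct.
have xc0 : x c <= 0.
  rewrite leNgt; apply/negP => xc.
  have [d d0 hd] := (cvg_realP _ _ _).1 (cx c) _ xc.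
  have [t [/andP[at_ tb] xt] ct] := sup_adherent d0 supS.
  have tc : t <= c by apply: ub_le_sup; [exists b|split; rewrite // at_ tb].
  have := hd t; rewrite !ltr_distl ct (le_lt_trans tc) ?ltrDl// => /(_ isT).
  by rewrite subrr ltNge xt.
have {}cb : c < b by rewrite lt_neqAle cb andbT; apply/eqP => E; move: xb;
  rewrite -E ltNge xc0.
exists c; first by rewrite ac.
split=> //; apply/eqP; rewrite eq_le xc0 /= leNgt; apply/negP => xc.
have xc' : 0 < - x c by rewrite oppr_gt0.
have [d d0 hd] := (cvg_realP _ _ _).1 (cx c) _ xc'.
have [t [ct tb td]] : exists t, [/\ c < t, t <= b & t < c + d].
  exists (c + Num.min d (b - c) / 2).
  by rewrite /Num.min; case: (ltP d (b - c)) => ?; split; lra.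
have := hd t; rewrite !ltr_distl td andbT (lt_trans _ ct) ?gtrDl ?oppr_lt0// =>
  /(_ isT)/andP[_].
by rewrite subrr ltNge ltW// gt// ct.
Qed.

(** The arc lives between the last zero of [x] before [b] and the first one after it, the latter
    being found by reversing time. The other sign of [y] at either end would mean a crossing in the
    wrong direction, against [x] being positive in between. *)
Lemma arc_exists (R : realType) (F1 f1 g1 F2 g2 x y : R -> R) (a b c : R) :
  side F1 f1 g1 -> regular_solution F1 g1 F2 g2 x y -> a < b -> b < c ->
  x a < 0 -> 0 < x b -> x c < 0 ->
  exists s S, arc F1 g1 (fun t => x (s + t)) (fun t => y (s + t)) S.
Proof.
move=> sd1 reg ab bc xa xb xc; have cx := regular_contx reg.
have [s /andP[as_ sb] [xs gts]] := last_zero cx ab (ltW xa) xb.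
have cxN : continuous (fun t => x (- t)).
  by move=> t; apply: (@continuous_comp _ _ _ -%R x); [exact: opp_continuous|exact: cx].
have bcN : - c < - b by rewrite ltrN2.
have [||r' /andP[cr rb] [xr gtr]] := last_zero cxN bcN; rewrite ?opprK//; first exact: ltW.
pose r := - r'; rewrite -/r in xr.
have br : b < r by rewrite ltrNr.
have xpos t : s < t < r -> 0 < x t.
  move=> /andP[st tr]; have [tb|bt] := leP t b; first by apply: gts; rewrite st.
  rewrite -[t]opprK; apply: gtr; rewrite lerN2 ltW// andbT.
  by rewrite ltrNr.
have sr : s < r by exact: lt_trans br.
have reg' := regular_shift s reg.
exists s, (r - s); split.
- by rewrite subr_gt0.
- exact: regular_contx reg'.
- exact: reg_conty reg'.
- by rewrite addr0.
- by rewrite addrC subrK.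
- by move=> t /andP[t0 tr]; apply: xpos; rewrite ltrDl t0 -ltrBrDl.
- move=> t /andP[t0 tr]; have xp : 0 < x (s + t) by apply: xpos; rewrite ltrDl t0 -ltrBrDl.
  by have := reg_x reg' t; rewrite /side_map (ltW xp).
- move=> t /andP[t0 tr]; have xp : 0 < x (s + t) by apply: xpos; rewrite ltrDl t0 -ltrBrDl.
  exact: reg_pos reg' _ xp.
- rewrite addr0; have [h1 h2] := regular_crossing sd1 reg xs.
  have [//|yp|/(reg_axis reg xs)//] := ltgtP (y s) 0.
  have [d d0 hd] := h2 yp.
  have [t [st tr td]] : exists t, [/\ s < t, t < r & t < s + d].
    exists (s + Num.min d (r - s) / 2).
    by rewrite /Num.min; case: (ltP d (r - s)) => ?; split; lra.
  have [|h _] := hd t; first by rewrite ltr_distl td (lt_trans _ st)// gtrDl oppr_lt0.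
  by have := h st; rewrite ltNge ltW// xpos// st.
- rewrite addrC subrK; have [h1 h2] := regular_crossing sd1 reg xr.
  have [yn|//|/(reg_axis reg xr)//] := ltgtP (y r) 0.
  have [d d0 hd] := h1 yn.
  have [t [st tr td]] : exists t, [/\ s < t, t < r & r - d < t].
    exists (r - Num.min d (r - s) / 2).
    by rewrite /Num.min; case: (ltP d (r - s)) => ?; split; lra.
  have [|_ h] := hd t; first by rewrite ltr_distl td (lt_trans tr)// ltrDl.
  by have := h tr; rewrite ltNge ltW// xpos// st.
Qed.

Lemma periodic_int (R : realType) (V : Type) (z : R -> V) (T : R) :
  (forall t, z (t + T) = z t) -> forall (n : int) t, z (t + T * n%:~R) = z t.
Proof.
move=> zT; have nat (n : nat) t : z (t + T * n%:R) = z t.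
  elim: n t => [|n IH] t; first by rewrite mulr0 addr0.
  by rewrite -natr1 mulrDr mulr1 addrA zT.
case=> n t; first exact: nat.
rewrite NegzE -[in RHS](subrK (T * n.+1%:R) t) nat; congr z.
by rewrite mulrNz mulrN.
Qed.

(** Translates of [a] by consecutive multiples of the period enclose [b], and [x] is negative at
    both. *)
Lemma periodic_arc_exists (R : realType) (F1 f1 g1 F2 g2 x y : R -> R) (T : R) :
  side F1 f1 g1 -> regular_solution F1 g1 F2 g2 x y -> 0 < T ->
  (forall t, x (t + T) = x t) -> (exists t, 0 < x t) -> (exists t, x t < 0) ->
  exists s S, arc F1 g1 (fun t => x (s + t)) (fun t => y (s + t)) S.
Proof.
move=> sd1 reg T0 xT [b xb] [a xa].
pose n := Num.floor ((b - a) / T).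
have /andP[h1 h2] := periodic_part_itv (b - a) T0.
have E1 : x (a + T * n%:~R) < 0 by rewrite periodic_int.
have E2 : x (a + T * (n + 1)%:~R) < 0 by rewrite periodic_int.
apply: (arc_exists sd1 reg _ _ E1 xb E2).
  have : a + T * n%:~R <= b by move: h1; rewrite /periodic_part -/n; lra.
  by rewrite le_eqVlt => /predU1P[E|//]; move: xb; rewrite -E ltNge ltW.
by move: h2; rewrite /periodic_part -/n intrD1; lra.
Qed.

(** * Neighborhoods of crossing periodic orbits *)

Definition loop (R : realType) (F1 g1 F2 g2 : R -> R) (G : set (R * R)) : Prop :=
  exists x1 y1 T1 x2 y2 T2, [/\ arc F1 g1 x1 y1 T1, arc F2 g2 x2 y2 T2,
    y2 0 = y1 0, y2 T2 = y1 T1 & G = closed_curve x1 y1 T1 x2 y2 T2].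

(** The bound by [F2 m] is strict so that nearby right arcs satisfy it as well and can be
    transferred. *)
Definition matched_loop (R : realType) (F1 g1 F2 g2 : R -> R) (G : set (R * R)) : Prop :=
  exists x1 y1 T1 x2 y2 T2 m, [/\ arc F1 g1 x1 y1 T1 /\ arc F2 g2 x2 y2 T2,
    arcs_match F1 x1 y1 T1 F2 x2 y2 T2, 0 <= m,
    forall t : R, 0 <= t <= T1 -> F1 (x1 t) < F2 m & G = closed_curve x1 y1 T1 x2 y2 T2].

(** The first clause fills neighborhoods with loops, inside any prescribed neighborhood of [G]; this
    gives the annulus. The second guarantees points off [G] near some point of [G], so that not all
    these loops are [G] itself; together they exclude limit cycles. *)
Definition surrounded (R : realType) (F1 g1 F2 g2 : R -> R) (G : set (R * R)) : Prop :=
  (forall U : set (R * R), (forall q, G q -> nbhs q U) -> forall q0, G q0 ->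
    nbhs q0 [set q | exists G', [/\ loop F1 g1 F2 g2 G', G' q & G' `<=` U]]) /\
  (exists2 q0, G q0 & forall N, nbhs q0 N -> exists2 q, N q & ~ G q).

Definition mirror (R : realType) (q : R * R) : R * R := (- q.1, q.2).

Lemma mirrorK (R : realType) : involutive (@mirror R).
Proof. by case=> a b; rewrite /mirror /= opprK. Qed.

Lemma mirror_cont (R : realType) : continuous (@mirror R).
Proof.
move=> q; have c1 : {for q, continuous (fun q : R * R => - q.1)}.
  by apply: cvgN; exact: cvg_fst.
have c2 : {for q, continuous (snd : R * R -> R)} by exact: cvg_snd.
exact: (cvg_pair c1 c2).
Qed.

Lemma loop_mirror (R : realType) (F1 g1 F2 g2 : R -> R) (G : set (R * R)) :
  loop F1 g1 F2 g2 G -> loop F2 g2 F1 g1 (@mirror R @^-1` G).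
Proof.
move=> [x1 [y1 [T1 [x2 [y2 [T2 [a1 a2 y0 yT ->]]]]]]].
exists x2, y2, T2, x1, y1, T1; split => //; apply/seteqP.
split=> -[a b]; rewrite /closed_curve /mirror /=.
  case=> -[t tT [E1 E2]]; [right|left]; exists t => //.
    by rewrite -E1 -E2 opprK.
  by rewrite -[a]opprK E1 E2 opprK.
case=> -[t tT [E1 E2]]; [right|left]; exists t => //.
  by rewrite E1 E2.
by rewrite E1 E2 opprK.
Qed.

Lemma loop_crossing (R : realType) (F1 f1 g1 F2 f2 g2 : R -> R) (G : set (R * R)) :
  side F1 f1 g1 -> side F2 f2 g2 -> loop F1 g1 F2 g2 G ->
  crossing_periodic_orbit (inclusion F1 g1 F2 g2) G.
Proof.
move=> sd1 sd2 [x1 [y1 [T1 [x2 [y2 [T2 [a1 a2 y0 yT GE]]]]]]].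
have T10 := arc_gt0 a1; have T20 := arc_gt0 a2.
have [z [z1 z2 z3 z4 z5]] := glue_arcs sd1 sd2 a1 a2 y0 yT.
split.
- exists z, (T1 + T2); split => //; first exact: addr_gt0.
  by rewrite GE.
- exists (x1 (T1 / 2), y1 (T1 / 2)); last by apply: (arc_pos a1); lra.
  by rewrite GE; left; exists (T1 / 2) => //; lra.
- exists (- x2 (T2 / 2), y2 (T2 / 2)); last by rewrite oppr_lt0; apply: (arc_pos a2); lra.
  by rewrite GE; right; exists (T2 / 2) => //; lra.
Qed.

Lemma surrounded_mirror (R : realType) (F1 g1 F2 g2 : R -> R) (G : set (R * R)) :
  surrounded F2 g2 F1 g1 (@mirror R @^-1` G) -> surrounded F1 g1 F2 g2 G.
Proof.
move=> [h1 [q0 Gq0 h2]]; split=> [U GU q Gq|].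
  have GU' p : (@mirror R @^-1` G) p -> nbhs p (@mirror R @^-1` U).
    by move=> /= /GU; exact: mirror_cont.
  have Gq' : (@mirror R @^-1` G) (mirror q) by rewrite /= mirrorK.
  have n1 : nbhs q (@mirror R @^-1` [set p | exists G',
      [/\ loop F2 g2 F1 g1 G', G' p & G' `<=` @mirror R @^-1` U]]).
    exact: (@mirror_cont R q _ (h1 _ GU' _ Gq')).
  apply: (filterS _ n1) => p [G' [lG Gp GU'']].
  exists (@mirror R @^-1` G'); split => //; first exact: loop_mirror.
  by move=> r /= /GU''; rewrite /= mirrorK.
exists (mirror q0) => // N nN.
have nN' : nbhs q0 (@mirror R @^-1` N) by exact: mirror_cont.
have [q Nq nGq] := h2 _ nN'; exists (mirror q) => //.
Qed.

(** The right arc, transferred and glued, gives a closed solution that starts where the given one is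
    at time [s]. Forward uniqueness identifies the two from there on, and by periodicity nonnegative
    times cover both ranges. *)
Lemma regular_matched_loop (R : realType) (F1 f1 g1 F2 f2 g2 x y : R -> R) (T s S m : R) :
  side F1 f1 g1 -> side F2 f2 g2 -> same_ratio f1 g1 F1 f2 g2 F2 ->
  regular_solution F1 g1 F2 g2 x y -> 0 < T ->
  (forall t, x (t + T) = x t) -> (forall t, y (t + T) = y t) ->
  arc F1 g1 (fun t => x (s + t)) (fun t => y (s + t)) S -> 0 <= m ->
  (forall t : R, 0 <= t <= S -> F1 (x (s + t)) < F2 m) ->
  matched_loop F1 g1 F2 g2 (range (fun t => (x t, y t))).
Proof.
move=> sd1 sd2 rat reg T0 xT yT a m0 xm.
have [X [Y [S2 [a2 mt]]]] := arc_transfer sd1 sd2 rat a m0 xm.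
exists (fun t => x (s + t)), (fun t => y (s + t)), S, X, Y, S2, m; split => //.
have [E0 ES _ _] := mt.
have [z [z1 z2 z3 z4 z5]] := glue_arcs sd1 sd2 a a2 E0 ES.
rewrite z4; set P := S + S2 in z2; have P0 : 0 < P
  by rewrite addr_gt0 ?(arc_gt0 a) ?(arc_gt0 a2).
have regz := filippov_regular sd1 sd2 rat z1 z3.
have reg' := regular_shift s reg.
have zE u : 0 <= u -> z u = (x (s + u), y (s + u)).
  move=> u0; have [||<- <-] := regular_unique sd1 sd2 regz reg' _ _ u0.
  - by rewrite z5 (arc_x0 a).
  - by rewrite z5.
  - by case: (z u).
apply/seteqP; split=> _ [t _ <-].
  pose u := periodic_part T (t - s).
  have /andP[u0 _] := periodic_part_itv (t - s) T0.
  exists u => //; rewrite zE//.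
  have E : t = (s + u) + T * (Num.floor ((t - s) / T))%:~R by rewrite /u /periodic_part; ring.
  by rewrite [in RHS]E (periodic_int xT) (periodic_int yT).
pose u := periodic_part P t.
have /andP[u0 _] := periodic_part_itv t P0.
exists (s + u) => //; rewrite -zE//.
have E : t = u + P * (Num.floor (t / P))%:~R by rewrite /u /periodic_part; ring.
by rewrite [in RHS]E (periodic_int z2).
Qed.

Lemma arc_max (R : realType) (F f g x y : R -> R) (T : R) : side F f g -> arc F g x y T ->
  exists2 c : R, 0 <= c & (exists2 t : R, 0 <= t <= T & x t = c) /\
    forall t : R, 0 <= t <= T -> F (x t) <= F c.
Proof.
move=> sd a; have cx : {within `[0, T], continuous (fun t => F (x t))}.
  apply: continuous_subspaceT => t; apply: (@continuous_comp _ _ _ x F);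
    first exact: arc_contx a _.
  exact: side_contF sd _.
have [c cT hc] := EVT_max (ltW (arc_gt0 a)) cx; rewrite in_itv /= in cT.
exists (x c); first exact: arc_x_ge0 a _ cT.
by split; [exists c|move=> t tT; apply: hc; rewrite in_itv].
Qed.

Lemma matched_loop_surrounded (R : realType) (F1 f1 g1 F2 f2 g2 : R -> R) (G : set (R * R)) :
  side F1 f1 g1 -> side F2 f2 g2 -> same_ratio f1 g1 F1 f2 g2 F2 ->
  matched_loop F1 g1 F2 g2 G -> surrounded F1 g1 F2 g2 G.
Proof.
move=> sd1 sd2 rat [x1 [y1 [T1 [x2 [y2 [T2 [m [[a1 a2] mt m0 xm ->]]]]]]]].
have [Y0 YT m1 m2] := mt; have T10 := arc_gt0 a1; have T20 := arc_gt0 a2.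
have [hh1 [hm1 ch1 hE1]] := side_ext sd1; have [hh2 [hm2 ch2 hE2]] := side_ext sd2.
have [k1 [kh1 ck1 _]] := strict_mono_inverse hm1 ch1.
have [k2 [kh2 ck2 _]] := strict_mono_inverse hm2 ch2.
have cF1 : continuous F1 by exact: side_contF sd1.
have cF2 : continuous F2 by exact: side_contF sd2.
have x1ge := arc_x_ge0 a1; have x2ge := arc_x_ge0 a2.
have k1E u v : 0 <= u -> F1 u = v -> k1 v = u by move=> u0 <-; rewrite -hE1// kh1.
have k2E u v : 0 <= u -> F2 u = v -> k2 v = u by move=> u0 <-; rewrite -hE2// kh2.
have T100 : (0 : R) <= 0 <= T1 by rewrite lexx ltW.
split=> [U GU q0 Gq0|]; last first.
  exists (x1 0, y1 0); first by left; exists 0.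
  move=> N /nbhs_ballP[r /= r0 hr].
  have y10 := arc_y0 a1.
  (* The curve meets the y-axis only at the heights [y1 0 < 0] and [y1 T1 > 0], so the points of the
     axis just below the first are free. *)
  pose v := y1 0 - r / 2.
  exists (0, v).
    apply: hr; split; first by rewrite /= (arc_x0 a1); exact: ballxx.
    rewrite /ball /= /v opprB addrC subrK gtr0_norm; lra.
  have v0 : v < 0 by rewrite /v; lra.
  have y0v : v != y1 0 by rewrite /v; apply/eqP; lra.
  have key (x y : R -> R) T F g : arc F g x y T -> y 0 = y1 0 -> y T = y1 T1 ->
      forall t, 0 <= t <= T -> x t = 0 -> v <> y t.
    move=> a E0 ET t /andP[t0 tT] xt vE.
    move: t0; rewrite le_eqVlt => /predU1P[Z|t0].
      by move: y0v; rewrite vE -Z E0 eqxx.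
    move: tT; rewrite le_eqVlt => /predU1P[Z|tT].
      by have := arc_yT a; rewrite -Z -vE ltNge ltW.
    have tT' : 0 < t < T by rewrite t0.
    by have := arc_pos a tT'; rewrite xt ltxx.
  case=> -[t tT [E1 E2]].
    exact: (key _ _ _ _ _ a1 erefl erefl t tT (esym E1) E2).
  apply: (key _ _ _ _ _ a2 Y0 YT t tT _ E2).
  by apply/eqP; rewrite -oppr_eq0 -E1.
(* [- C u] is the abscissa on the left at which F has the value it has at [u] on the right. Right
   arcs inside [V] can be transferred, and they stay in [U] together with their left
   counterparts. *)
pose C u := k2 (F1 u).
pose V : set (R * R) := [set p | [/\ U p, U (- C p.1, p.2) & F1 p.1 < F2 m]].
have nV t : 0 <= t <= T1 -> nbhs (x1 t, y1 t) V.
  move=> tT; have [t' tT' [E1 E2]] := m2 t tT.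
  have CE : C (x1 t) = x2 t' by apply: k2E => //; exact: x2ge.
  have cC : {for x1 t, continuous C}.
    apply: (@continuous_comp _ _ _ F1 k2); first exact: cF1.
    by rewrite /= -E2 -hE2 ?x2ge//; exact: ck2.
  have n1 : nbhs (x1 t, y1 t) U by apply: GU; left; exists t.
  have n2 : nbhs (x1 t, y1 t) [set p | U (- C p.1, p.2)].
    have cg : {for (x1 t, y1 t), continuous (fun p : R * R => (- C p.1, p.2))}.
      have c1 : {for (x1 t, y1 t), continuous (fun p : R * R => - C p.1)}.
        by apply: cvgN; apply: (@cvg_comp _ _ _ fst C); [exact: cvg_fst|exact: cC].
      have c2 : {for (x1 t, y1 t), continuous (snd : R * R -> R)} by exact: cvg_snd.
      exact: (cvg_pair c1 c2).
    apply: cg; apply: GU; right; exists t' => //.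
    by rewrite /= CE E1.
  have n3 : nbhs (x1 t, y1 t) [set p | F1 p.1 < F2 m].
    have cg : {for (x1 t, y1 t), continuous (fun p : R * R => F1 p.1)}.
      by apply: (@cvg_comp _ _ _ fst F1); [exact: cvg_fst|exact: cF1].
    by apply: (cg [set v | v < F2 m]); apply: lt_nbhsl; exact: xm.
  by apply: filterS (filterI n1 (filterI n2 n3)) => p [? [? ?]].
(* [Psi] folds the left half-plane onto the right one along the values of [F1] and
   [F2]. *)
pose Psi u := Num.max u 0 + k1 (F2 (Num.max (- u) 0)).
have k10 : k1 (F2 0) = 0 by apply: k1E => //; rewrite (side_0 sd1) (side_0 sd2).
have PsiP u : 0 <= u -> Psi u = u.
  by move=> u0; rewrite /Psi max_l// max_r ?oppr_le0// k10 addr0.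
have PsiN u : u <= 0 -> Psi u = k1 (F2 (- u)).
  by move=> u0; rewrite /Psi max_r// max_l ?oppr_ge0// add0r.
have [s sT [Ps ys [w w0 Fw]]] : exists2 s : R, 0 <= s <= T1 &
    [/\ Psi q0.1 = x1 s, q0.2 = y1 s & exists2 w, 0 <= w & F2 (Num.max (- q0.1) 0) = F1 w].
  case: Gq0 => -[t tT ->] /=.
    exists t => //; split => //; first by rewrite PsiP ?x1ge.
    by exists 0 => //; rewrite max_r ?oppr_le0 ?x1ge// (side_0 sd1) (side_0 sd2).
  have [s sT [E1 E2]] := m1 t tT; exists s => //; split => //.
    by rewrite PsiN ?oppr_le0 ?x2ge// opprK; apply: k1E; [exact: x1ge|rewrite E2].
  by exists (x1 s); [exact: x1ge|rewrite opprK max_l ?x2ge].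
have [r r0 hr] := arc_perturb sd1 a1 nV sT.
have cmN : continuous (fun u : R => F2 (Num.max (- u) 0)).
  move=> u; apply: (@continuous_comp _ _ _ (fun u : R => Num.max (- u) 0) F2);
    last exact: cF2.
  apply: (@continuous_max _ _ (fun u : R => - u) (fun=> 0)); last exact: cvg_cst.
  exact: opp_continuous.
have cPsi : {for q0.1, continuous Psi}.
  apply: continuousD.
    by apply: (@continuous_max _ _ id (fun=> 0)); [exact: cvg_id|exact: cvg_cst].
  apply: (@continuous_comp _ _ _ (fun u : R => F2 (Num.max (- u) 0)) k1); first exact: cmN.
  by rewrite /= Fw -hE1//; exact: ck1.
have n1 : nbhs q0 [set q | `|Psi q.1 - x1 s| < r].
  have cg : {for q0, continuous (fun q : R * R => Psi q.1)}.
    by apply: (@cvg_comp _ _ _ fst Psi); [exact: cvg_fst|exact: cPsi].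
  apply: (cg [set v | `|v - x1 s| < r]); rewrite /= Ps.
  by apply/nbhs_ballP; exists r => // v; rewrite /ball /= distrC.
have n2 : nbhs q0 [set q | `|q.2 - y1 s| < r].
  have cg : {for q0, continuous (snd : R * R -> R)} by exact: cvg_snd.
  apply: (cg [set v | `|v - y1 s| < r]); rewrite /= ys.
  by apply/nbhs_ballP; exists r => // v; rewrite /ball /= distrC.
(* This keeps the values of [F2] on the left within the range of [F1], where [k1] is a true
   inverse. *)
have n3 : nbhs q0 [set q | F2 (Num.max (- q.1) 0) < F1 (w + 1)].
  have cg : {for q0, continuous (fun q : R * R => F2 (Num.max (- q.1) 0))}.
    by apply: (@cvg_comp _ _ _ fst (fun u : R => F2 (Num.max (- u) 0)));
      [exact: cvg_fst|exact: cmN].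
  apply: (cg [set v | v < F1 (w + 1)]); apply: lt_nbhsl; rewrite Fw.
  by apply: (side_mono sd1) => //; rewrite ltrDl.
apply: filterS (filterI n1 (filterI n2 n3)) => q [/= q1 [q2 q3]].
have [p0 pq] : 0 <= Psi q.1 /\ (q.1 <= 0 -> F1 (Psi q.1) = F2 (- q.1)).
  have [q10|q10] := leP q.1 0; last by rewrite PsiP ltW//; split => // h.
  rewrite PsiN//; rewrite max_l ?oppr_ge0// in q3.
  have [p /andP[p0 _] Fp] : exists2 p : R, 0 <= p <= w + 1 & F1 p = F2 (- q.1).
    apply: ivt_pt; first exact: addr_ge0.
      by move=> u _; exact: cF1.
    by rewrite (side_0 sd1) (side_ge0 sd2) ?oppr_ge0// ltW.
  by rewrite (k1E p)//.
have [X [Y [S [aX [t0 t0S [Xt0 Yt0]] XV]]]] := hr _ _ q1 q2 p0.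
have Xm t : 0 <= t <= S -> F1 (X t) < F2 m by move=> /XV[].
have [X2 [Y2 [S2 [aX2 mX]]]] := arc_transfer sd1 sd2 rat aX m0 Xm.
have [Z0 ZS n1' n2'] := mX.
exists (closed_curve X Y S X2 Y2 S2); split.
- by exists X, Y, S, X2, Y2, S2.
- have [q10|q10] := leP 0 q.1.
    left; exists t0 => //; rewrite Xt0 Yt0 PsiP//.
    by case: (q).
  right; have [t tS [E1 E2]] := n2' t0 t0S; exists t => //.
  rewrite E1 Yt0; have -> : X2 t = - q.1; last by rewrite opprK; case: (q).
  apply: (side_inj sd2); [exact: arc_x_ge0 aX2 _ tS|by rewrite oppr_ge0 ltW|].
  by rewrite E2 Xt0 pq// ltW.
- move=> _ [[t tS ->]|[t tS ->]]; first by have [] := XV t tS.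
  have [u uS [E1 E2]] := n1' t tS; have [_ + _] := XV u uS.
  rewrite /= E1; have -> : C (X u) = X2 t; last by [].
  by apply: k2E => //; exact: arc_x_ge0 aX2 _ tS.
Qed.

Lemma crossing_orbit_surrounded (R : realType) (F1 f1 g1 F2 f2 g2 : R ->
  R) (G : set (R * R)) :
  side F1 f1 g1 -> side F2 f2 g2 -> same_ratio f1 g1 F1 f2 g2 F2 ->
  crossing_periodic_orbit (inclusion F1 g1 F2 g2) G -> surrounded F1 g1 F2 g2 G.
Proof.
move=> sd1 sd2 rat [[z [T [zsol T0 zT zneq GE]]] [qp Gp qp0] [qn Gn qn0]].
have reg := filippov_regular sd1 sd2 rat zsol zneq.
have regN := regular_mirror sd1 sd2 reg.
rewrite GE in Gp Gn; case: Gp => tp _ zp; case: Gn => tn _ zn.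
have [||| s [S a]] := periodic_arc_exists sd1 reg T0.
- by move=> t; rewrite zT.
- by exists tp; rewrite zp.
- by exists tn; rewrite zn.
have zTN (V : Type) (f : R * R -> V) t : f (z (- (t + T))) = f (z (- t)).
  by rewrite -[in RHS](subrK T (- t)) zT opprD.
have [||| s' [S' a']] := periodic_arc_exists sd2 regN T0.
- by move=> t; rewrite (zTN _ (fun q => - q.1)).
- by exists (- tn); rewrite opprK zn oppr_gt0.
- by exists (- tp); rewrite opprK zp oppr_lt0.
have [c c0 [_ hc]] := arc_max sd1 a; have [c' c'0 [_ hc']] := arc_max sd2 a'.
have [cc|cc] := leP (F1 c) (F2 c').
  have GE' : G = range (fun t => ((z t).1, (z t).2)).
    rewrite GE; have -> // : (fun t => ((z t).1, (z t).2)) = z.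
    by apply/funext => t; case: (z t).
  rewrite GE'; apply: (matched_loop_surrounded sd1 sd2 rat).
  (* The two maxima may be equal, whereas a strict bound is required; hence [c' + 1] instead of
     [c']. *)
  apply: (regular_matched_loop (m := c' + 1) sd1 sd2 rat reg T0 _ _ a) => [t|t||t tS].
  - by rewrite zT.
  - by rewrite zT.
  - by rewrite addr_ge0.
  - apply: le_lt_trans (hc t tS) _; apply: le_lt_trans cc _.
    by apply: (side_mono sd2) => //; rewrite ltrDl.
apply: surrounded_mirror.
have -> : @mirror R @^-1` G = range (fun t => (- (z (- t)).1, (z (- t)).2)).
  rewrite GE; apply/seteqP; split=> [q [t _ zt]|_ [t _ <-]].
    by exists (- t) => //; rewrite opprK zt; case: (q) => u v; rewrite /= opprK.
  by exists (- t) => //; rewrite /mirror /= opprK; case: (z (- t)).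
have rat' := same_ratio_sym rat.
apply: (matched_loop_surrounded sd2 sd1 rat').
apply: (regular_matched_loop (m := c) sd2 sd1 rat' regN T0 _ _ a') => [t|t||t tS].
- by rewrite (zTN _ (fun q => - q.1)).
- by rewrite (zTN _ snd).
- exact: c0.
- exact: le_lt_trans (hc' t tS) cc.
Qed.

(** * The smooth Lienard system *)

Lemma C1_lip (R : realType) (h dh : R -> R) :
  (forall x : R, is_derive x (1 : R) h (dh x)) -> continuous dh ->
  forall M : R, exists2 L : R, 0 <= L & forall x y : R, `|x| <= M -> `|y| <= M ->
    `|h x - h y| <= L * `|x - y|.
Proof.
move=> hd cd M; have [M0|M0] := ltP M 0.
  by exists 0 => // x y xM; have := le_lt_trans xM M0; rewrite ltNge normr_ge0.
have MM : - M <= M by lra.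
have cd' : {within `[- M, M], continuous (fun t => `|dh t|)}.
  by apply: continuous_subspaceT => t; apply: cvg_norm; exact: cd.
have [c cM hc] := EVT_max MM cd'; exists `|dh c| => // x y.
rewrite [`|x| <= M]ler_norml [`|y| <= M]ler_norml => xM yM.
have main s t : s < t -> - M <= s -> t <= M -> `|h t - h s| <= `|dh c| * `|t - s|.
  move=> st sM tM; have [r /andP[sr rt] ->] : exists2 r : R,
    s < r < t & h t - h s = dh r * (t - s).
    by apply: MVT_pt => // r _; exact: is_derive_cont (hd r).
  rewrite normrM ler_wpM2r// hc// in_itv /= (le_trans sM (ltW sr))/=.
  exact: le_trans (ltW rt) tM.
have /andP[x1 x2] := xM; have /andP[y1 y2] := yM.
have [xy|yx|->] := ltgtP x y.
- by rewrite (distrC (h x)) (distrC x) main.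
- by rewrite main.
- by rewrite !subrr normr0 mulr0.
Qed.

Lemma smooth_C1 (R : realType) (f : R -> R) : smooth f ->
  (forall x : R, is_derive x (1 : R) f (f^`()%classic x)) /\ continuous (f^`()%classic).
Proof.
move=> sf; split=> x.
  by split; [exact: (sf 0%N x)|rewrite derive1E].
by apply: differentiable_continuous; apply/derivable1_diffP; exact: (sf 1%N x).
Qed.

Lemma smooth_side (R : realType) (f g : R -> R) : smooth f -> smooth g ->
  (forall x : R, 0 < x -> 0 < f x) -> side (primitive0 f) f g.
Proof.
move=> /smooth_C1[df cdf] /smooth_C1[dg cdg] fpos.
have cf : continuous f by move=> x; exact: is_derive_cont (df x).
split => // [||M]; first exact: primitive0_0.
  exact: primitive0_is_derive.
have [L1 L10 h1] := C1_lip (primitive0_is_derive cf) cf M.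
have [L2 L20 h2] := C1_lip dg cdg M.
exists (L1 + L2) => [|x y xM yM]; first exact: addr_ge0.
split; first by apply: le_trans (h1 x y xM yM) _; rewrite ler_wpM2r// lerDl.
by apply: le_trans (h2 x y xM yM) _; rewrite ler_wpM2r// lerDr.
Qed.

Lemma side_reflect (R : realType) (f g : R -> R) : smooth f -> smooth g ->
  (forall x : R, x < 0 -> f x < 0) ->
  side (fun x => primitive0 f (- x)) (fun x => - f (- x)) (fun x => - g (- x)).
Proof.
move=> /smooth_C1[df cdf] /smooth_C1[dg cdg] fneg.
have cf : continuous f by move=> x; exact: is_derive_cont (df x).
have cN (u : R -> R) : continuous u -> continuous (fun x => - u (- x)).
  move=> cu x; apply: continuousN.
  by apply: (@continuous_comp _ _ _ -%R u); [exact: opp_continuous|exact: cu].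
have dN (u du : R -> R) (x : R) : (forall x : R, is_derive x (1 : R) u (du x)) ->
    is_derive x (1 : R) (fun x => u (- x)) (- du (- x)).
  move=> hu; rewrite -[X in is_derive _ _ _ X]mulrN1.
  exact: (is_derive1_comp (f := u) (hu (- x)) (is_deriveNid x 1)).
have dF x := dN _ _ x (primitive0_is_derive cf).
have dG (x : R) : is_derive x (1 : R) (fun x => - g (- x)) (- - g^`()%classic (- x)).
  exact: is_deriveN (dN _ _ x dg).
have cdG : continuous (fun x => - - g^`()%classic (- x)).
  by move=> x; exact: (cvgN (cN _ cdg x)).
split => // [|||M].
- by rewrite oppr0 primitive0_0.
- exact: cN.
- by move=> x x0; rewrite oppr_gt0 fneg// oppr_lt0.
have [L1 L10 h1] := C1_lip dF (cN _ cf) M.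
have [L2 L20 h2] := C1_lip dG cdG M.
exists (L1 + L2) => [|x y xM yM]; first exact: addr_ge0.
split; first by apply: le_trans (h1 x y xM yM) _; rewrite ler_wpM2r// lerDl.
by apply: le_trans (h2 x y xM yM) _; rewrite ler_wpM2r// lerDr.
Qed.

(** The limit is the supremum of the strictly increasing extension of [F], and [F u] is already
    exceeded at [u + 1]. Thus attained values of p lie strictly below p^+ and p^-. *)
Lemma side_lt_lim (R : realType) (F f g : R -> R) (u : R) : side F f g -> 0 <= u ->
  ((F u)%:E < lim ((F x)%:E @[x --> +oo%R]))%E.
Proof.
move=> sd u0; have [h [hm _ hE]] := side_ext sd.
have nd : nondecreasing_fun (fun x => (h x)%:E).
  move=> x y; rewrite le_eqVlt => /predU1P[->//|/hm/ltW].
  by rewrite lee_fin.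
have cv : (F x)%:E @[x --> +oo] --> ereal_sup (range (fun x => (h x)%:E)).
  apply: cvg_trans (nondecreasing_cvge nd); apply: near_eq_cvg.
  by near=> x; rewrite hE//; near: x; apply: nbhs_pinfty_ge; rewrite num_real.
rewrite (cvg_lim _ cv)//; apply: (@lt_le_trans _ _ (h (u + 1))%:E).
  by rewrite lte_fin -(hE u u0); apply: hm; rewrite ltrDl.
by apply: ereal_sup_ubound; exists (u + 1).
Unshelve. all: by end_near. Qed.

Theorem theorem1p3 (R : realType) (fp fm gp gm : R -> R)
  (fp_smooth : smooth fp) (fm_smooth : smooth fm)
  (gp_smooth : smooth gp) (gm_smooth : smooth gm)
  (fp_pos : forall x : R, 0 < x -> 0 < fp x)
  (fm_neg : forall x : R, x < 0 -> fm x < 0)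
  (etap etam : R)
  (lim_etap : gp (xplus fp p) / fp (xplus fp p) @[p --> (0 : R)^'+] --> etap)
  (lim_etam : gm (xminus fm p) / fm (xminus fm p) @[p --> (0 : R)^'+] --> etam)
  (ratio_eq : forall p : R, 0 < p ->
     (p%:E < Order.min (pplus fp) (pminus fm))%E ->
     gp (xplus fp p) / fp (xplus fp p) = gm (xminus fm p) / fm (xminus fm p)) :
  (forall G : set (R * R),
     crossing_periodic_orbit (lienard_inclusion fp fm gp gm) G ->
     exists A : set (R * R),
       periodic_annulus (lienard_inclusion fp fm gp gm) G A) /\
  ~ (exists G : set (R * R),
       crossing_limit_cycle (lienard_inclusion fp fm gp gm) G).
Proof.
pose F2 x := primitive0 fm (- x); pose f2 x := - fm (- x); pose g2 x := - gm (- x).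
have sd1 : side (primitive0 fp) fp gp by exact: smooth_side.
have sd2 : side F2 f2 g2 by exact: side_reflect.
have -> : lienard_inclusion fp fm gp gm = inclusion (primitive0 fp) gp F2 g2.
  rewrite /lienard_inclusion /inclusion; congr filippov_field; apply/funext => q.
  by rewrite /lienard_field /F2 /g2 !opprK.
(* For p = F^+(u) = F^-(-v) one has x^+(p) = u and x^-(p) = -v. Being attained on both sides, p lies
   below both limits, and the ratio hypothesis applies. *)
have rat : same_ratio fp gp (primitive0 fp) f2 g2 F2.
  move=> u v u0 v0 E.
  have p0 : 0 < primitive0 fp u by rewrite -(side_0 sd1); exact: side_mono sd1 _ _ _ _.
  have pp : ((primitive0 fp u)%:E < pplus fp)%E by apply: (side_lt_lim sd1); exact: ltW.
  have pm : ((primitive0 fp u)%:E < pminus fm)%E.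
    rewrite E; have := side_lt_lim sd2 (ltW v0).
    suff -> : pminus fm = lim ((F2 x)%:E @[x --> +oo]) by [].
    by rewrite /pminus -ninfty.
  have xpE : xplus fp (primitive0 fp u) = u.
    apply: pinvKV; last by rewrite inE /= in_itv /= andbT ltW.
    move=> a b; rewrite !inE /= !in_itv /= !andbT => a0 b0.
    exact: side_inj sd1 _ _ a0 b0.
  have xmE : xminus fm (primitive0 fp u) = - v.
    rewrite E; apply: pinvKV; last by rewrite inE /= in_itv /= oppr_le0 ltW.
    move=> a b; rewrite !inE /= !in_itv /= -oppr_ge0 -[b <= 0]oppr_ge0 => a0 b0 ab.
    by apply: oppr_inj; apply: (side_inj sd2 a0 b0); rewrite /F2 !opprK.
  have := ratio_eq _ p0; rewrite lt_min pp pm xpE xmE => /(_ isT) H.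
  have fu : fp u != 0 by rewrite lt0r_neq0// fp_pos.
  have fv : fm (- v) != 0 by rewrite lt_eqF// fm_neg// oppr_lt0.
  have -> : gp u = gm (- v) / fm (- v) * fp u by rewrite -H divfK.
  by rewrite /f2 /g2; field.
have surr G : crossing_periodic_orbit (inclusion (primitive0 fp) gp F2 g2) G ->
    surrounded (primitive0 fp) gp F2 g2 G by exact: (crossing_orbit_surrounded sd1 sd2 rat).
split=> [G /surr[h _]|[G [/surr[h [q0 Gq0 hq]] [U GU only]]]].
  (* The union of all loops: no loop through one of its points can leave it. *)
  exists [set q | exists G', loop (primitive0 fp) gp F2 g2 G' /\ G' q].
  split=> [q Gq|q [G' [lG' Gq]]].
    have /(_ (fun _ _ => filterT) q Gq) := h setT.
    by apply: filterS => p [G' [lG' Gp _]]; exists G'.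
  exists G'; split => //; first exact: (loop_crossing sd1 sd2).
  by move=> p Gp; exists G'.
have GU' q : G q -> nbhs q U by move=> Gq; exact: GU.
(* A point near [q0] but off [G] lies on a loop inside [U], which isolation would force to equal
   [G]. *)
have [q [G' [lG' G'q G'U]] nGq] := hq _ (h U GU' q0 Gq0).
by apply: nGq; rewrite -(only G')//; exact: (loop_crossing sd1 sd2).
Qed.
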